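(* For any integer $n\geq 0$, let $l_n$ denote the first-passage time between $(0,0)$ and $(n,0)$ in the ladder graph $G_n$ with independent mean-one exponential edge weights. Let $\chi=\frac32-\frac{J_1(2)}{2J_2(2)}$, $f(r,x,y,z)=\min\{r+y+z,\,x\}$ and $\bar f=f-\chi$. Then there exists a positive constant $\sigma^2$ such that $$\frac{l_n-n\chi}{\sqrt n}\xrightarrow{\ d\ }N(0,\sigma^2)\qquad (n\to\infty),$$ where $N(0,\sigma^2)$ is a normally distributed random variable with mean zero and variance $\sigma^2$ and $\xrightarrow{d}$ denotes convergence in distribution. Moreover, $$\sigma^2=\int_{\mathbb R\times\mathbb R_+^3}\bar f(m)^2\,\tilde\pi(\mathrm dm)+2\sum_{n=1}^\infty\int_{\mathbb R\times\mathbb R_+^3}\bar f(m)\,P^n\bar f(m)\,\tilde\pi(\mathrm dm),$$ where $$P^n\bar f(m)=\mathbb E\left[\bar f(M_n)\mid M_0=m\right]=\int_{\mathbb R\times\mathbb R_+^3}\bar f(m')\,\tilde K^n(m,m')\,\mathrm dm'.$$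
   Context: Ladder graph: $G_n$ has vertex set $\{0,\ldots,n\}\times\{0,1\}$ and edges $((i,0),(i+1,0))$ and $((i,1),(i+1,1))$ for $0\le i<n$, and $((i,0),(i,1))$ for $0\le i\le n$. All edge weights are independent exponential random variables with mean one, and the weights for different $n$ are the restrictions of one common family on $\mathbb N\times\{0,1\}$. Write $X_i$ for the weight of the edge between $(i-1,0)$ and $(i,0)$, $Y_i$ for the weight of the edge between $(i-1,1)$ and $(i,1)$ ($i\ge1$), and $Z_i$ for the weight of the rung between $(i,0)$ and $(i,1)$ ($i\ge 0$). The first-passage time between two vertices is the infimum, over all paths joining them, of the sum of the weights of the edges of the path. $l_n$ (resp. $l_n'$) is the first-passage time in $G_n$ from $(0,0)$ to $(n,0)$ (resp. to $(n,1)$), and $\Delta_n=l_n'-l_n$. One has $$\Delta_n=\min\{\Delta_{n-1}+Y_n,\,X_n+Z_n\}-\min\{\Delta_{n-1}+Y_n+Z_n,\,X_n\},$$ so $(\Delta_n)_{n\ge0}$ is a Markov chain on $\mathbb R$. The associated Markov chain $M_n=(\Delta_n,X_{n+1},Y_{n+1},Z_{n+1})$ has state space $\mathbb R\times\mathbb R_+^3$, whose elements are written $m=(r,x,y,z)$; transition kernels are considered for arbitrary starting points. $\mathbb R_+$ is the set of positive reals. The $n$-step transition kernel $\tilde K^n$ is defined by $\tilde K^n(m',m)\,\mathrm dm=\mathbb P(M_n\in \mathrm dm\mid M_0=m')$ (in the sense of measures/distributions in $m$; for $n=1$ it contains a Dirac mass in the first coordinate). $\tilde\pi$ is the stationary distribution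 of $(M_n)$, namely $$\tilde\pi(\mathrm dm)=e^{-(x+y+z)}\,\mathrm dx\,\mathrm dy\,\mathrm dz\;\pi(\mathrm dr),\qquad \pi(\mathrm dr)=\frac{1}{2J_2(2)}e^{-\frac32|r|}J_1\!\left(2e^{-\frac12|r|}\right)\mathrm dr.$$ $J_\nu$ denotes the Bessel function of the first kind of order $\nu$. *)

(* Defs.v *)
From HB Require Import structures.
From mathcomp Require Import all_boot all_order all_algebra.
From mathcomp Require Import all_classical all_reals all_analysis.
From mathcomp Require Import measurable_realfun.

Set Implicit Arguments.
Unset Strict Implicit.
Unset Printing Implicit Defensive.

Import Order.TTheory GRing.Theory Num.Theory.
Import numFieldNormedType.Exports.

Local Open Scope classical_set_scope.
Local Open Scope ring_scope.

Section first_passage.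
Context (V : finType) (R : realType).
Variables (e : rel V) (w : V -> V -> R).

Fixpoint path_weight (x : V) (p : seq V) : R :=
  if p is y :: p' then w x y + path_weight y p' else 0.

(* Paths are self-avoiding, so the infimum is over a finite set; for
   nonnegative weights, as here almost surely, allowing repeated vertices would
   not change it. *)
Definition first_passage_time (x y : V) : R :=
  inf [set path_weight x p | p in
        [set p | [/\ path e x p, last x p = y & uniq (x :: p)]]].

End first_passage.

(* (i, false) and (i, true) stand for the vertices (i, 0) and (i, 1). *)
Definition ladder_vertex (n : nat) : finType := ('I_n.+1 * bool)%type.

Definition ladder (n : nat) : rel (ladder_vertex n) := fun u v =>
  (u.2 == v.2) && ((v.1 == u.1.+1 :> nat) || (u.1 == v.1.+1 :> nat))
  || (u.1 == v.1) && (u.2 != v.2).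

(* Edges of the infinite ladder on nat * bool:
   rail i b joins (i, b) to (i.+1, b), and rung i joins (i, 0) to (i, 1);
   hence X_i = rail i.-1 false, Y_i = rail i.-1 true, Z_i = rung i. *)
Definition ladder_edge : eqType := (nat * bool + nat)%type.
Definition rail (i : nat) (b : bool) : ladder_edge := inl (i, b).
Definition rung (i : nat) : ladder_edge := inr i.

(* Only meaningful on adjacent vertices. *)
Definition ladder_edge_of (n : nat) (u v : ladder_vertex n) : ladder_edge :=
  if u.1 == v.1 then rung u.1 else rail (minn u.1 v.1) u.2.

Definition ladder_fpt (T : Type) (R : realType) (W : ladder_edge -> T -> R)
    (n : nat) (t : T) : R :=
  first_passage_time (@ladder n) (fun u v => W (ladder_edge_of u v) t)
    (ord0, false) (ord_max, false).

Definition mutually_independent d (T : measurableType d) (R : realType)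
    (P : probability T R) (I : eqType) (W : I -> {RV P >-> R}) : Prop :=
  forall (s : seq I) (A : I -> set R), uniq s ->
    (forall i, measurable (A i)) ->
    P (\bigcap_(i in [set` s]) W i @^-1` A i)
    = (\prod_(i <- s) P (W i @^-1` A i))%E.

Definition cvg_in_distribution d (T : measurableType d) (R : realType)
    (P : probability T R) (X : nat -> T -> R)
    (mu : probability (measurableTypeR R) R) : Prop :=
  (forall n, measurable_fun [set: T] (X n)) /\
  forall x : R, {for x, continuous (fun y : R => mu `]-oo, y]%classic)} ->
    P [set t | X n t <= x] @[n --> \oo] --> mu `]-oo, x]%classic.

Section bessel.
Context {R : realType}.
Implicit Types (x : R) (nu k : nat).

Definition bessel_coeff nu x k : R :=
  (-1) ^+ k / (k`! * (k + nu)`!)%:R * (x / 2) ^+ (2 * k + nu).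

Definition bessel nu x : R := limn (series (bessel_coeff nu x)).

Lemma is_cvg_series_bessel nu x : cvgn (series (bessel_coeff nu x)).
Proof.
apply: normed_cvg.
pose v k : R := `|x / 2| ^+ nu * exp_coeff (`|x / 2| ^+ 2) k.
apply: (@series_le_cvg _ _ v) => //.
- by move=> k /=.
- by move=> k; rewrite mulr_ge0 ?exprn_ge0// exp_coeff_ge0 ?exprn_ge0.
- move=> k; rewrite /v /bessel_coeff /exp_coeff /=.
  rewrite normrM normrX normrM normrX normrN1 expr1n mul1r exprD exprM.
  rewrite [leLHS]mulrC [X in X * _]mulrC -mulrA.
  rewrite ler_wpM2l ?exprn_ge0// ler_wpM2l ?exprn_ge0//.
  rewrite ger0_norm ?invr_ge0// lef_pV2 ?posrE ?ltr0n ?muln_gt0 ?fact_gt0//.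
  by rewrite ler_nat leq_pmulr ?fact_gt0.
- exact: is_cvg_seriesZ (is_cvg_series_exp_coeff _).
Qed.

(* On [0, 2] the terms of the series alternate and decrease. *)
Lemma bessel_ge0 nu x : 0 <= x <= 2 -> 0 <= bessel nu x.
Proof.
move=> /andP[x0 x2].
have t0 : 0 <= x / 2 by rewrite divr_ge0.
have t1 : x / 2 <= 1 by rewrite ler_pdivrMr// mul1r.
pose u k : R := (x / 2) ^+ (2 * k + nu) / (k`! * (k + nu)`!)%:R.
have u0 k : 0 <= u k by rewrite divr_ge0// exprn_ge0.
have uS k : u k.+1 <= u k.
  rewrite /u ler_pM ?invr_ge0 ?exprn_ge0//.
    by rewrite ler_wiXn2l// leq_add2r leq_pmul2l.
  rewrite lef_pV2 ?posrE ?ltr0n ?muln_gt0 ?fact_gt0// ler_nat.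
  by rewrite addSn !factS leq_mul// leq_pmull.
have cE k : bessel_coeff nu x k = (-1) ^+ k * u k.
  by rewrite /bessel_coeff /u mulrAC -mulrA.
have sD N : (-1) ^+ N.*2 = 1 :> R by rewrite -signr_odd odd_double.
have S2 N : 0 <= series (bessel_coeff nu x) N.*2.
  elim: N => [|N IH]; first by rewrite /series/= big_geq.
  rewrite doubleS /series/= !big_nat_recr//= -addrA addr_ge0//.
  rewrite !cE exprS sD mulr1 mul1r mulN1r.
  by rewrite subr_ge0.
have S0 n : 0 <= series (bessel_coeff nu x) n.
  rewrite -(odd_double_half n); case: (odd n) => /=; last by rewrite add0n.
  rewrite add1n /series/= big_nat_recr//= addr_ge0//; first exact: S2.
  by rewrite cE sD mul1r.
apply: limr_ge; first exact: is_cvg_series_bessel.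
exact: nearW.
Qed.

Lemma measurable_bessel nu : measurable_fun [set: R] (bessel nu).
Proof.
apply: (@measurable_fun_cvg _ _ _ _ (fun n x => series (bessel_coeff nu x) n)).
- move=> n; rewrite /series/=; apply: measurable_sum => k.
  apply: measurable_funM => //; apply: measurable_funX.
  exact: measurable_funM.
- by move=> x _; exact: is_cvg_series_bessel.
Qed.

End bessel.

Section invariant_law.
Context {R : realType}.

Definition pi_density (r : R) : R :=
  (2 * bessel 2 2)^-1 * expR (- (3 / 2) * `|r|)
  * bessel 1 (2 * expR (- (1 / 2) * `|r|)).

Lemma pi_density_ge0 r : 0 <= pi_density r.
Proof.
rewrite /pi_density mulr_ge0// ?mulr_ge0 ?expR_ge0//.
  by rewrite invr_ge0 mulr_ge0// bessel_ge0// lexx ler0n.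
by rewrite bessel_ge0// mulr_ge0 ?expR_ge0//= ler_piMr// -expR0 ler_expR.
Qed.

Lemma measurable_pi_density : measurable_fun [set: R] pi_density.
Proof.
have mabs (c : R) : measurable_fun [set: R] (fun r : R => expR (c * `|r|)).
  apply: measurableT_comp => //; apply: measurable_funM => //.
apply: measurable_funM; first exact: measurable_funM.
apply: (measurableT_comp (measurable_bessel 1)).
exact: measurable_funM.
Qed.

Definition pi_law (A : set (measurableTypeR R)) : \bar R :=
  (\int[lebesgue_measure]_(r in A) (pi_density r)%:E)%E.

Let pi_law0 : pi_law set0 = 0%E.
Proof. by rewrite /pi_law integral_set0. Qed.

Let pi_law_ge0 A : (0 <= pi_law A)%E.
Proof. by apply: integral_ge0 => r _; rewrite lee_fin pi_density_ge0. Qed.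

Let pi_law_sigma_additive : semi_sigma_additive pi_law.
Proof.
move=> F mF tF mUF; rewrite /pi_law; apply: cvg_toP.
  apply: ereal_nondecreasing_is_cvgn => m n mn.
  by apply: lee_sum_nneg_natr => // k _ _; exact: pi_law_ge0.
rewrite ge0_integral_bigcup//=.
- apply/measurable_funTS/measurableT_comp => //.
  exact: measurable_pi_density.
- by move=> r _; rewrite lee_fin pi_density_ge0.
Qed.

HB.instance Definition _ := isMeasure.Build _ _ R pi_law
  pi_law0 pi_law_ge0 pi_law_sigma_additive.

End invariant_law.

Section exponential_noise.
Variable R : realType.

(* The library's probability structure on exponential_prob needs a proof that
   the rate is positive, which is supplied here. *)
Definition exp1 : probability (measurableTypeR R) R.
Proof. by refine (exponential_prob (1 : R)); exact: ltr01. Defined.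

Definition noise :
    probability (measurableTypeR R * measurableTypeR R * measurableTypeR R)%type R :=
  ((exp1 \x exp1) \x exp1)%E.

End exponential_noise.

Section markov_chain.
Variable R : realType.

(* Elements are written (r, (x, y, z)); the kernels below live on the whole of
   R * R^3, and integrals over the states are restricted to state_space, which
   is R * (R_+)^3. *)
Definition state : measurableType _ :=
  (measurableTypeR R
   * (measurableTypeR R * measurableTypeR R * measurableTypeR R))%type.

Definition state_space : set state :=
  [set m | let: (_, (x, y, z)) := m in [/\ 0 < x, 0 < y & 0 < z]].

(* The difference of the passage times to (n+1, 1) and to (n+1, 0), given that
   the one at n is r and that the weights of the edges (n, 0)-(n+1, 0),
   (n, 1)-(n+1, 1), (n+1, 0)-(n+1, 1) are x, y, z. *)
Definition delta_step (m : state) : measurableTypeR R :=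
  let: (r, (x, y, z)) := m in
  Num.min (r + y) (x + z) - Num.min (r + y + z) x.

Lemma measurable_delta_step : measurable_fun [set: state] delta_step.
Proof.
rewrite (_ : delta_step = fun m => Num.min (m.1 + m.2.1.2) (m.2.1.1 + m.2.2)
    - Num.min (m.1 + m.2.1.2 + m.2.2) m.2.1.1); last first.
  by apply/funext => -[r [[x y] z]].
have mr : measurable_fun [set: state] (fun m : state => m.1).
  exact: measurable_fst.
have mz : measurable_fun [set: state] (fun m : state => m.2.2).
  exact: measurableT_comp measurable_snd measurable_snd.
have mxy : measurable_fun [set: state] (fun m : state => m.2.1).
  exact: measurableT_comp measurable_fst measurable_snd.
have mx : measurable_fun [set: state] (fun m : state => m.2.1.1).
  exact: measurableT_comp measurable_fst mxy.
have my : measurable_fun [set: state] (fun m : state => m.2.1.2).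
  exact: measurableT_comp measurable_snd mxy.
by apply: measurable_funB; apply: measurable_minr => //;
  repeat apply: measurable_funD.
Qed.

(* From m the chain moves to (delta_step m, fresh exponential weights). *)
Definition transition (m : state) : {measure set state -> \bar R} :=
  (\d_(delta_step m) \x noise R)%E.

Let measurable_transition U : measurable U ->
  measurable_fun [set: state] (transition ^~ U).
Proof.
move=> mU.
have mN : measurable_fun [set: measurableTypeR R] (noise R \o xsection U).
  exact: measurable_fun_xsection.
rewrite (_ : transition ^~ U = (noise R \o xsection U) \o delta_step).
  exact: measurableT_comp mN measurable_delta_step.
apply/funext => m; rewrite /transition /= /product_measure1.
by rewrite integral_dirac//= diracT mul1e.
Qed.

HB.instance Definition _ := isKernel.Build _ _ _ _ _ transition
  measurable_transition.

Let transition_setT m : transition m [set: state] = 1%E.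
Proof. by rewrite /transition /= probability_setT. Qed.

HB.instance Definition _ := Kernel_isProbability.Build _ _ _ _ _ transition
  transition_setT.

Fixpoint ntransition (n : nat) : R.-spker state ~> state :=
  match n with
  | 0 => kdirac (@measurable_id _ state setT)
  | n'.+1 => mkcomp_noparam transition (ntransition n')
  end.

(* noise R has density exp (- (x + y + z)) on (R_+)^3. *)
Definition pi_tilde : {measure set state -> \bar R} :=
  (@pi_law R \x noise R)%E.

Definition chi : R := 3 / 2 - bessel 1 2 / (2 * bessel 2 2).

Definition ladder_f (m : state) : R :=
  let: (r, (x, y, z)) := m in Num.min (r + y + z) x.

Definition ladder_fbar (m : state) : R := ladder_f m - chi.

(* P^n fbar *)
Definition iter_fbar (n : nat) (m : state) : R :=
  \int[ntransition n m]_(m' in state_space) ladder_fbar m'.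

End markov_chain.

Arguments state_space {R}.
Arguments ntransition {R}.
Arguments chi {R}.
Arguments ladder_f {R}.
Arguments ladder_fbar {R}.
Arguments iter_fbar {R}.

(* Main.v *)
Require Import Defs.
From HB Require Import structures.
From mathcomp Require Import all_boot all_order all_algebra.
From mathcomp Require Import all_classical all_reals all_analysis.
From mathcomp Require Import measurable_realfun ring lra.

Set Implicit Arguments.
Unset Strict Implicit.
Unset Printing Implicit Defensive.

Import Order.TTheory GRing.Theory Num.Theory.
Import numFieldNormedType.Exports.

Local Open Scope classical_set_scope.
Local Open Scope ring_scope.

(* Write Delta for the chain and Q for its one-step operator. Passage times obey a
   min-plus recursion from one rung to the next, so l_n is the sum of f along the
   chain.  The density of pi is integrated termwise in the Bessel series; the
   invariance of pi and pi(f) = chi then reduce to telescoping sums.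

   Two consecutive steps forget the starting point with positive probability, hence
   bounded functions of mean zero mix geometrically and Poisson equations are
   solvable.  If h - Q h = E f - chi, then l_n - n chi + h(Delta_n) has centered
   increments, with conditional variance v(Delta); the mean of v under pi is
   sigma^2, it is positive, and expanding the square of the increment turns it into
   the Green-Kubo series because h(Delta_1) is the sum over n >= 1 of P^n fbar.

   The limit theorem follows by exchanging increments for Gaussian ones (Lindeberg).
   Since the conditional variance is not constant, u_k is exchanged together with
   u_k'' g(Delta) / (2 n), where g - Q g = v - sigma^2: the second-order terms then
   cancel exactly. Cubic splines serve as test functions for the distribution
   function. *)

(** For $z>0$ one step replaces $r$ by $r+y-x$ truncated to $[-z,z]$. Most estimates come from this
    form: $|\Delta_{n+1}|\le Z_{n+1}$ whatever the past, the tails of a step factor through the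
    independent variables $Y-X$ and $Z$, and starting points merge once $r+y-x>z$ for all of them.

    The obstacle is that $f$ and its mean grow linearly in $r$, whereas the contraction concerns
    bounded functions. One application of $Q$ makes a function of linear growth bounded, so the
    Poisson equation is solved for $Q(Ef-\chi)$ and the missing first term is added by hand. The
    increments of the corrected process are then controlled by the weights alone, uniformly in $r$,
    and have bounded conditional third moments. Integrability and Fubini rest on one product
    majorant with factors $e^{|\cdot|/2}$, integrable under the laws of the chain and larger, up to
    a constant, than the cube of the linear growth.

    In the exchange argument one step costs $O(n^{-3/2})$, hence $n$ steps cost $O(n^{-1/2})$; this
    works only because the class of test functions is preserved by Gaussian smoothing with the same
    constants. *)

Notation intg mu f := (mu.-integrable [set: _] (EFin \o f)).

(** * Integrals and measures *)

Section domination.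
Context d (T : measurableType d) (R : realType).
Variable mu : {measure set T -> \bar R}.
Implicit Types f g : T -> R.

Lemma measurable_intg f : intg mu f -> measurable_fun [set: T] f.
Proof. by move=> /measurable_int/measurable_EFinP. Qed.

Lemma intg_dom g f : measurable_fun [set: T] f -> intg mu g ->
  (forall x, `|f x| <= g x) -> intg mu f.
Proof.
move=> mf ig fg; apply: (le_integrable measurableT _ _ ig); first exact/measurable_EFinP.
by move=> x _ /=; rewrite lee_fin (le_trans (fg x))// ler_norm.
Qed.

Lemma intgD f g : intg mu f -> intg mu g -> intg mu (fun x => f x + g x).
Proof. by move=> i j; have := integrableD measurableT i j. Qed.

Lemma intgB f g : intg mu f -> intg mu g -> intg mu (fun x => f x - g x).
Proof. by move=> i j; have := integrableB measurableT i j. Qed.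

Lemma intgZ c f : intg mu f -> intg mu (fun x => c * f x).
Proof. by move=> i; have := integrableZl measurableT c i. Qed.

Lemma intg_norm f : intg mu f -> intg mu (fun x => `|f x|).
Proof. by move=> i; have := integrable_norm i. Qed.

Lemma measure_integral_indic A : measurable A -> mu A = (\int[mu]_x (\1_A x)%:E)%E.
Proof. by move=> mA; rewrite integral_indic// setIT. Qed.

Lemma le_norm_Rintegral f g : measurable_fun [set: T] f -> intg mu g ->
  (forall x, `|f x| <= g x) -> `|\int[mu]_x f x| <= \int[mu]_x g x.
Proof.
move=> mf ig fg; have i := intg_dom mf ig fg.
apply: le_trans (le_normr_Rintegral measurableT i) _.
by apply: le_Rintegral => //; exact: intg_norm.
Qed.

End domination.

Section probability_integral.
Context d (T : measurableType d) (R : realType).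
Variable mu : probability T R.
Implicit Types f g : T -> R.

Lemma intg_cst (c : R) : intg mu (fun=> c).
Proof. exact: finite_measure_integrable_cst. Qed.

Lemma Rintegral_cstp (c : R) : \int[mu]_x c = c.
Proof.
rewrite Rintegral_cst//.
by rewrite /= probability_setT mulr1.
Qed.

Lemma intg_bounded f (c : R) : measurable_fun [set: T] f ->
  (forall x, `|f x| <= c) -> intg mu f.
Proof. by move=> mf fc; apply: (intg_dom mf (intg_cst c)). Qed.

Lemma Rintegral_le_bound f (c : R) : measurable_fun [set: T] f ->
  (forall x, `|f x| <= c) -> `|\int[mu]_x f x| <= c.
Proof.
move=> mf fc; rewrite -[leRHS]Rintegral_cstp.
by apply: le_norm_Rintegral => //; exact: intg_cst.
Qed.

End probability_integral.

Section pushforward.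
Context d1 d2 (T1 : measurableType d1) (T2 : measurableType d2) (R : realType).
Variables (m1 : {measure set T1 -> \bar R}) (phi : T1 -> T2).
Hypothesis mphi : measurable_fun [set: T1] phi.

(* The law m2 of phi is only known through its values on measurable sets. *)
Variable m2 : {measure set T2 -> \bar R}.
Hypothesis m2E : forall A, measurable A -> m2 A = m1 (phi @^-1` A).

Lemma law_integralE (f : T2 -> \bar R) : measurable_fun [set: T2] f ->
  (forall x, (0 <= f x)%E) ->
  (\int[m2]_x f x = \int[m1]_x f (phi x))%E.
Proof.
move=> mf f0.
transitivity (\int[pushforward m1 phi]_x f x)%E.
  by apply: eq_measure_integral => A mA _; rewrite m2E.
by rewrite ge0_integral_pushforward.
Qed.

Lemma law_intg (f : T2 -> R) : measurable_fun [set: T2] f ->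
  intg m2 f <-> intg m1 (f \o phi).
Proof.
move=> mf; have mfE : measurable_fun [set: T2] (EFin \o f).
  exact/measurable_EFinP.
have mfphi : measurable_fun [set: T1] (f \o phi) by exact: measurableT_comp.
split=> /integrableP[_ fo]; apply/integrableP; split => //.
- exact/measurable_EFinP.
- rewrite -(@law_integralE (fun x => `|(f x)%:E|%E))//.
  exact: measurableT_comp.
- rewrite (@law_integralE (fun x => `|(f x)%:E|%E))//.
  exact: measurableT_comp.
Qed.

Lemma law_Rintegral (f : T2 -> R) : intg m2 f ->
  \int[m2]_x f x = \int[m1]_x f (phi x).
Proof.
move=> fi; have mf := measurable_intg fi.
rewrite /Rintegral; congr fine.
rewrite integralE [in RHS]integralE; congr (_ - _)%E.
  rewrite (@law_integralE (EFin \o f)^\+%E)//.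
    by apply: eq_integral => x _; rewrite !funeposE.
  by apply: measurable_funepos; exact/measurable_EFinP.
rewrite (@law_integralE (EFin \o f)^\-%E)//.
  by apply: eq_integral => x _; rewrite !funenegE.
by apply: measurable_funeneg; exact/measurable_EFinP.
Qed.

End pushforward.

Section dominated_fubini.
Context d1 d2 (T1 : measurableType d1) (T2 : measurableType d2) (R : realType).
Variable m1 : {sigma_finite_measure set T1 -> \bar R}.
Variable m2 : {sigma_finite_measure set T2 -> \bar R}.
Variables (f : T1 * T2 -> R) (D1 : T1 -> R) (D2 : T2 -> R).
Hypothesis mf : measurable_fun [set: T1 * T2] f.
Hypothesis iD1 : intg m1 D1.
Hypothesis iD2 : intg m2 D2.
Hypothesis fD : forall x y, `|f (x, y)| <= D1 x * D2 y.

Lemma intg_section1 x : intg m2 (fun y => f (x, y)).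
Proof.
apply: (@intg_dom _ _ _ _ (fun y => D1 x * D2 y)) => //.
  exact: measurableT_comp.
exact: intgZ.
Qed.

Lemma intg_section2 y : intg m1 (fun x => f (x, y)).
Proof.
apply: (@intg_dom _ _ _ _ (fun x => D2 y * D1 x)) => //.
  exact: measurableT_comp.
  exact: intgZ.
by move=> x; rewrite mulrC.
Qed.

(** Tonelli bounds the iterated integral of $|f|$ by the product of the two finite integrals of
    $|D_1|$ and $|D_2|$. A majorant in product form makes every section integrable, not only almost
    every one, so the partial integrals are genuine at each point. *)
Lemma intg_prod : intg (m1 \x m2)%E f.
Proof.
apply/integrable12ltyP; first exact/measurable_EFinP.
apply: (@le_lt_trans _ _ (\int[m1]_x (`|D1 x|%:E * \int[m2]_y `|D2 y|%:E)))%E.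
  apply: ge0_le_integral => //.
  - by move=> x _; apply: integral_ge0.
  - apply: (measurable_fun_fubini_tonelli_F (fun z => `|(f z)%:E|%E)) => //.
    by apply: measurableT_comp => //; exact/measurable_EFinP.
  - apply: emeasurable_funM => //; apply/measurable_EFinP.
    by apply: measurableT_comp => //; exact: measurable_intg iD1.
  - move=> x _; rewrite -ge0_integralZl//; last first.
      apply/measurable_EFinP; apply: measurableT_comp => //.
      exact: measurable_intg iD2.
    apply: ge0_le_integral => //.
    + by apply/measurable_EFinP; do 2 apply: measurableT_comp => //.
    + apply: emeasurable_funM => //; apply/measurable_EFinP.
      by apply: measurableT_comp => //; exact: measurable_intg iD2.
    + move=> y _; rewrite /= -EFinM lee_fin -normrM.
      by rewrite (le_trans (fD x y))// ler_norm.
rewrite ge0_integralZr//.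
- have /integrableP[_ h1] := iD1; have /integrableP[_ h2] := iD2.
  apply: lte_mul_pinfty; rewrite ?integral_ge0//.
  by rewrite ge0_fin_numE// ?integral_ge0.
- apply/measurable_EFinP; apply: measurableT_comp => //.
  exact: measurable_intg iD1.
- exact: integral_ge0.
Qed.

Lemma measurable_Rintegral1 : measurable_fun [set: T1] (fun x => \int[m2]_y f (x, y)).
Proof.
have := measurable_fubini_F intg_prod.
rewrite /fubini_F => h.
by apply: measurableT_comp h => //; exact: measurable_fine.
Qed.

Let RE1 x : (\int[m2]_y f (x, y))%:E = (\int[m2]_y (f (x, y))%:E)%E.
Proof.
by rewrite /Rintegral fineK//; apply: integrable_fin_num (intg_section1 x).
Qed.

Let RE2 y : (\int[m1]_x f (x, y))%:E = (\int[m1]_x (f (x, y))%:E)%E.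
Proof.
by rewrite /Rintegral fineK//; apply: integrable_fin_num (intg_section2 y).
Qed.

Lemma intg_Rintegral1 : intg m1 (fun x => \int[m2]_y f (x, y)).
Proof.
apply: eq_integrable (integrable_fubini_F intg_prod) => //.
by move=> x _ /=; rewrite RE1.
Qed.

Lemma Rintegral_prod : \int[(m1 \x m2)%E]_z f z = \int[m1]_x \int[m2]_y f (x, y).
Proof.
rewrite /Rintegral -[in LHS](integral12_prod_meas1 intg_prod)//; congr fine.
by apply: eq_integral => x _; rewrite RE1.
Qed.

Lemma Rintegral_prod2 :
  \int[(m1 \x m2)%E]_z f z = \int[m2]_y \int[m1]_x f (x, y).
Proof.
rewrite /Rintegral -[in LHS](integral21_prod_meas1 intg_prod)//; congr fine.
by apply: eq_integral => x _; rewrite RE2.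
Qed.

End dominated_fubini.

Section density.
Context d (T : measurableType d) (R : realType).
Variables (mu m : {measure set T -> \bar R}) (g : T -> R).
Hypothesis mg : measurable_fun [set: T] g.
Hypothesis g0 : forall x, 0 <= g x.
Hypothesis mE : forall A, measurable A -> m A = (\int[mu]_(x in A) (g x)%:E)%E.

Import HBNNSimple.

Let density_nnsfun (h : {nnsfun T >-> R}) :
  (\int[m]_x (h x)%:E = \int[mu]_x ((h x)%:E * (g x)%:E))%E.
Proof.
have mgE : measurable_fun [set: T] (EFin \o g) by exact/measurable_EFinP.
transitivity (\int[m]_x (\sum_(y \in range h) (y * \1_(h @^-1` [set y]) x)%:E))%E.
  by apply: eq_integral => t _; rewrite fimfunE -fsumEFin.
rewrite ge0_integral_fsum//; last 2 first.
  by move=> r; apply/measurable_EFinP; apply: measurable_funM.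
  by move=> r x _; exact: nnfun_muleindic_ge0.
transitivity (\int[mu]_x (\sum_(y \in range h)
    (y * \1_(h @^-1` [set y]) x)%:E * (g x)%:E))%E; last first.
  apply: eq_integral => x _.
  rewrite -ge0_mule_fsuml => [|y]; last exact: nnfun_muleindic_ge0.
  by rewrite fsumEFin // -(fimfunE _ x).
rewrite ge0_integral_fsum//; last 2 first.
  move=> r; apply: emeasurable_funM => //.
  by apply/measurable_EFinP; apply: measurable_funM.
  by move=> r x _; rewrite mule_ge0 ?lee_fin// -lee_fin nnfun_muleindic_ge0.
apply: eq_fsbigr => r; rewrite inE => -[t _ <-].
under eq_integral do rewrite EFinM.
under [RHS]eq_integral do rewrite EFinM -muleA.
rewrite ge0_integralZl//; last 2 first.
- exact/measurable_EFinP.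
- by rewrite lee_fin.
rewrite ge0_integralZl//; last 3 first.
- by apply: emeasurable_funM => //; exact/measurable_EFinP.
- by move=> x _; rewrite mule_ge0 ?lee_fin.
- by rewrite lee_fin.
congr (_ * _)%E.
rewrite integral_indic// setIT mE// integral_mkcond.
apply: eq_integral => x _.
by rewrite patchE/= indicE; case: ifPn => xA; rewrite ?mul1e ?mul0e.
Qed.

(** Monotone convergence along simple functions. Only the values of [m] on measurable sets are
    known, which is how the exponential, normal and invariant laws are given. *)
Lemma ge0_integral_density (f : T -> \bar R) :
  measurable_fun [set: T] f -> (forall x, (0 <= f x)%E) ->
  (\int[m]_x f x = \int[mu]_x (f x * (g x)%:E))%E.
Proof.
move=> mf f0; pose h := nnsfun_approx measurableT mf.
have hf x : (EFin \o h^~ x) n @[n --> \oo] --> f x.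
  exact: cvg_nnsfun_approx.
transitivity (limn (fun n => \int[m]_x (h n x)%:E)%E).
  rewrite -monotone_convergence//=.
  - by apply: eq_integral => x _; apply/esym/cvg_lim => //; exact: hf.
  - by move=> n; exact/measurable_EFinP.
  - by move=> n x _; rewrite lee_fin.
  - by move=> x _ a b ab; rewrite lee_fin; exact/lefP/nd_nnsfun_approx.
transitivity (limn (fun n => \int[mu]_x ((h n x)%:E * (g x)%:E))%E).
  by congr (limn _); apply/funext => n; exact: density_nnsfun.
rewrite -monotone_convergence//=.
- apply: eq_integral => x _; apply/cvg_lim => //.
  by apply: cvgeZr => //; exact: hf.
- move=> n; apply: emeasurable_funM; exact/measurable_EFinP.
- by move=> n x _; rewrite mule_ge0 ?lee_fin.
- move=> x _ a b ab; rewrite lee_wpmul2r ?lee_fin//.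
  exact/lefP/nd_nnsfun_approx.
Qed.

Lemma intg_density (f : T -> R) : measurable_fun [set: T] f ->
  intg m f <-> intg mu (fun x => f x * g x).
Proof.
move=> mf.
have mf' : measurable_fun [set: T] (fun x => `|(f x)%:E|%E).
  by apply: measurableT_comp => //; exact/measurable_EFinP.
have E : (\int[m]_x `|(f x)%:E| = \int[mu]_x `|(f x * g x)%:E|)%E.
  rewrite ge0_integral_density//; apply: eq_integral => x _ /=.
  by rewrite normrM (ger0_norm (g0 x)) EFinM.
split=> /integrableP[_ fo]; apply/integrableP; split.
- by apply/measurable_EFinP; exact: measurable_funM.
- by rewrite -E.
- exact/measurable_EFinP.
- by rewrite E.
Qed.

Lemma Rintegral_density (f : T -> R) : intg m f ->
  \int[m]_x f x = \int[mu]_x (f x * g x).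
Proof.
move=> fi; have mf := measurable_intg fi.
rewrite /Rintegral; congr fine.
rewrite integralE [in RHS]integralE; congr (_ - _)%E.
  rewrite ge0_integral_density//.
    apply: eq_integral => x _; rewrite !funeposE.
    by rewrite -!EFin_max -EFinM maxr_pMl// mul0r.
  by apply: measurable_funepos; exact/measurable_EFinP.
rewrite ge0_integral_density//.
  apply: eq_integral => x _; rewrite !funenegE.
  by rewrite -!EFinN -!EFin_max -EFinM maxr_pMl// mul0r mulNr.
by apply: measurable_funeneg; exact/measurable_EFinP.
Qed.

End density.

(** * Exponential weights *)

Section exponential_integrals.
Context {R : realType}.
Notation mu := (@lebesgue_measure R).
Implicit Types a l : R.

Lemma is_derive_continuous (f : R -> R) (x : R^o) (df : R) :
  is_derive x 1 f df -> {for x, continuous f}.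
Proof. by move=> [fd _]; apply: differentiable_continuous; apply/derivable1_diffP. Qed.

Lemma cvg_expRN_pinfty l : 0 < l -> expR (- l * x) @[x --> +oo] --> (0 : R).
Proof.
move=> l0.
rewrite (_ : (fun x => _) = (fun z => expR (- z)) \o (fun z => l * z)); last first.
  by apply/funext => x /=; rewrite mulNr.
apply: (@cvg_comp _ _ _ _ _ _ (pinfty_nbhs R)); last exact: cvgr_expR.
exact: gt0_cvgMry.
Qed.

Lemma integral_expR_halfline l a : 0 < l ->
  (\int[mu]_(x in `[a, +oo[) (expR (- l * x))%:E = (expR (- l * a) / l)%:E)%E.
Proof.
move=> l0.
have dF (x : R^o) : is_derive x 1 (fun x : R => - (expR (- l * x) / l)) (expR (- l * x)).
  apply: is_derive_eq; rewrite /GRing.scale/= .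
  by field; rewrite gt_eqF.
rewrite (@ge0_continuous_FTC2y _ _ (fun x => - (expR (- l * x) / l)) _ 0)//.
- by rewrite sub0e -EFinN opprK.
- apply: continuous_subspaceT => x.
  apply: continuous_comp; last exact: continuous_expR.
  exact: mulrl_continuous.
- rewrite -oppr0; apply: cvgN; rewrite -[X in _ --> X](mul0r l^-1).
  by apply: cvgM; [exact: cvg_expRN_pinfty|exact: cvg_cst].
- by apply: cvg_at_right_filter; exact: (is_derive_continuous (dF a)).
- by move=> x _; rewrite derive1E; case: (dF x).
Qed.

Lemma integral_affine_expR_halfline a :
  (\int[mu]_(x in `[a, +oo[) ((x - a) * expR (- x))%:E = (expR (- a))%:E)%E.
Proof.
have dF (x : R^o) : is_derive x 1 (fun x : R => - ((x - a + 1) * expR (- x))) ((x - a) * expR (- x)).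
  apply: is_derive_eq; rewrite /GRing.scale/= .
  by ring.
rewrite (@ge0_continuous_FTC2y _ _ (fun x => - ((x - a + 1) * expR (- x))) _ 0)//.
- by rewrite sub0e -EFinN opprK subrr add0r mul1r.
- by move=> x ax; rewrite mulr_ge0 ?expR_ge0// subr_ge0.
- apply: continuous_subspaceT => x.
  apply: (@is_derive_continuous _ _ (expR (- x) + (x - a) * (- expR (- x)))).
  by apply: is_derive_eq; rewrite /GRing.scale/=; ring.
- rewrite -oppr0; apply: cvgN.
(* Decay of the primitive: $xe^{-x}\le 2e^{-x/2}$, because $1+x/2\le e^{x/2}$. *)
have E (x : R) : 0 <= x -> `|(x - a + 1) * expR (- x)| <=
    2 * expR (- (1 / 2) * x) + `|1 - a| * expR (- 1 * x).
  move=> x0; rewrite normrM (ger0_norm (expR_ge0 _)).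
  have -> : 2 * expR (- (1 / 2) * x) = 2 * expR (x / 2) * expR (- x).
    by rewrite -mulrA -expRD; congr (_ * expR _); field.
  rewrite mulN1r -mulrDl ler_wpM2r ?expR_ge0//.
  rewrite (_ : x - a + 1 = x + (1 - a)); last by ring.
  rewrite (le_trans (ler_normD _ _))// lerD2r ger0_norm//.
  have := expR_ge1Dx (x / 2); lra.
apply/cvgr0Pnorm_le => //= e e0.
have h : (fun x : R => 2 * expR (- (1 / 2) * x) + `|1 - a| * expR (- 1 * x)) x @[x --> +oo] --> (0:R).
  rewrite -[X in _ --> X](_ : 2 * 0 + `|1 - a| * 0 = 0); last by rewrite !mulr0 addr0.
  apply: cvgD; apply: cvgM; (try exact: cvg_cst); apply: cvg_expRN_pinfty; lra.
near=> x; apply: (le_trans (E x _)) => //.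
rewrite -[leLHS]ger0_norm; last by rewrite addr_ge0// mulr_ge0 ?expR_ge0.
by near: x; move/cvgr0Pnorm_le : h; exact.
- by apply: cvg_at_right_filter; exact: (is_derive_continuous (dF a)).
- by move=> x _; rewrite derive1E; case: (dF x).
Unshelve. all: by end_near. Qed.

Lemma ge0_integral_halfline_split (f : R -> \bar R) a b :
  measurable_fun [set: R] f -> (forall x, (0 <= f x)%E) -> a <= b ->
  (\int[mu]_(x in `[a, +oo[) f x =
   \int[mu]_(x in `[a, b[) f x + \int[mu]_(x in `[b, +oo[) f x)%E.
Proof.
move=> mf f0 ab; rewrite -ge0_integral_setU//=.
- by rewrite -itv_bndbnd_setU// bnd_simp.
- exact: measurable_funS mf.
- apply/disj_setPS => x [/=]; rewrite !in_itv/= andbT => /andP[_ xb] bx.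
  by move: xb; rewrite ltNge bx.
Qed.

Lemma integral_expR_segment l a b : 0 < l -> a <= b ->
  (\int[mu]_(x in `[a, b[) (expR (- l * x))%:E =
   ((expR (- l * a) - expR (- l * b)) / l)%:E)%E.
Proof.
move=> l0 ab.
have mf : measurable_fun [set: R] (fun x => (expR (- l * x))%:E).
  by apply/measurable_EFinP; apply: measurableT_comp.
have := @ge0_integral_halfline_split _ a b mf _ ab.
rewrite !integral_expR_halfline// => h.
have /eqP : _ := h ltac:(by move=> x; rewrite lee_fin expR_ge0).
rewrite -sube_eq//; last exact: fin_num_adde_defl.
by rewrite -EFinB => /eqP <-; congr (_%:E); rewrite mulrBl.
Qed.

Lemma exp1_integralE (f : R -> \bar R) :
  measurable_fun [set: R] f -> (forall x, (0 <= f x)%E) ->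
  (\int[exp1 R]_x f x = \int[mu]_(x in `[0%R, +oo[) (f x * (expR (- x))%:E))%E.
Proof.
move=> mf f0.
rewrite (@ge0_integral_density _ _ _ mu _ (exponential_pdf 1))//.
- rewrite [RHS]integral_mkcond; apply: eq_integral => x _.
  rewrite patchE /exponential_pdf patchE; case: ifPn => _; rewrite ?mule0//.
  by rewrite mul1r mulN1r.
- exact: measurable_exponential_pdf.
- by move=> x; exact: exponential_pdf_ge0.
Qed.

(** The flag [b] selects a closed or an open endpoint, the law having no atoms. The maximum records
    that a ray starting below $0$ has full mass. *)
Lemma exp1_tail (b : bool) s :
  exp1 R [set` Interval (BSide b s) +oo%O] = (expR (- Num.max s 0))%:E.
Proof.
have mA : measurable [set` Interval (BSide b s) +oo%O] by exact: measurable_itv.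
have -> : exp1 R [set` Interval (BSide b s) +oo%O] =
    (\int[mu]_(x in `[Num.max s 0%R, +oo[) (expR (- 1 * x))%:E)%E.
  transitivity (\int[exp1 R]_x (\1_[set` Interval (BSide b s) +oo%O] x)%:E)%E.
    by rewrite integral_indic// setIT.
  rewrite exp1_integralE//; last by apply/measurable_EFinP.
  case: (leP 0 s) => s0; last first.
    apply: eq_integral => x; rewrite inE/= in_itv/= andbT => x0.
    rewrite indicE mem_set ?mul1e ?mulN1r//=.
    case: b {mA}; rewrite in_itv/= andbT; lra.
  transitivity (\int[mu]_(x in [set` Interval (BSide b s) +oo%O]) (expR (- 1 * x))%:E)%E; last first.
    case: b {mA} => //.
    rewrite integral_itv_obnd_cbnd//.
    by apply/measurable_EFinP; apply: measurable_funTS; apply: measurableT_comp.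
  rewrite [LHS]integral_mkcond [RHS]integral_mkcond; apply: eq_integral => x _.
  rewrite !patchE indicE mulN1r; case: ifPn => x0; case: ifPn => xA; rewrite ?mul1e ?mul0e//.
  exfalso; move: x0 xA; rewrite notin_setE inE/= !in_itv/= !andbT => /negP.
  by rewrite -ltNge; case: b {mA} => /=; lra.
by rewrite integral_expR_halfline// divr1 mulN1r.
Qed.

Let mexp l : measurable_fun [set: R] (fun x => expR (l * `|x|)).
Proof. by apply: measurableT_comp => //; apply: measurable_funM. Qed.

Lemma intg_exp1_expR : intg (exp1 R) (fun x => expR (1 / 2 * `|x|)).
Proof.
apply/integrableP; split; first by apply/measurable_EFinP; exact: mexp.
rewrite exp1_integralE//; last first.
  by apply: measurableT_comp => //; apply/measurable_EFinP; exact: mexp.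
rewrite (@eq_integral _ _ _ mu `[0, +oo[%classic (fun x : R => (expR (- (1 / 2) * x))%:E)).
  by rewrite integral_expR_halfline ?ltry//; lra.
move=> x; rewrite inE/= in_itv/= andbT => x0.
rewrite ger0_norm ?expR_ge0// ger0_norm// -EFinM -expRD; congr (expR _)%:E.
by field.
Qed.

Lemma exp1_RintegralE (f : R -> R) : measurable_fun [set: R] f ->
  (forall x, 0 <= f x) ->
  \int[exp1 R]_x f x = fine (\int[mu]_(x in `[0%R, +oo[) (f x * expR (- x))%:E)%E.
Proof.
move=> mf f0; rewrite /Rintegral exp1_integralE//.
exact/measurable_EFinP.
Qed.

(** Absence of memory: beyond the level $a$, reached with probability $e^{-a}$, the excess is again
    exponential of mean one. *)
Lemma exp1_mean_excess a : 0 <= a ->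
  \int[exp1 R]_x (Num.max (x - a) 0) = expR (- a).
Proof.
move=> a0; rewrite exp1_RintegralE; last 2 first.
- by apply: measurable_maxr => //; apply: measurable_funB.
- by move=> x; rewrite le_max lexx orbT.
rewrite -[RHS]/(fine (expR (- a))%:E) -integral_affine_expR_halfline; congr fine.
rewrite [LHS]integral_mkcond [RHS]integral_mkcond; apply: eq_integral => x _.
rewrite !patchE; case: ifPn => x0; case: ifPn => xa //.
- by move: xa; rewrite inE/= in_itv/= andbT => xa; rewrite max_l// subr_ge0.
- move: xa; rewrite notin_setE/= in_itv/= andbT => /negP; rewrite -ltNge => xa.
  by rewrite max_r ?mul0r//; lra.
- exfalso; move: x0 xa; rewrite notin_setE inE/= !in_itv/= !andbT => /negP.
  by rewrite -ltNge; lra.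
Qed.

Lemma intg_exp1_dom (f : R -> R) (c : R) : measurable_fun [set: R] f ->
  (forall x, `|f x| <= c * expR (1 / 2 * `|x|)) -> intg (exp1 R) f.
Proof.
move=> mf fc; apply: (@intg_dom _ (measurableTypeR R) _ _
  (fun x : R => c * expR (1 / 2 * `|x|))) => //.
exact/intgZ/intg_exp1_expR.
Qed.

Lemma norm_le_expR_half (x : R) : `|x| <= 2 * expR (1 / 2 * `|x|).
Proof. have := expR_ge1Dx (1 / 2 * `|x|); lra. Qed.

Lemma exp1_mean : \int[exp1 R]_x x = 1.
Proof.
have mp : measurable_fun [set: R] (fun x : R => Num.max (x - 0) 0).
  by apply: measurable_maxr => //; apply: measurable_funB.
have mn : measurable_fun [set: R] (fun x : R => Num.max (- x) 0).
  by apply: measurable_maxr => //; exact: measurable_oppr.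
transitivity (\int[exp1 R]_x (Num.max (x - 0) 0 - Num.max (- x) 0)).
  have posneg (y : R) : y = Num.max (y - 0) 0 - Num.max (- y) 0.
    by rewrite subr0; case: (leP y 0) => ?; case: (leP (- y) 0) => ?; lra.
  by apply: eq_Rintegral => x _; exact: posneg.
rewrite RintegralB//.
- rewrite exp1_mean_excess// oppr0 expR0 exp1_RintegralE//; last first.
    by move=> x; rewrite le_max lexx orbT.
  rewrite integral0_eq ?subr0// => x; rewrite /= in_itv/= andbT => x0.
  by rewrite max_r ?mul0r// oppr_le0.
- apply: (@intg_exp1_dom _ 2 mp) => x; apply: le_trans (norm_le_expR_half x).
  by rewrite subr0 ger0_norm ?le_max ?lexx ?orbT// ge_max ler_norm/=.
- apply: (@intg_exp1_dom _ 2 mn) => x; apply: le_trans (norm_le_expR_half x).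
  by rewrite ger0_norm ?le_max ?lexx ?orbT// ge_max ler_normr lexx orbT /=.
Qed.

(** For independent mean-one exponentials $X,Y$ the integrand is $P(Y>w+x)$, so the integral is
    $P(Y-X>w)$, a tail of the Laplace law. For $w<0$ the range splits at $x=-w$, below which the
    integrand is $1$. *)
Lemma exp1_expR_excess w :
  \int[exp1 R]_x (expR (- Num.max (w + x) 0)) =
  if 0 <= w then expR (- w) / 2 else 1 - expR w / 2.
Proof.
have me (c l : R) : measurable_fun [set: R] (fun x => (expR (c + l * x))%:E).
  apply/measurable_EFinP; apply: measurableT_comp => //.
  by apply: measurable_funD => //; apply: measurable_funM.
have eE (c l : R) x : (expR (c + l * x))%:E = ((expR c)%:E * (expR (l * x))%:E)%E.
  by rewrite expRD EFinM.
have mexc : measurable_fun [set: R] (fun x : R => expR (- Num.max (w + x) 0)).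
  apply: measurableT_comp => //; apply: measurableT_comp => //.
  by apply: measurable_maxr => //; exact: measurable_funD.
have half a c l : 0 < l ->
    (\int[mu]_(x in `[a, +oo[) (expR (c + - l * x))%:E = (expR c * (expR (- l * a) / l))%:E)%E.
  move=> l0; under eq_integral do rewrite eE.
  rewrite ge0_integralZl//; last first.
    apply: measurable_funTS; apply/measurable_EFinP; apply: measurableT_comp => //.
  by rewrite integral_expR_halfline.
rewrite exp1_RintegralE//.
case: (leP 0 w) => w0.
  rewrite (@eq_integral _ _ _ mu _ (fun x : R => (expR (- w + - 2 * x))%:E)); last first.
    move=> x; rewrite inE/= in_itv/= andbT => x0; rewrite -expRD max_l; last lra.
    by congr (expR _)%:E; ring.
  by rewrite half//= mulr0 expR0; field.
rewrite (@ge0_integral_halfline_split _ _ (- w)); last 3 first.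
- by apply/measurable_EFinP; apply: measurable_funM => //; apply: measurableT_comp.
- by move=> x; rewrite lee_fin mulr_ge0// expR_ge0.
- lra.
rewrite (@eq_integral _ _ _ mu _ (fun x : R => (expR (- 1 * x))%:E)); last first.
  move=> x; rewrite inE/= in_itv/= => /andP[x0 xw]; rewrite -expRD max_r; last lra.
  by congr (expR _)%:E; ring.
rewrite integral_expR_segment//; last lra.
rewrite (@eq_integral _ _ _ mu _ (fun x : R => (expR (- w + - 2 * x))%:E)); last first.
  move=> x; rewrite inE/= in_itv/= andbT => x0; rewrite -expRD max_l; last lra.
  by congr (expR _)%:E; ring.
rewrite half//= mulr0 expR0 divr1 mulN1r opprK mulrA -expRD.
by rewrite (_ : - w + -2 * - w = w); [field|ring].
Qed.

End exponential_integrals.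

Section noise_facts.
Context {R : realType}.
Notation mR := (measurableTypeR R).
Notation NT := (mR * mR * mR)%type.
Implicit Types (w : NT) (r : R).

(** Common majorant for functions of the three weights. It is a product over coordinates, as the
    Fubini lemmas require; the rate $1/2$ is below the rate $1$ of the weights, hence integrable,
    and yet leaves room for cubes of affine functions ([growth3_le]). *)
Definition noise_dom w : R :=
  expR (1 / 2 * `|w.1.1|) * expR (1 / 2 * `|w.1.2|) * expR (1 / 2 * `|w.2|).

Lemma measurable_expR_norm (l : R) : measurable_fun [set: R] (fun x => expR (l * `|x|)).
Proof. by apply: measurableT_comp => //; apply: measurable_funM. Qed.

Let mexpN (l : R) : measurable_fun [set: mR] (fun x : mR => expR (l * `|x|)).
Proof. exact: measurable_expR_norm. Qed.

Let mexp11 : measurable_fun [set: NT] (fun w => expR (1 / 2 * `|w.1.1|)).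
Proof.
apply: (measurableT_comp (mexpN (1 / 2))).
exact: measurableT_comp measurable_fst measurable_fst.
Qed.

Let mexp12 : measurable_fun [set: NT] (fun w => expR (1 / 2 * `|w.1.2|)).
Proof.
apply: (measurableT_comp (mexpN (1 / 2))).
exact: measurableT_comp measurable_snd measurable_fst.
Qed.

Let mexp2 : measurable_fun [set: NT] (fun w => expR (1 / 2 * `|w.2|)).
Proof.
apply: (measurableT_comp (mexpN (1 / 2))).
exact: measurable_snd.
Qed.

Lemma measurable_noise_dom : measurable_fun [set: NT] noise_dom.
Proof. by apply: measurable_funM => //; apply: measurable_funM. Qed.

Lemma noise_dom_ge1 w : 1 <= noise_dom w.
Proof.
have h (x : R) : 1 <= expR (1 / 2 * `|x|).
  by rewrite -expR0 ler_expR mulr_ge0// ?normr_ge0//; lra.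
rewrite /noise_dom -[leLHS]mulr1 ler_pM// -[leLHS]mulr1 ler_pM//.
Qed.

Lemma noise_dom_ge0 w : 0 <= noise_dom w.
Proof. exact: le_trans (noise_dom_ge1 w). Qed.

Definition noise_xy : probability (mR * mR)%type R := (exp1 R \x exp1 R)%E.

Lemma intg_noise_prod (f : NT -> R) (D1 : mR * mR -> R) (D2 : mR -> R) :
  measurable_fun [set: NT] f -> intg noise_xy D1 -> intg (exp1 R) D2 ->
  (forall u z, `|f (u, z)| <= D1 u * D2 z) ->
  [/\ intg (noise R) f,
      \int[noise R]_w f w = \int[noise_xy]_u \int[exp1 R]_z f (u, z) &
      \int[noise R]_w f w = \int[exp1 R]_z \int[noise_xy]_u f (u, z)].
Proof.
move=> mf i1 i2 fD; split; first exact: intg_prod fD.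
- exact: (Rintegral_prod mf i1 i2 fD).
- exact: (Rintegral_prod2 mf i1 i2 fD).
Qed.

Lemma intg_noise_xy_dom : intg noise_xy
  (fun u : mR * mR => expR (1 / 2 * `|u.1|) * expR (1 / 2 * `|u.2|)).
Proof.
have i := @intg_exp1_expR R.
have mxy : measurable_fun [set: mR * mR]
    (fun u : mR * mR => expR (1 / 2 * `|u.1|) * expR (1 / 2 * `|u.2|)).
  apply: measurable_funM; apply: (measurableT_comp (mexpN (1 / 2))) => //.
apply: (intg_prod mxy i i) => x y.
by rewrite /= ger0_norm ?mulr_ge0 ?expR_ge0.
Qed.

Lemma intg_noise_dom : intg (noise R) noise_dom.
Proof.
have [] // := intg_noise_prod measurable_noise_dom intg_noise_xy_dom (@intg_exp1_expR R).
by move=> u z; rewrite ger0_norm ?noise_dom_ge0.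
Qed.

Definition noise_const : R := \int[noise R]_w noise_dom w.

Definition noise_pos : set NT := (`]0, +oo[ `*` `]0, +oo[) `*` `]0, +oo[.

Lemma measurable_noise_pos : measurable noise_pos.
Proof. by apply: measurableX => //; exact: measurableX. Qed.

Lemma noise_setX (A B C : set mR) : measurable A -> measurable B -> measurable C ->
  noise R ((A `*` B) `*` C) = (exp1 R A * exp1 R B * exp1 R C)%E.
Proof.
move=> mA mB mC.
rewrite /noise/= product_measure1E//; last exact: measurableX.
by rewrite /= product_measure1E.
Qed.

Lemma noise_posC : noise R (~` noise_pos) = 0%E.
Proof.
rewrite probability_setC; last exact: measurable_noise_pos.
rewrite noise_setX// !exp1_tail.
by rewrite maxxx oppr0 expR0 !mule1 subee.
Qed.

(** The octant of positive weights has full mass. Identities between minima and absolute values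
    therefore have to be checked there only. *)
Lemma eq_noise_integral (f g : NT -> \bar R) :
  measurable_fun [set: NT] f -> measurable_fun [set: NT] g ->
  (forall w, 0 < w.1.1 -> 0 < w.1.2 -> 0 < w.2 -> f w = g w) ->
  (\int[noise R]_w f w = \int[noise R]_w g w)%E.
Proof.
move=> mf mg fg; apply: ae_eq_integral => //.
exists (~` noise_pos); split.
- by apply: measurableC; exact: measurable_noise_pos.
- exact: noise_posC.
- move=> [[x y] z] /= h [[/= x0 y0] z0]; apply: h => _.
  move: x0 y0 z0; rewrite !in_itv/= !andbT => x0 y0 z0.
  by apply: fg.
Qed.

Lemma noise_eq_pos (A B : set NT) : measurable A -> measurable B ->
  (forall w, 0 < w.1.1 -> 0 < w.1.2 -> 0 < w.2 -> A w <-> B w) ->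
  noise R A = noise R B.
Proof.
move=> mA mB AB.
rewrite (measure_integral_indic (noise R) mA) (measure_integral_indic (noise R) mB).
apply: eq_noise_integral; try exact/measurable_EFinP/measurable_indic.
move=> w x0 y0 z0; rewrite !indicE.
suff -> : (w \in A) = (w \in B) by [].
by apply/idP/idP; rewrite !inE => /AB; apply.
Qed.

Lemma eq_noise_Rintegral (f g : NT -> R) :
  measurable_fun [set: NT] f -> measurable_fun [set: NT] g ->
  (forall w, 0 < w.1.1 -> 0 < w.1.2 -> 0 < w.2 -> f w = g w) ->
  \int[noise R]_w f w = \int[noise R]_w g w.
Proof.
move=> mf mg fg; congr fine; apply: eq_noise_integral.
- exact/measurable_EFinP.
- exact/measurable_EFinP.
- by move=> w x0 y0 z0; rewrite fg.
Qed.

Lemma intg_noise_dominated (f : NT -> R) (c : R) : measurable_fun [set: NT] f ->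
  (forall w, `|f w| <= c * noise_dom w) -> intg (noise R) f.
Proof.
move=> mf fc; apply: (@intg_dom _ _ _ _ (fun w => c * noise_dom w)) => //.
exact/intgZ/intg_noise_dom.
Qed.

Lemma norm_Rintegral_noise_dominated (f : NT -> R) (c : R) : measurable_fun [set: NT] f ->
  (forall w, `|f w| <= c * noise_dom w) -> `|\int[noise R]_w f w| <= c * noise_const.
Proof.
move=> mf fc; rewrite /noise_const -RintegralZl//; last exact: intg_noise_dom.
by apply: le_norm_Rintegral => //; exact/intgZ/intg_noise_dom.
Qed.

Definition noise_swap w : NT := (w.1.2, w.1.1, w.2).

Lemma measurable_noise_swap : measurable_fun [set: NT] noise_swap.
Proof.
apply: measurable_fun_pair => /=; last exact: measurable_snd.
by apply: measurable_fun_pair; [exact: measurableT_comp measurable_snd measurable_fst|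
  exact: measurableT_comp measurable_fst measurable_fst].
Qed.

(** Exchanging the rails maps rectangles to rectangles of the same mass, and rectangles determine a
    product measure. *)
Lemma Rintegral_noise_swap (f : NT -> R) : intg (noise R) f ->
  \int[noise R]_w f w = \int[noise R]_w f (noise_swap w).
Proof.
move=> fi.
pose sw (u : mR * mR) : (mR * mR) := (u.2, u.1).
have msw : measurable_fun [set: mR * mR] sw by apply: measurable_fun_pair.
have xyE A : measurable A -> noise_xy A = noise_xy (sw @^-1` A).
  move=> mA.
  rewrite -[RHS]/(pushforward noise_xy sw A).
  apply: (@product_measure_unique _ _ _ _ R (exp1 R) (exp1 R) (pushforward noise_xy sw)) => //.
  move=> B C mB mC; transitivity (noise_xy (C `*` B)).
    by congr (noise_xy _); apply/seteqP; split => -[x y] [].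
  by rewrite [LHS]product_measure1E// muleC.
have nE A : measurable A -> noise R A = noise R (noise_swap @^-1` A).
  move=> mA; rewrite -[RHS]/(pushforward (noise R) noise_swap A).
  apply: (@product_measure_unique _ _ _ _ R noise_xy (exp1 R)
    (pushforward (noise R) noise_swap)); last exact: mA.
    exact: measurable_noise_swap.
  move=> mswN.
  move=> B C mB mC; transitivity (noise R ((sw @^-1` B) `*` C)).
    by congr (noise R _); apply/seteqP; split => -[[x y] z] [].
  have msB : measurable (sw @^-1` B) by rewrite -[X in measurable X]setTI; exact: msw.
  transitivity (noise_xy (sw @^-1` B) * exp1 R C)%E.
    exact: (product_measure1E noise_xy (exp1 R) msB mC).
  exact: (congr1 (fun t => t * exp1 R C)%E (esym (xyE _ mB))).
exact: (law_Rintegral measurable_noise_swap nE fi).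
Qed.

End noise_facts.

Opaque noise exp1.

(** * One step of the chain *)

Section step_facts.
Context {R : realType}.
Notation mR := (measurableTypeR R).
Notation NT := (mR * mR * mR)%type.
Implicit Types (w : NT) (r : R) (m : state R).

(** For $z\ge0$ the step truncates $r+y-x$ to $[-z,z]$: the passage times to the two ends of a rung
    differ by at most its weight. The absence of $r$ from the bound is the source of uniformity in
    the starting point. *)
Lemma norm_delta_step m : `|delta_step m| <= `|m.2.2|.
Proof.
suff h (r x y z : R) : `|Num.min (r + y) (x + z) - Num.min (r + y + z) x| <= `|z|.
  by case: m => r [[x y] z]; exact: h.
have := ler_norm z; have := ler_norm (- z); rewrite normrN.
by case: (leP (r + y) (x + z)) => ?; case: (leP (r + y + z) x) => ? ? ?;
  rewrite ler_norml; apply/andP; split; lra.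
Qed.

Lemma ladder_f_lip r w w' :
  `|ladder_f (r, w) - ladder_f (r, w')| <=
  `|w.1.1 - w'.1.1| + `|w.1.2 - w'.1.2| + `|w.2 - w'.2|.
Proof.
case: w => [[x y] z]; case: w' => [[x' y'] z'] /=.
have := ler_norm (x - x'); have := ler_norm (y - y'); have := ler_norm (z - z').
have := ler_normr (x' - x) (x - x'); rewrite distrC.
have h (a b : R) : - `|a - b| <= a - b by rewrite lerNl -normrN ler_norm.
have := h x x'; have := h y y'; have := h z z'.
case: (lerP (r + y + z) x) => ?; case: (lerP (r + y' + z') x') => ?;
  rewrite ler_norml => *; apply/andP; split; lra.
Qed.

Lemma measurable_ladder_f : measurable_fun [set: state R] (@ladder_f R).
Proof.
rewrite (_ : ladder_f = fun m => Num.min (m.1 + m.2.1.2 + m.2.2) m.2.1.1); last first.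
  by apply/funext => -[r [[x y] z]].
have mr : measurable_fun [set: state R] (fun m : state R => m.1).
  exact: measurable_fst.
have mz : measurable_fun [set: state R] (fun m : state R => m.2.2).
  exact: measurableT_comp measurable_snd measurable_snd.
have mxy : measurable_fun [set: state R] (fun m : state R => m.2.1).
  exact: measurableT_comp measurable_fst measurable_snd.
have mx : measurable_fun [set: state R] (fun m : state R => m.2.1.1).
  exact: measurableT_comp measurable_fst mxy.
have my : measurable_fun [set: state R] (fun m : state R => m.2.1.2).
  exact: measurableT_comp measurable_snd mxy.
by apply: measurable_minr => //; repeat apply: measurable_funD.
Qed.

Definition growth m : R := 1 + `|m.1| + `|m.2.1.1| + `|m.2.1.2| + `|m.2.2|.
Definition state_dom m : R := expR (1 / 2 * `|m.1|) * noise_dom m.2.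

Lemma growth_ge1 m : 1 <= growth m.
Proof. by rewrite /growth -!addrA lerDl !addr_ge0. Qed.

(** With $t$ the sum of the absolute values of the coordinates, $1+t\le 6e^{t/6}$, and the cube of
    the right-hand side is $216\,e^{t/2}$. The third power serves the Taylor remainder of the
    exchange argument. *)
Lemma growth3_le m : growth m ^+ 3 <= 216 * state_dom m.
Proof.
set t := `|m.1| + `|m.2.1.1| + `|m.2.1.2| + `|m.2.2|.
have -> : state_dom m = expR (t / 6) ^+ 3.
  rewrite /state_dom /noise_dom -!expRD -expRM_natl; congr expR.
  by rewrite /t; field.
rewrite -(_ : 6 ^+ 3 = 216) -?exprMn; last by ring.
apply: lerXn2r; rewrite ?nnegrE.
- exact: le_trans (growth_ge1 m).
- by rewrite mulr_ge0 ?expR_ge0.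
- rewrite (_ : growth m = 1 + t); last by rewrite /growth /t; ring.
  by have := expR_ge1Dx (t / 6); lra.
Qed.

Lemma growth2_le m : growth m ^+ 2 <= 216 * state_dom m.
Proof.
by apply: le_trans (growth3_le m); apply: ler_weXn2l; rewrite ?growth_ge1.
Qed.

Lemma growth_le m : growth m <= 216 * state_dom m.
Proof.
by apply: le_trans (growth3_le m); rewrite -{1}[growth m]expr1; apply: ler_weXn2l; rewrite ?growth_ge1.
Qed.

Lemma norm_ladder_f m : `|ladder_f m| <= growth m.
Proof.
case: m => r [[x y] z]; rewrite /growth/=.
have h (a : R) : - `|a| <= a <= `|a| by rewrite -ler_norml.
have := h r; have := h x; have := h y; have := h z.
have := normr_ge0 r; have := normr_ge0 x; have := normr_ge0 y; have := normr_ge0 z.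
case: (lerP (r + y + z) x) => ?; rewrite ler_norml => *; apply/andP; split; lra.
Qed.

(** The probability $P(Y-X>v)$ for two independent mean-one exponential variables. *)
Definition laplace_tail (v : R) : R :=
  if 0 <= v then expR (- v) / 2 else 1 - expR v / 2.

Lemma laplace_tailN v : laplace_tail (- v) = 1 - laplace_tail v.
Proof.
rewrite /laplace_tail; case: (ltrgtP v 0) => v0.
- by rewrite oppr_ge0 (ltW v0) opprK; lra.
- by rewrite oppr_ge0 leNgt v0 /=.
- by rewrite v0 oppr0 lexx oppr0 expR0; lra.
Qed.

Definition diff_gt (s : R) : set (mR * mR) := [set u | s < u.2 - u.1].

Lemma measurable_diff_gt s : measurable (diff_gt s).
Proof.
rewrite -[diff_gt s]setTI; apply: measurable_fun_ltr => //.
by apply: measurable_funB.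
Qed.

Let mexc s : measurable_fun [set: R] (fun x : R => expR (- Num.max (s + x) 0)).
Proof.
apply: measurableT_comp => //; apply: measurableT_comp => //.
by apply: measurable_maxr => //; exact: measurable_funD.
Qed.

Let exc_int s : (\int[exp1 R]_x (expR (- Num.max (s + x) 0))%:E)%E = (laplace_tail s)%:E.
Proof.
rewrite -[RHS]/((if _ then _ else _)%:E) -(exp1_expR_excess s) /Rintegral fineK//.
apply: integrable_fin_num => //.
apply: (@intg_exp1_dom _ _ 1) => [|x]; first exact: mexc.
rewrite ger0_norm ?expR_ge0// mul1r ler_expR.
by rewrite (@le_trans _ _ 0)// ?oppr_le0 ?le_max ?lexx ?orbT// mulr_ge0//; lra.
Qed.

Lemma noise_xy_diff_gt s : noise_xy (diff_gt s) = (laplace_tail s)%:E.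
Proof.
rewrite -exc_int; apply: eq_integral => x _ /=.
rewrite -(exp1_tail false); congr (exp1 R _); apply/seteqP; split => y.
  by rewrite /xsection/= inE /diff_gt/= in_itv/= andbT; lra.
by rewrite /xsection/= inE /diff_gt/= in_itv/= andbT; lra.
Qed.

End step_facts.

Section step_law.
Context {R : realType}.
Notation mR := (measurableTypeR R).
Notation NT := (mR * mR * mR)%type.
Implicit Types (w : NT) (r s : R).

Lemma measurable_step_section r : measurable_fun [set: NT] (fun w => delta_step (r, w)).
Proof. apply: measurableT_comp; [exact: measurable_delta_step|exact: pair1_measurable]. Qed.

Lemma measurable_step_gt r s : measurable [set w : NT | s < delta_step (r, w)].
Proof.
rewrite -[X in measurable X]setTI; apply: measurable_fun_ltr => //.
exact: measurable_step_section.
Qed.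

Lemma measurable_step_le r s : measurable [set w : NT | delta_step (r, w) <= s].
Proof.
rewrite -[X in measurable X]setTI; apply: measurable_fun_ler => //.
exact: measurable_step_section.
Qed.

Lemma noise_prodE (A : set (mR * mR)) (B : set mR) : measurable A -> measurable B ->
  noise R (A `*` B) = (noise_xy A * exp1 R B)%E.
Proof. by move=> mA mB; exact: (product_measure1E noise_xy (exp1 R) mA mB). Qed.

(** For $z>0$ the truncation of $r+y-x$ to $[-z,z]$ exceeds $s\ge0$ exactly when $r+y-x>s$ and
    $z>s$, and these two events are independent. *)
Lemma noise_step_gt r s : 0 <= s ->
  noise R [set w | s < delta_step (r, w)] = (expR (- s) * laplace_tail (s - r))%:E.
Proof.
move=> s0.
rewrite (noise_eq_pos (@measurable_step_gt r s)
    (measurableX (measurable_diff_gt (s - r)) (measurable_itv `]s, +oo[))).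
  rewrite noise_prodE//; last exact: measurable_diff_gt.
  by rewrite noise_xy_diff_gt exp1_tail max_l// -EFinM mulrC.
suff h (x y z : R) : 0 < z ->
  s < Num.min (r + y) (x + z) - Num.min (r + y + z) x <-> s - r < y - x /\ s < z.
  move=> [[x y] z] /= x0 y0 z0; rewrite /diff_gt/= in_itv/= andbT.
  by have := h x y z z0.
move=> z0; case: (leP (r + y) (x + z)) => ?; case: (leP (r + y + z) x) => ?; split=> [|[]]; try lra.
Qed.

(** Mirror image of [noise_step_gt]: the truncated value is at most $s<0$ exactly when $r+y-x\le s$
    and $z\ge-s$. [laplace_tailN] turns the complementary probability back into a tail. *)
Lemma noise_step_le r s : s < 0 ->
  noise R [set w | delta_step (r, w) <= s] = (expR s * laplace_tail (r - s))%:E.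
Proof.
move=> s0.
have mC : measurable (~` diff_gt (s - r) : set (mR * mR)).
  by apply: measurableC; exact: measurable_diff_gt.
rewrite (noise_eq_pos (@measurable_step_le r s)
    (measurableX mC (measurable_itv `[- s, +oo[))).
  rewrite noise_prodE// probability_setC; last exact: measurable_diff_gt.
  rewrite noise_xy_diff_gt exp1_tail max_l; last lra.
  rewrite -[1%E]/(1%:E) -EFinB -EFinM mulrC opprK.
  by rewrite -laplace_tailN opprB.
suff h (x y z : R) : 0 < z ->
  Num.min (r + y) (x + z) - Num.min (r + y + z) x <= s <-> (~ s - r < y - x) /\ - s <= z.
  move=> [[x y] z] /= x0 y0 z0; rewrite /diff_gt/= in_itv/= andbT.
  by have := h x y z z0.
move=> z0; have E : (~ s - r < y - x) <-> y - x <= s - r by rewrite leNgt; split => /negP.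
rewrite E; case: (leP (r + y) (x + z)) => ?; case: (leP (r + y + z) x) => ?; split=> [|[]]; try lra.
Qed.

(** The two summands are the increments of $l_n$ and $l_n'$, the second read through the reflection
    of the ladder. If $|r+y-x|\le z$, both ends are reached along their own rails and the sum is
    $x+y$; otherwise one end is reached through the rung, which saves $|r+y-x|-z$. *)
Lemma ladder_f_sum r w : 0 < w.2 ->
  ladder_f (r, w) + ladder_f (- r, noise_swap w) =
  w.1.1 + w.1.2 - `|r + w.1.2 - w.1.1| + `|delta_step (r, w)|.
Proof.
suff h (x y z : R) : 0 < z ->
    Num.min (r + y + z) x + Num.min (- r + x + z) y =
    x + y - `|r + y - x| + `|Num.min (r + y) (x + z) - Num.min (r + y + z) x|.
  by case: w => [[x y] z]; exact: h.
move=> z0; have nE (a : R) : (0 <= a /\ `|a| = a) \/ (a <= 0 /\ `|a| = - a).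
  by case: (ger0P a) => h; [left|right]; split; lra.
case: (nE (r + y - x)) => -[? ->];
case: (nE (Num.min (r + y) (x + z) - Num.min (r + y + z) x)) => -[+ ->];
case: (leP (r + y) (x + z)) => ?; case: (leP (r + y + z) x) => ?;
case: (leP (- r + x + z) y) => ? ?; lra.
Qed.

Definition mean_abs_shift r : R := \int[noise R]_w `|r + w.1.2 - w.1.1|.

Let mx : measurable_fun [set: NT] (fun w => w.1.1).
Proof. exact: measurableT_comp measurable_fst measurable_fst. Qed.
Let my : measurable_fun [set: NT] (fun w => w.1.2).
Proof. exact: measurableT_comp measurable_snd measurable_fst. Qed.
Let mz : measurable_fun [set: NT] (fun w => w.2).
Proof. exact: measurable_snd. Qed.

Lemma noise_dom_le w : 1 + `|w.1.1| + `|w.1.2| + `|w.2| <= 216 * noise_dom w.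
Proof.
have := growth_le (0, w); rewrite /growth /state_dom/= normr0 mulr0 expR0 mul1r.
by rewrite addr0.
Qed.

Lemma intg_noise_x : intg (noise R) (fun w => w.1.1).
Proof.
apply: (intg_noise_dominated (c := 216) mx) => w; apply: le_trans (noise_dom_le w).
by have := normr_ge0 w.1.2; have := normr_ge0 w.2; lra.
Qed.

Lemma intg_noise_y : intg (noise R) (fun w => w.1.2).
Proof.
apply: (intg_noise_dominated (c := 216) my) => w; apply: le_trans (noise_dom_le w).
by have := normr_ge0 w.1.1; have := normr_ge0 w.2; lra.
Qed.

Lemma intg_noise_z : intg (noise R) (fun w => `|w.2|).
Proof.
apply: (intg_noise_dominated (c := 216)); first exact: measurableT_comp mz.
move=> w; apply: le_trans (noise_dom_le w).
by rewrite normr_id; have := normr_ge0 w.1.1; have := normr_ge0 w.1.2; lra.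
Qed.

Lemma Rintegral_noise_fst (f : mR * mR -> R) : intg noise_xy f ->
  \int[noise R]_w f w.1 = \int[noise_xy]_u f u.
Proof.
move=> fi.
have mf : measurable_fun [set: NT] (fun w => f w.1).
  exact: measurableT_comp (measurable_intg fi) measurable_fst.
have [_ -> _] := intg_noise_prod mf (intg_norm fi) (intg_cst (exp1 R) 1)
  ltac:(by move=> u z; rewrite mulr1).
by apply: eq_Rintegral => u _; exact: (Rintegral_cstp (exp1 R) (f u)).
Qed.

Lemma noise_mean_x : \int[noise R]_w w.1.1 = 1.
Proof.
have e (x : R) : 1 <= expR (1 / 2 * `|x|).
  by rewrite -expR0 ler_expR mulr_ge0// ?normr_ge0//; lra.
have i1 := @intg_exp1_dom R id 2 (@measurable_id _ _ _) (@norm_le_expR_half R).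
have mf : measurable_fun [set: mR * mR] (fun u : mR * mR => u.1) := measurable_fst.
have fD (x y : mR) : `|(x, y).1| <= `|x| * 1 by rewrite mulr1.
have i2 := intg_norm i1.
rewrite (@Rintegral_noise_fst (fun u => u.1)); last first.
  exact: (intg_prod mf i2 (intg_cst (exp1 R) 1) fD).
rewrite -[RHS](@exp1_mean R) [LHS](Rintegral_prod mf i2 (intg_cst (exp1 R) 1) fD).
by apply: eq_Rintegral => x _; exact: (Rintegral_cstp (exp1 R) x).
Qed.

Lemma noise_mean_y : \int[noise R]_w w.1.2 = 1.
Proof. by rewrite Rintegral_noise_swap; [exact: noise_mean_x|exact: intg_noise_y]. Qed.

(** Given $Y$, the excess of $X$ over $r+Y$ has mean $e^{-r-Y}$, and $E\,e^{-Y}=1/2$. The inner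
    maximum keeps the level nonnegative for all values of $y$, as [exp1_mean_excess] demands. *)
Let excess r : 0 <= r ->
  \int[noise R]_w Num.max (w.1.1 - (r + Num.max w.1.2 0)) 0 = expR (- r) / 2.
Proof.
move=> r0.
have mf : measurable_fun [set: mR * mR] (fun u : mR * mR => Num.max (u.1 - (r + Num.max u.2 0)) 0).
  apply: measurable_maxr => //; apply: measurable_funB => //.
  by apply: measurable_funD => //; apply: measurable_maxr.
have fD (x y : mR) : `|(fun u : mR * mR => Num.max (u.1 - (r + Num.max u.2 0)) 0) (x, y)| <= `|x| * 1.
  have h (a b : R) : `|Num.max (a - (r + Num.max b 0)) 0| <= `|a| * 1.
    rewrite mulr1 ger0_norm ?le_max ?lexx ?orbT// ge_max normr_ge0 andbT.
    have := ler_norm a; have : 0 <= Num.max b 0 by rewrite le_max lexx orbT.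
    lra.
  exact: h.
have i1 := @intg_exp1_dom R id 2 (@measurable_id _ _ _) (@norm_le_expR_half R).
have i2 := intg_norm i1.
rewrite (@Rintegral_noise_fst (fun u => Num.max (u.1 - (r + Num.max u.2 0)) 0)); last first.
  exact: (intg_prod mf i2 (intg_cst (exp1 R) 1) fD).
rewrite [LHS](Rintegral_prod2 mf i2 (intg_cst (exp1 R) 1) fD) /=.
under eq_Rintegral.
  move=> y _; rewrite exp1_mean_excess; last by rewrite addr_ge0// le_max lexx orbT.
  rewrite opprD expRD (_ : Num.max y 0 = Num.max (0 + y) 0); last by rewrite add0r.
  over.
rewrite RintegralZl//.
  by rewrite (exp1_expR_excess 0) lexx oppr0 expR0 mul1r.
apply: (@intg_exp1_dom _ _ 1).
  apply: measurableT_comp => //; apply: measurableT_comp => //.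
  by apply: measurable_maxr => //; exact: measurable_funD.
move=> x; rewrite ger0_norm ?expR_ge0// mul1r ler_expR.
by rewrite (@le_trans _ _ 0)// ?oppr_le0 ?le_max ?lexx ?orbT// mulr_ge0//; lra.
Qed.

Let mshift r : measurable_fun [set: NT] (fun w => `|r + w.1.2 - w.1.1|).
Proof. by apply: measurableT_comp => //; apply: measurable_funB => //; apply: measurable_funD. Qed.

Lemma norm_shift_le r w : `|r + w.1.2 - w.1.1| <= 216 * (1 + `|r|) * noise_dom w.
Proof.
have h : `|r + w.1.2 - w.1.1| <= `|r| + (`|w.1.2| + `|w.1.1|).
  by rewrite -addrA (le_trans (ler_normD _ _))// lerD2l ler_normB.
apply: le_trans h _; have := noise_dom_le w; have := noise_dom_ge1 w.
have := normr_ge0 w.2; have := normr_ge0 r => r0 z0 d1 d2.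
have : `|r| <= `|r| * noise_dom w by rewrite ler_peMr.
rewrite mulrDr mulr1 mulrDl -[_ * `|r| * _]mulrA.
lra.
Qed.

Lemma intg_shift r : intg (noise R) (fun w => `|r + w.1.2 - w.1.1|).
Proof.
apply: (intg_noise_dominated (c := 216 * (1 + `|r|)) (mshift r)) => w.
by rewrite normr_id; exact: norm_shift_le.
Qed.

Lemma mean_abs_shiftN r : mean_abs_shift (- r) = mean_abs_shift r.
Proof.
rewrite /mean_abs_shift (Rintegral_noise_swap (intg_shift (- r))).
apply: eq_Rintegral => w _; rewrite -normrN; congr (`|_|).
by rewrite /noise_swap/= !opprD !opprK addrAC.
Qed.

(** By reflection $r\ge0$. Then $|a|=a+2a^-$ for $a=r+Y-X$, which has mean $r$, and [excess] gives
    the mean of the negative part. *)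
Lemma mean_abs_shiftE r : mean_abs_shift r = `|r| + expR (- `|r|).
Proof.
wlog r0 : r / 0 <= r => [h|].
  have [r0|r0] := leP 0 r; first exact: h.
  by rewrite -mean_abs_shiftN h ?normrN// oppr_ge0 ltW.
have mm : measurable_fun [set: NT] (fun w => Num.max (w.1.1 - (r + Num.max w.1.2 0)) 0).
  apply: measurable_maxr => //; apply: measurable_funB => //.
  by apply: measurable_funD => //; apply: measurable_maxr.
have im : intg (noise R) (fun w => Num.max (w.1.1 - (r + Num.max w.1.2 0)) 0).
  apply: (intg_dom mm (intg_norm intg_noise_x)) => w.
  have h (a b : R) : `|Num.max (a - (r + Num.max b 0)) 0| <= `|a|.
    rewrite ger0_norm ?le_max ?lexx ?orbT// ge_max normr_ge0 andbT.
    have := ler_norm a; have : 0 <= Num.max b 0 by rewrite le_max lexx orbT.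
    lra.
  exact: h.
have iyx := intgB intg_noise_y intg_noise_x.
have ir := intg_cst (noise R) r.
transitivity (\int[noise R]_w (r + (w.1.2 - w.1.1) +
    2 * Num.max (w.1.1 - (r + Num.max w.1.2 0)) 0)).
  apply: eq_noise_Rintegral => //.
  - apply: measurable_funD; last exact: measurable_funM.
    by apply: measurable_funD => //; apply: measurable_funB.
  - suff h (x y : R) : 0 < y -> `|r + y - x| = r + (y - x) + 2 * Num.max (x - (r + Num.max y 0)) 0.
      by move=> w _ y0 _; exact: h.
    move=> y0; rewrite (max_l (ltW y0)).
    by case: (ger0P (r + y - x)) => ?; case: (leP (x - (r + y)) 0) => ?; lra.
rewrite RintegralD//; [|exact: intgD|exact: intgZ].
rewrite RintegralZl// excess// RintegralD// RintegralB//; [|exact: intg_noise_y|exact: intg_noise_x].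
by rewrite (Rintegral_cstp (noise R) r) noise_mean_x noise_mean_y ger0_norm//; lra.
Qed.

End step_law.

(** * The invariant law *)

Section laplace_integrals.
Context {R : realType}.
Notation mu := (@lebesgue_measure R).
Notation mR := (measurableTypeR R).

Lemma integral_lebesgueN (f : R -> \bar R) : measurable_fun [set: R] f ->
  (forall x, (0 <= f x)%E) -> (\int[mu]_x f (- x)%R = \int[mu]_x f x)%E.
Proof.
move=> mf f0; apply/esym/law_integralE => //.
by move=> A mA; exact/esym/(lebesgue_measureN mA).
Qed.

Lemma integral_even_split (f : R -> \bar R) : measurable_fun [set: R] f ->
  (forall x, (0 <= f x)%E) ->
  (\int[mu]_x f x = \int[mu]_(x in `[0%R, +oo[) f x + \int[mu]_(x in `[0%R, +oo[) f (- x)%R)%E.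
Proof.
move=> mf f0.
have mfN : measurable_fun [set: R] (fun x => f (- x)) by exact: measurableT_comp.
rewrite -[X in integral _ X](setUv `[0, +oo[) ge0_integral_setU//=; last 3 first.
- exact: measurableC.
- by rewrite setUv.
- exact/disj_setPCl.
congr (_ + _)%E.
rewrite -integral_itv_obnd_cbnd; last exact: measurable_funTS.
rewrite [LHS]integral_mkcond [RHS]integral_mkcond -[LHS]integral_lebesgueN.
- apply: eq_integral => x _; rewrite !patchE.
  have -> // : (- x \in ~` `[0, +oo[%classic) = (x \in `]0, +oo[%classic).
  apply/idP/idP; rewrite !inE/= !in_itv/= !andbT oppr_ge0.
    by move=> /negP; rewrite -ltNge.
  by move=> x0; apply/negP; rewrite -ltNge.
- apply/(measurable_restrictT _ _).1 => //; last exact: measurable_funTS.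
  exact: measurableC.
- by move=> x; rewrite patchE; case: ifP.
Qed.

Lemma integral_laplace l : 0 < l ->
  (\int[mu]_r (expR (- l * `|r|))%:E = (2 / l)%:E)%E.
Proof.
move=> l0; rewrite integral_even_split//; last first.
  by apply/measurable_EFinP; exact: measurable_expR_norm.
rewrite [X in (X + _)%E](@eq_integral _ _ _ mu _ (fun r : R => (expR (- l * r))%:E)); last first.
  by move=> r; rewrite inE/= in_itv/= andbT => r0; rewrite ger0_norm.
rewrite [X in (_ + X)%E](@eq_integral _ _ _ mu _ (fun r : R => (expR (- l * r))%:E)); last first.
  by move=> r; rewrite inE/= in_itv/= andbT => r0; rewrite normrN ger0_norm.
by rewrite !integral_expR_halfline// mulr0 expR0 -EFinD; congr (_%:E); lra.
Qed.

Lemma intg_laplace l : 0 < l -> intg mu (fun r : R => expR (- l * `|r|)).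
Proof.
move=> l0; apply/integrableP; split.
  by apply/measurable_EFinP; exact: measurable_expR_norm.
under eq_integral do rewrite /= ger0_norm ?expR_ge0//.
by rewrite integral_laplace// ltry.
Qed.

Lemma integral_laplace_gt l s : 0 < l -> 0 <= s ->
  (\int[mu]_(r in `]s, +oo[) (expR (- l * `|r|))%:E = (expR (- l * s) / l)%:E)%E.
Proof.
move=> l0 s0; rewrite integral_itv_obnd_cbnd; last first.
  by apply/measurable_funTS/measurable_EFinP; exact: measurable_expR_norm.
rewrite -integral_expR_halfline//; apply: eq_integral => r.
rewrite inE/= in_itv/= andbT => sr; rewrite ger0_norm//; lra.
Qed.

Lemma measurable_laplace_tail : measurable_fun [set: R] (@laplace_tail R).
Proof.
rewrite /laplace_tail; apply: measurable_fun_ifT => //.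
- exact: measurable_fun_ler.
- by apply: measurable_funM => //; apply: measurableT_comp.
- by apply: measurable_funB => //; apply: measurable_funM.
Qed.

Lemma laplace_tail_ge0 (v : R) : 0 <= laplace_tail v <= 1.
Proof.
rewrite /laplace_tail; case: (leP 0 v) => v0.
  have : expR (- v) <= 1 by rewrite expR_le1 oppr_le0.
  by have := expR_ge0 (- v); lra.
have : expR v <= 1 by rewrite expR_le1 ltW.
by have := expR_ge0 v; lra.
Qed.

(** Explicit integration over $[0,s)$, $[s,\infty)$ and the negative half-line. The outcome involves
    $e^{-s}$ and $e^{-ls}$ only, which is what turns the invariance equation into a recursion
    between coefficients. *)
Lemma integral_laplace_tail l s : 1 < l -> 0 <= s ->
  (\int[mu]_r (laplace_tail (s - r) * expR (- l * `|r|))%:E =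
   ((l * expR (- s) - expR (- l * s) / l) / (l ^+ 2 - 1))%:E)%E.
Proof.
move=> l1 s0.
have mt : measurable_fun [set: R] (fun r : R => (laplace_tail (s - r) * expR (- l * `|r|))%:E).
  apply/measurable_EFinP; apply: measurable_funM; last exact: measurable_expR_norm.
  by apply: (measurableT_comp measurable_laplace_tail); apply: measurable_funB.
have t0 (r : R) : (0 <= (laplace_tail (s - r) * expR (- l * `|r|))%:E)%E.
  by rewrite lee_fin mulr_ge0 ?expR_ge0//; case/andP: (laplace_tail_ge0 (s - r)).
have mexpl (k c : R) : measurable_fun [set: R] (fun r : R => (c * expR (k * r))%:E).
  by apply/measurable_EFinP; apply: measurable_funM => //; apply: measurableT_comp => //; exact: measurable_funM.
have int_half (a k c : R) : 0 < k -> 0 <= c ->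
    (\int[mu]_(r in `[a, +oo[) (c * expR (- k * r))%:E = (c * (expR (- k * a) / k))%:E)%E.
  move=> k0 c0; under eq_integral do rewrite EFinM.
  rewrite ge0_integralZl_EFin// ?integral_expR_halfline//.
  by apply: measurable_funTS; have := mexpl (- k) 1; under eq_fun do rewrite mul1r.
have int_seg (k c : R) : 0 < k -> 0 <= c ->
    (\int[mu]_(r in `[0%R, s[) (c * expR (- k * r))%:E = (c * ((1 - expR (- k * s)) / k))%:E)%E.
  move=> k0 c0; under eq_integral do rewrite EFinM.
  rewrite ge0_integralZl_EFin// ?integral_expR_segment ?mulr0 ?expR0//.
  by apply: measurable_funTS; have := mexpl (- k) 1; under eq_fun do rewrite mul1r.
have int_i (a k c : R) : 0 < k -> 0 <= c ->
    mu.-integrable `[a, +oo[ (EFin \o (fun r : R => c * expR (- k * r))).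
  move=> k0 c0; apply/integrableP; split; first by apply: measurable_funTS; exact: mexpl.
  under eq_integral do rewrite /= ger0_norm ?mulr_ge0 ?expR_ge0//.
  by rewrite int_half// ltry.
rewrite integral_even_split// (@ge0_integral_halfline_split _ _ 0 s)//.
rewrite [X in (X + _ + _)%E](@eq_integral _ _ _ mu _
    (fun r : R => (expR (- s) / 2 * expR (- (l - 1) * r))%:E)); last first.
  move=> r; rewrite inE/= in_itv/= => /andP[r0 rs].
  rewrite /laplace_tail ifT; last lra.
  rewrite ger0_norm// !(mulrAC _ 2^-1) -!expRD; congr (expR _ / _)%:E; ring.
rewrite [X in (_ + X + _)%E](@eq_integral _ _ _ mu _
    (fun r : R => ((expR (- l * r))%:E - (expR s / 2 * expR (- (l + 1) * r))%:E)%E)); last first.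
  move=> r; rewrite inE/= in_itv/= andbT => rs.
  rewrite ger0_norm; last lra.
  rewrite -EFinB; congr (_%:E).
  have [rs'|rs'] := leP r s.
    have -> : r = s by lra.
    rewrite /laplace_tail subrr lexx oppr0 expR0.
    rewrite (mulrAC (expR s)) -expRD (_ : s + _ = - l * s); [lra|ring].
  rewrite /laplace_tail ifF; last by apply/negbTE; rewrite -ltNge; lra.
  rewrite mulrBl mul1r !(mulrAC _ 2^-1) -!expRD.
  by congr (_ - expR _ / _); ring.
rewrite [X in (_ + X)%E](@eq_integral _ _ _ mu _
    (fun r : R => (expR (- s) / 2 * expR (- (l + 1) * r))%:E)); last first.
  move=> r; rewrite inE/= in_itv/= andbT => r0.
  rewrite /laplace_tail ifT; last lra.
  rewrite normrN ger0_norm// !(mulrAC _ 2^-1) -!expRD; congr (expR _ / _)%:E; ring.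
rewrite integralB_EFin//; last 2 first.
- apply: eq_integrable (int_i s l 1 _ _) => //; [by move=> r _ /=; rewrite mul1r|lra].
- by apply: int_i; [lra|rewrite divr_ge0// expR_ge0].
have [p0 pm pp] : [/\ 0 < l, 0 < l - 1 & 0 < l + 1] by split; lra.
have [ep en] : 0 <= expR s / 2 /\ 0 <= expR (- s) / 2 by rewrite !divr_ge0 ?expR_ge0.
rewrite integral_expR_halfline// !int_half// int_seg//.
rewrite -EFinB -!EFinD mulr0 expR0; congr (_%:E).
have e1 : expR (- s) * expR (- (l - 1) * s) = expR (- l * s).
  by rewrite -expRD; congr expR; ring.
have e2 : expR s * expR (- (l + 1) * s) = expR (- l * s).
  by rewrite -expRD; congr expR; ring.
move: e1 e2; move: (expR (- s)) (expR s) (expR (- l * s)) (expR (- (l - 1) * s)) (expR (- (l + 1) * s)) => A B C D E AD BE.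
have l1n : l - 1 != 0 by lra.
have l2n : l + 1 != 0 by lra.
have l3n : l ^+ 2 - 1 != 0 by rewrite (_ : _ - _ = (l - 1) * (l + 1)) ?mulf_neq0//; ring.
have ln : l != 0 by lra.
rewrite (_ : A / 2 * _ = (A - A * D) / 2 / (l - 1)); last by field.
rewrite (_ : B / 2 * _ = B * E / 2 / (l + 1)); last by field.
rewrite AD BE; field.
by rewrite l1n l2n l3n ln.
Qed.

End laplace_integrals.

(** * Expansion of the invariant density in two-sided exponentials *)

Section pi_series.
Context {R : realType}.
Notation mu := (@lebesgue_measure R).
Notation mR := (measurableTypeR R).

Definition alt_coeff (nu k : nat) : R := (-1) ^+ k / (k`! * (k + nu)`!)%:R.

Lemma bessel2E nu : bessel nu (2 : R) = limn (series (alt_coeff nu)).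
Proof.
rewrite /bessel; congr (limn (series _)); apply/funext => k.
by rewrite /bessel_coeff /alt_coeff divff// expr1n mulr1.
Qed.

Lemma cvg_alt_coeff nu : series (alt_coeff nu) n @[n --> \oo] --> bessel nu (2 : R).
Proof.
rewrite bessel2E; have := @is_cvg_series_bessel R nu 2.
rewrite (_ : bessel_coeff nu 2 = alt_coeff nu)//.
by apply/funext => k; rewrite /bessel_coeff /alt_coeff divff// expr1n mulr1.
Qed.

Lemma fact_pair_gt0 (k nu : nat) : 0 < (k`! * (k + nu)`!)%:R :> R.
Proof. by rewrite ltr0n muln_gt0 !fact_gt0. Qed.

Lemma norm_alt_coeff nu k : `|alt_coeff nu k| <= k`!%:R^-1.
Proof.
rewrite /alt_coeff normrM normrX normrN1 expr1n mul1r ger0_norm; last first.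
  by rewrite invr_ge0 ltW// fact_pair_gt0.
rewrite lef_pV2 ?posrE ?fact_pair_gt0 ?ltr0n ?fact_gt0//.
by rewrite ler_nat leq_pmulr// fact_gt0.
Qed.

Lemma sum_norm_alt_coeff nu N : \sum_(0 <= k < N) `|alt_coeff nu k| <= expR 1.
Proof.
apply: (@le_trans _ _ (series (exp_coeff (1 : R)) N)).
  rewrite /series/=; apply: ler_sum => k _.
  by rewrite /exp_coeff/= expr1n mul1r; exact: norm_alt_coeff.
rewrite /expR; apply: nondecreasing_cvgn_le; last exact: is_cvg_series_exp_coeff.
by apply: nondecreasing_series => k _ _; rewrite exp_coeff_ge0.
Qed.

(** The series alternates with decreasing terms, so partial sums of positive even length stay above
    the first pair, $1/2-1/6=1/3$. *)
Lemma bessel22_gt0 : 0 < bessel 2 (2 : R).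
Proof.
pose u k : R := (k`! * (k + 2)`!)%:R^-1.
have uS k : u k.+1 <= u k.
  rewrite lef_pV2 ?posrE ?fact_pair_gt0// ler_nat.
  by rewrite addSn !factS leq_mul// leq_pmull.
have cE k : alt_coeff 2 k = (-1) ^+ k * u k by [].
have sD N : (-1) ^+ N.*2 = 1 :> R by rewrite -signr_odd odd_double.
have S2 N : 1 / 3 <= series (alt_coeff 2) N.+1.*2.
  elim: N => [|N IH].
    by rewrite /series/= !big_nat_recr//= big_geq// add0r /alt_coeff !factS !fact0/= expr0 expr1; lra.
  have SS m : series (alt_coeff 2) m.+2 =
      series (alt_coeff 2) m + (alt_coeff 2 m + alt_coeff 2 m.+1).
    by rewrite /series/= !big_nat_recr//= -addrA.
  rewrite [N.+2.*2]doubleS SS -[leLHS]addr0 lerD//.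
  by rewrite !cE exprS sD mulr1 mul1r mulN1r subr_ge0.
apply: (@lt_le_trans _ _ (1 / 3)); first by [].
have h : series (alt_coeff 2) n.+1.*2 @[n --> \oo] --> bessel 2 (2 : R).
  apply: (@cvg_comp _ _ _ (fun n : nat => n.+1.*2) (series (alt_coeff 2)) _ \oo _ _ (@cvg_alt_coeff 2)).
  apply/cvgnyPge => A; near=> n; rewrite (@leq_trans n)//.
    by near: n; exact: nbhs_infty_ge.
  by rewrite -addnn addSn leqW// leq_addr.
rewrite -(cvg_lim _ h)//; apply: limr_ge; first by apply/cvg_ex; eexists; exact: h.
exact: nearW.
Unshelve. all: by end_near. Qed.

Definition pi_const : R := (2 * bessel 2 2)^-1.

Lemma pi_const_gt0 : 0 < pi_const.
Proof. by rewrite invr_gt0 mulr_gt0// bessel22_gt0. Qed.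

(** In the expansion of $J_1(2e^{-|r|/2})$ the prefactor $e^{-3|r|/2}$ turns the term of index $k$
    into a multiple of $e^{-(k+2)|r|}$: the invariant law is a signed mixture of Laplace laws of
    rates $2,3,\ldots$ *)
Definition pi_partial N (r : R) : R :=
  pi_const * \sum_(0 <= k < N) alt_coeff 1 k * expR (- (k.+2)%:R * `|r|).

Lemma cvg_pi_partial r : pi_partial N r @[N --> \oo] --> pi_density r.
Proof.
rewrite /pi_density -/pi_const -mulrA; apply: cvgMr.
rewrite (_ : (fun N => _) = (fun N => expR (- (3 / 2) * `|r|) *
    series (bessel_coeff 1 (2 * expR (- (1 / 2) * `|r|))) N)); last first.
  apply/funext => N; rewrite /series/= mulr_sumr; apply: eq_bigr => k _.
  rewrite /bessel_coeff /alt_coeff mulrCA; congr (_ * _).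
  rewrite (_ : forall t : R, 2 * t / 2 = t); last by move=> t; field.
  rewrite -expRM_natl -expRD; congr expR.
  by rewrite natrD natrM -[k.+2]addn2 natrD; field.
by apply: cvgMr; exact: is_cvg_series_bessel.
Qed.

Lemma norm_pi_partial N r : `|pi_partial N r| <= pi_const * expR 1 * expR (- 2 * `|r|).
Proof.
rewrite /pi_partial normrM (ger0_norm (ltW pi_const_gt0)) -mulrA.
rewrite ler_wpM2l ?(ltW pi_const_gt0)//.
apply: le_trans (ler_norm_sum _ _ _) _.
apply: (@le_trans _ _ (\sum_(0 <= k < N) `|alt_coeff 1 k| * expR (- 2 * `|r|))).
  apply: ler_sum => k _; rewrite normrM (ger0_norm (expR_ge0 _)) ler_wpM2l//.
  by rewrite ler_expR !mulNr lerN2 ler_wpM2r// ler_nat.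
by rewrite -mulr_suml ler_wpM2r ?expR_ge0// sum_norm_alt_coeff.
Qed.

Lemma pi_lawE (A : set mR) : measurable A -> pi_law A = (\int[mu]_(r in A) (pi_density r)%:E)%E.
Proof. by []. Qed.

Lemma measurable_pi_partial N : measurable_fun [set: R] (pi_partial N).
Proof.
apply: measurable_funM => //; apply: measurable_sum => k.
by apply: measurable_funM => //; exact: measurable_expR_norm.
Qed.

(** Dominated convergence: all partial densities lie below a multiple of $e^{-2|r|}$, the slowest
    exponential present, so a test function of order $e^{|r|}$ still leaves the integrable majorant
    $e^{-|r|}$. *)
Lemma pi_law_termwise (w : R -> R) (C : R) : measurable_fun [set: R] w ->
  (forall r, `|w r| <= C * expR `|r|) ->
  intg (@pi_law R) w /\
  (fun N => pi_const * \sum_(0 <= k < N) alt_coeff 1 k *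
     \int[mu]_r (w r * expR (- (k.+2)%:R * `|r|))) n @[n --> \oo] -->
  \int[@pi_law R]_r w r.
Proof.
move=> mw wC.
have C0 : 0 <= C.
  by have := le_trans (normr_ge0 _) (wC 0); rewrite normr0 expR0 mulr1.
have part_dom N r : `|w r * pi_partial N r| <= C * (pi_const * expR 1) * expR (- 1 * `|r|).
  rewrite normrM.
  apply: (@le_trans _ _ (C * expR `|r| * (pi_const * expR 1 * expR (- 2 * `|r|)))).
    by rewrite ler_pM// norm_pi_partial.
  rewrite (_ : C * expR `|r| * _ = C * (pi_const * expR 1) * (expR `|r| * expR (- 2 * `|r|))); last by ring.
  by rewrite -expRD (_ : `|r| + _ = - 1 * `|r|)//; ring.
have iterm k : intg mu (fun r : R => w r * expR (- (k.+2)%:R * `|r|)).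
  apply: (@intg_dom _ _ _ mu (fun r : R => C * expR (- 1 * `|r|))).
  - by apply: measurable_funM => //; exact: measurable_expR_norm.
  - by apply: intgZ; apply: intg_laplace.
  - move=> r; rewrite normrM (ger0_norm (expR_ge0 _)).
    rewrite (@le_trans _ _ (C * expR `|r| * expR (- (k.+2)%:R * `|r|)))//.
      by rewrite ler_wpM2r ?expR_ge0.
    rewrite -mulrA ler_wpM2l// -expRD ler_expR.
    have : 0 <= k%:R * `|r| by rewrite mulr_ge0.
    by rewrite -[k.+2]addn2 natrD; have := normr_ge0 r; lra.
have [] := @dominated_convergence _ mR _ mu setT measurableT
  (fun N r => (w r * pi_partial N r)%:E) (fun r => (w r * pi_density r)%:E)
  (fun r => (C * (pi_const * expR 1) * expR (- 1 * `|r|))%:E).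
- by move=> N; apply/measurable_EFinP; apply: measurable_funM => //; exact: measurable_pi_partial.
- by apply/measurable_EFinP; apply: measurable_funM => //; exact: measurable_pi_density.
- apply: aeW => r _; apply: cvg_EFin; first exact: nearW.
  by apply: cvgMr; exact: cvg_pi_partial.
- by have := intgZ (C * (pi_const * expR 1)) (@intg_laplace R 1 ltr01).
- by apply: aeW => r N _; rewrite lee_fin; exact: part_dom.
move=> ilim _ cvl.
have il : intg (@pi_law R) w.
  exact: ((@intg_density _ mR R mu (@pi_law R) (@pi_density R)
    measurable_pi_density (@pi_density_ge0 R) pi_lawE w mw).2 ilim).
split => //.
rewrite (@Rintegral_density _ mR R mu (@pi_law R) (@pi_density R)
  measurable_pi_density (@pi_density_ge0 R) pi_lawE w il).
rewrite (_ : (fun N => _) = (fun N => fine (\int[mu]_r (w r * pi_partial N r)%:E)%E)).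
  apply: fine_cvg; rewrite fineK//; exact: integrable_fin_num ilim.
apply/funext => N.
rewrite -[RHS]/(\int[mu]_r (w r * pi_partial N r)).
elim: N => [|N IH].
  rewrite big_geq// mulr0 (@eq_Rintegral _ _ _ mu _ (fun=> 0)) ?Rintegral_cst ?mul0r// => r _.
  by rewrite /pi_partial big_geq// mulr0 mulr0.
rewrite big_nat_recr//= mulrDr IH.
have ipart : intg mu (fun r : R => w r * pi_partial N r).
  apply: (@intg_dom _ _ _ mu (fun r : R => C * (pi_const * expR 1) * expR (- 1 * `|r|))).
  - by apply: measurable_funM => //; exact: measurable_pi_partial.
  - by apply: intgZ; apply: intg_laplace.
  - move=> r; exact: part_dom.
rewrite -!RintegralZl//; last exact: intgZ.
rewrite -RintegralD//; last by do 2 apply: intgZ.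
apply: eq_Rintegral => r _; rewrite /pi_partial big_nat_recr//= mulrDr mulrDr.
by congr (_ + _); ring.
Qed.

End pi_series.

Lemma EFin_Rintegral d (T : measurableType d) (R : realType)
    (mu : {measure set T -> \bar R}) (f : T -> R) : intg mu f ->
  (\int[mu]_x f x)%:E = (\int[mu]_x (f x)%:E)%E.
Proof. by move=> i; rewrite /Rintegral fineK//; exact: integrable_fin_num i. Qed.

Section pi_facts.
Context {R : realType}.
Notation mu := (@lebesgue_measure R).
Notation mR := (measurableTypeR R).
Notation a1 := (@alt_coeff R 1).

Lemma alt_coeff12 k : a1 k / (k.+2)%:R = alt_coeff 2 k.
Proof.
rewrite /alt_coeff addn1 addn2 -mulrA -invfM -natrM; congr (_ / _%:R).
by rewrite -mulnA; congr (_ * _)%N; rewrite [RHS]factS mulnC.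
Qed.

(** This recursion makes the sums in [conv_tail_seq] and [pi_expRN] telescope. *)
Lemma alt_coeff_succ k : a1 k.+1 = - a1 k / (k.+1%:R * k.+2%:R).
Proof.
rewrite /alt_coeff !addn1 exprS mulN1r !mulNr; congr (- _).
rewrite -mulrA; congr (_ * _); rewrite -invfM -!natrM; congr (_%:R^-1).
by rewrite !factS; ring.
Qed.

(** Partial sums for the mass of $(t,\infty)$ under the invariant law; [conv_seq] plays the same
    role for the integral of [laplace_tail (t - r)]. *)
Definition tail_seq (t : R) N : R :=
  pi_const * \sum_(0 <= k < N) a1 k * (expR (- k.+2%:R * t) / k.+2%:R).

Definition conv_seq (t : R) N : R := pi_const * \sum_(0 <= k < N) a1 k *
  ((k.+2%:R * expR (- t) - expR (- k.+2%:R * t) / k.+2%:R) / (k.+2%:R ^+ 2 - 1)).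

(** The invariance equation for partial sums. Since $e^{-t}e^{-(k+2)t}$ is the exponential of index
    $k+1$, the recursion of the coefficients matches it with the next term of the tail, whence
    [N.+1]. The contributions to $e^{-2t}$ telescope to the first term of the tail and a boundary
    term, which vanishes in the limit. *)
Lemma conv_tail_seq t N : expR (- t) * conv_seq t N =
  tail_seq t N.+1 - pi_const * alt_coeff 2 N * expR (- 2 * t).
Proof.
rewrite /conv_seq /tail_seq mulrCA -mulrA -mulrBr; congr (_ * _).
elim: N => [|N IH].
  by rewrite big_geq// mulr0 big_nat1 -alt_coeff12; field.
rewrite big_nat_recr//= mulrDr IH [in RHS]big_nat_recr//= -!alt_coeff12 alt_coeff_succ.
rewrite (_ : expR (- N.+3%:R * t) = expR (- t) * expR (- N.+2%:R * t)); last first.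
  by rewrite -expRD; congr expR; rewrite -[N.+3]addn1 natrD; ring.
rewrite (_ : expR (-2 * t) = expR (- t) * expR (- t)); last first.
  by rewrite -expRD; congr expR; ring.
have e3 : N.+3%:R = N%:R + 3 :> R by rewrite -[N.+3]addn3 natrD.
have e2 : N.+2%:R = N%:R + 2 :> R by rewrite -[N.+2]addn2 natrD.
have e1 : N.+1%:R = N%:R + 1 :> R by rewrite -[N.+1]addn1 natrD.
move: (bigop _ _ _) (expR (- N.+2%:R * t)) (expR (- t)) (a1 N) => S B A a.
rewrite e3 e2 e1.
have : 0 <= N%:R :> R by []. move: (N%:R : R) => x x0.
have e : (x + 2) ^+ 2 - 1 = (x + 1) * (x + 3) by ring.
rewrite e; field.
by apply/and3P; split; rewrite gt_eqF//; lra.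
Qed.

Lemma cvg_alt_coeff0 nu : alt_coeff nu n @[n --> \oo] --> (0 : R).
Proof. by apply: cvg_series_cvg_0; apply/cvg_ex; eexists; exact: cvg_alt_coeff. Qed.

Lemma conv_tail_lim t (A B : R) : tail_seq t N @[N --> \oo] --> A ->
  conv_seq t N @[N --> \oo] --> B -> expR (- t) * B = A.
Proof.
move=> tA cB.
have h1 : expR (- t) * conv_seq t N @[N --> \oo] --> expR (- t) * B by exact: cvgMr.
have h2 : expR (- t) * conv_seq t N @[N --> \oo] --> A.
  rewrite (_ : (fun N => _) = (fun N => tail_seq t N.+1 -
    pi_const * alt_coeff 2 N * expR (- 2 * t))); last first.
    by apply/funext => N; exact: conv_tail_seq.
  rewrite -[X in _ --> X]subr0; apply: cvgB; first by rewrite cvg_shiftS.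
  rewrite -[X in _ --> X](_ : pi_const * 0 * expR (- 2 * t) = 0); last by rewrite mulr0 mul0r.
  by apply: cvgMl; apply: cvgMr; exact: cvg_alt_coeff0.
exact: (cvg_unique _ h1 h2).
Qed.

(** The exponential of rate $k+2$ has integral $2/(k+2)$, and dividing by $k+2$ turns the
    coefficients of $J_1(2)$ into those of $J_2(2)$; this explains the normalisation $2J_2(2)$. *)
Lemma pi_law_mass : @pi_law R setT = 1%E.
Proof.
have m1 : measurable_fun [set: R] (fun=> 1 : R) by [].
have [i c] := @pi_law_termwise R (fun=> 1) 1 m1 ltac:(by move=> r; rewrite normr1 mul1r -expR0 ler_expR).
have e k : \int[mu]_r (1 * expR (- k.+2%:R * `|r|)) = 2 / k.+2%:R.
  under eq_Rintegral do rewrite mul1r.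
  by rewrite /Rintegral integral_laplace.
have E : \int[@pi_law R]_r 1 = 1.
  have c2 : (fun N => pi_const * \sum_(0 <= k < N) a1 k *
      \int[mu]_r (1 * expR (- k.+2%:R * `|r|))) N @[N --> \oo] -->
      pi_const * (2 * bessel 2 (2 : R)).
    apply: cvgMr; rewrite (_ : (fun N => _) = (fun N => 2 * series (@alt_coeff R 2) N)).
      by apply: cvgMr; exact: cvg_alt_coeff.
    apply/funext => N; rewrite /series/= mulr_sumr; apply: eq_bigr => k _.
    by rewrite e -alt_coeff12 mulrCA.
  have := cvg_unique _ c c2; rewrite mulVf//; first exact.
  by rewrite gt_eqF// mulr_gt0// bessel22_gt0.
have : (\int[@pi_law R]_r 1%:E)%E = 1%:E.
  by rewrite -(EFin_Rintegral i) E.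
by rewrite integral_cst// mul1e.
Qed.

HB.instance Definition _ := Measure_isProbability.Build _ _ R (@pi_law R) pi_law_mass.

Definition pi_prob : probability mR R := @pi_law R.

Lemma measure_RintegralE d (T : measurableType d) (P : probability T R) A :
  measurable A -> P A = (\int[P]_x (\1_A x))%:E.
Proof.
move=> mA; rewrite (measure_integral_indic P mA) /Rintegral fineK//.
rewrite -(measure_integral_indic P mA); exact: fin_num_measure.
Qed.

Let w1 (A : set R) r : `|\1_A r| <= 1 * expR `|r| :> R.
Proof.
rewrite mul1r (@le_trans _ _ 1)//; last by rewrite -expR0 ler_expR.
by rewrite indicE; case: (_ \in _); rewrite ?normr1 ?normr0.
Qed.

Lemma pi_tail_lim s : 0 <= s ->
  tail_seq s N @[N --> \oo] --> \int[pi_prob]_r (\1_(`]s, +oo[%classic) r : R).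
Proof.
move=> s0.
have mw : measurable_fun [set: R] (\1_(`]s, +oo[%classic) : R -> R) by exact: measurable_indic.
have [_] := pi_law_termwise mw (w1 _).
rewrite (_ : (fun N => _) = tail_seq s); first exact.
apply/funext => N.
congr (_ * _); apply: eq_bigr => k _; congr (_ * _).
rewrite -[RHS]/(fine (expR (- k.+2%:R * s) / k.+2%:R)%:E) -integral_laplace_gt//.
rewrite /Rintegral [in RHS]integral_mkcond; congr fine; apply: eq_integral => r _.
by rewrite patchE indicE; case: (_ \in _); rewrite ?mul1r ?mul0r.
Qed.

Lemma pi_lower_tail_lim s : s < 0 ->
  tail_seq (- s) N @[N --> \oo] --> \int[pi_prob]_r (\1_(`]-oo, s]%classic) r : R).
Proof.
move=> s0.
have mw : measurable_fun [set: R] (\1_(`]-oo, s]%classic) : R -> R) by exact: measurable_indic.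
have [_] := pi_law_termwise mw (w1 _).
rewrite (_ : (fun N => _) = tail_seq (- s)); first exact.
apply/funext => N.
congr (_ * _); apply: eq_bigr => k _; congr (_ * _).
rewrite -[RHS]/(fine (expR (- k.+2%:R * - s) / k.+2%:R)%:E) -integral_laplace_gt//; last lra.
rewrite integral_itv_obnd_cbnd; last first.
  by apply/measurable_funTS/measurable_EFinP; exact: measurable_expR_norm.
rewrite /Rintegral [in RHS]integral_mkcond -integral_lebesgueN.
- congr fine; apply: eq_integral => r _.
  rewrite patchE indicE normrN.
  have -> : (- r \in `]-oo, s]%classic) = (r \in `[- s, +oo[%classic).
    by apply/idP/idP; rewrite !inE/= !in_itv/= andbT; lra.
  by case: (_ \in _); rewrite ?mul1r ?mul0r.
- apply/measurable_EFinP; apply: measurable_funM => //; exact: measurable_expR_norm.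
- by move=> r; rewrite lee_fin mulr_ge0 ?expR_ge0// indicE.
Qed.

Let mlap (t : R) : measurable_fun [set: R] (fun r => laplace_tail (t - r)).
Proof. by apply: (measurableT_comp measurable_laplace_tail); apply: measurable_funB. Qed.

Let mlapN (t : R) : measurable_fun [set: R] (fun r => laplace_tail (r - t)).
Proof. by apply: (measurableT_comp measurable_laplace_tail); apply: measurable_funB. Qed.

Let blap (v r : R) : `|laplace_tail v| <= 1 * expR `|r|.
Proof.
rewrite mul1r (@le_trans _ _ 1)//; last by rewrite -expR0 ler_expR.
by rewrite ger0_norm; case/andP: (laplace_tail_ge0 v).
Qed.

Lemma pi_conv_lim s : 0 <= s ->
  conv_seq s N @[N --> \oo] --> \int[pi_prob]_r laplace_tail (s - r).
Proof.
move=> s0.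
have [_] := pi_law_termwise (mlap s) (fun r => blap (s - r) r).
rewrite (_ : (fun N => _) = conv_seq s); first exact.
apply/funext => N.
congr (_ * _); apply: eq_bigr => k _; congr (_ * _).
rewrite /Rintegral integral_laplace_tail//.
by rewrite ltr1n.
Qed.

Lemma pi_convN_lim s : s < 0 ->
  conv_seq (- s) N @[N --> \oo] --> \int[pi_prob]_r laplace_tail (r - s).
Proof.
move=> s0.
have [_] := pi_law_termwise (mlapN s) (fun r => blap (r - s) r).
rewrite (_ : (fun N => _) = conv_seq (- s)); first exact.
apply/funext => N.
congr (_ * _); apply: eq_bigr => k _; congr (_ * _).
rewrite /Rintegral -integral_lebesgueN.
- under eq_integral do rewrite normrN -addrC.
  by rewrite integral_laplace_tail// ?ltr1n//; lra.
- apply/measurable_EFinP; apply: measurable_funM => //; exact: measurable_expR_norm.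
- by move=> r; rewrite lee_fin mulr_ge0 ?expR_ge0//; case/andP: (laplace_tail_ge0 (r - s)).
Qed.

Lemma pi_tail s : 0 <= s ->
  \int[pi_prob]_r (\1_(`]s, +oo[%classic) r : R) =
  expR (- s) * \int[pi_prob]_r laplace_tail (s - r).
Proof.
by move=> s0; apply/esym; apply: conv_tail_lim; [exact: pi_tail_lim|exact: pi_conv_lim].
Qed.

Lemma pi_lower_tail s : s < 0 ->
  \int[pi_prob]_r (\1_(`]-oo, s]%classic) r : R) =
  expR s * \int[pi_prob]_r laplace_tail (r - s).
Proof.
move=> s0; rewrite -{2}[s]opprK; apply/esym; apply: conv_tail_lim.
- exact: pi_lower_tail_lim.
- exact: pi_convN_lim.
Qed.

End pi_facts.

(** * Invariance, and the value of the time constant *)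

Section invariance.
Context {R : realType}.
Notation mu := (@lebesgue_measure R).
Notation mR := (measurableTypeR R).
Notation NT := (mR * mR * mR)%type.
Notation a1 := (@alt_coeff R 1).

Definition pi_state : probability (state R) R := (pi_prob \x noise R)%E.

Lemma intg_pi_expR : intg (@pi_prob R) (fun r => expR (1 / 2 * `|r|)).
Proof.
have [|i _] := @pi_law_termwise R _ 1 (@measurable_expR_norm R (1 / 2)); last exact: i.
move=> r; rewrite ger0_norm ?expR_ge0// [leRHS]mul1r ler_expR.
by have := normr_ge0 r; lra.
Qed.

Lemma intg_pi_dominated (phi : R -> R) (C : R) : measurable_fun [set: R] phi ->
  (forall r, `|phi r| <= C * expR (1 / 2 * `|r|)) -> intg (@pi_prob R) phi.
Proof.
move=> mp pC; apply: (@intg_dom _ mR _ _ (fun r : R => C * expR (1 / 2 * `|r|))) => //.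
exact/intgZ/intg_pi_expR.
Qed.

Lemma state_dominated (psi : state R -> R) (C : R) :
  measurable_fun [set: state R] psi -> (forall m, `|psi m| <= C * state_dom m) ->
  [/\ intg pi_state psi,
      measurable_fun [set: R] (fun r => \int[noise R]_w psi (r, w)),
      forall r, intg (noise R) (fun w => psi (r, w)),
      intg (@pi_prob R) (fun r => \int[noise R]_w psi (r, w)) &
      \int[pi_state]_m psi m = \int[pi_prob]_r \int[noise R]_w psi (r, w)].
Proof.
move=> mp pC.
have i1 := intgZ C intg_pi_expR.
have h (r : mR) (w : NT) : `|psi (r, w)| <= C * expR (1 / 2 * `|r|) * noise_dom w.
  by have := pC (r, w); rewrite /state_dom mulrA.
have i2 := @intg_noise_dom R.
split.
- exact: (intg_prod mp i1 i2 h).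
- exact: (measurable_Rintegral1 mp i1 i2 h).
- by move=> r; exact: (intg_section1 mp i2 h).
- exact: (intg_Rintegral1 mp i1 i2 h).
- exact: (Rintegral_prod mp i1 i2 h).
Qed.

Lemma pi_stateE A : measurable A ->
  pi_state (@delta_step R @^-1` A) =
  (\int[pi_prob]_r noise R [set w | A (delta_step (r, w))])%E.
Proof.
move=> mA; transitivity (\int[pi_prob]_r noise R (xsection (@delta_step R @^-1` A) r))%E.
  by [].
apply: eq_integral => r _; congr (noise R _); by apply/seteqP; split => w; rewrite /xsection/= inE.
Qed.

Let blap (v : R) : `|laplace_tail v| <= 1.
Proof. by rewrite ger0_norm; case/andP: (laplace_tail_ge0 v). Qed.

Lemma measure_eq_rays (m1 m2 : {measure set mR -> \bar R}) :
  (m1 setT < +oo)%E -> (forall s, m1 `]s, +oo[%classic = m2 `]s, +oo[%classic) ->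
  forall A, measurable A -> m1 A = m2 A.
Proof.
move=> m1fin m12 A mA.
apply: (@measure_unique _ R mR (@RGenOInfty.G R) (fun n => `]- n%:R, +oo[%classic)) => //.
- exact: RGenOInfty.measurableE.
- move=> _ _ [x ->] [y ->]; exists (Num.max x y).
  by apply/seteqP; split => z /=; rewrite !in_itv/= !andbT gt_max => /andP.
- by move=> n; eexists.
- apply/seteqP; split => // x _.
  exists (Num.truncn `|x|).+1 => //=.
  rewrite in_itv/= andbT ltrNl (le_lt_trans (ler_norm _))// normrN.
  by rewrite truncnS_gt.
- by move=> _ [s ->].
- by move=> n; apply: le_lt_trans m1fin; apply: le_measure; rewrite ?inE.
Qed.

(** Rays suffice. For $s\ge0$, [pi_tail] is the invariance equation once the step has been
    integrated by [noise_step_gt]. For $s<0$ the product form holds on the lower ray instead, hence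
    the passage to complements. *)
Lemma pi_invariant A : measurable A -> pi_prob A = pi_state (@delta_step R @^-1` A).
Proof.
move=> mA; rewrite -[RHS]/(pushforward pi_state (@delta_step R) A).
have mst : measurable_fun [set: state R] (@delta_step R) by exact: measurable_delta_step.
suff h (s : R) : pi_prob `]s, +oo[%classic = pi_state (@delta_step R @^-1` `]s, +oo[%classic).
  apply: (@measure_eq_rays pi_prob (pushforward pi_state (@delta_step R))) => //.
  by rewrite (le_lt_trans (probability_le1 _ _))// ltry.
have [s0|s0] := leP 0 s.
    have i1 : intg (@pi_prob R) (fun r => laplace_tail (s - r)).
      apply: (@intg_bounded _ _ _ _ _ 1) => [|r]; last exact: blap.
      by apply: (measurableT_comp measurable_laplace_tail); apply: measurable_funB.
    rewrite measure_RintegralE// pi_tail// -RintegralZl// pi_stateE// EFin_Rintegral; last exact: intgZ.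
    apply: eq_integral => r _; rewrite -(noise_step_gt r s0); apply: (congr1 (noise R)).
    by apply/seteqP; split => w /=; rewrite in_itv/= andbT.
  have mI : measurable (`]-oo, s]%classic : set mR) by exact: measurable_itv.
  have mpre : measurable (@delta_step R @^-1` `]-oo, s]%classic).
    by rewrite -[X in measurable X]setTI; exact: mst.
  rewrite -setCitvl preimage_setC (probability_setC pi_prob mI) (probability_setC pi_state mpre).
  congr (1 - _)%E.
  have i1 : intg (@pi_prob R) (fun r => laplace_tail (r - s)).
    apply: (@intg_bounded _ _ _ _ _ 1) => [|r]; last exact: blap.
    by apply: (measurableT_comp measurable_laplace_tail); apply: measurable_funB.
  rewrite measure_RintegralE// pi_lower_tail// -RintegralZl// pi_stateE// EFin_Rintegral; last exact: intgZ.
  apply: eq_integral => r _; rewrite -(noise_step_le r s0); apply: (congr1 (noise R)).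
  by apply/seteqP; split => w /=; rewrite in_itv/=.
Qed.

Definition step_op (phi : R -> R) (r : R) : R := \int[noise R]_w phi (delta_step (r, w)).

Lemma expR_delta_step_le (m : state R) : expR (1 / 2 * `|delta_step m|) <= state_dom m.
Proof.
have := norm_delta_step m; case: m => r [[x y] z]; rewrite [_.2.2]/= => h.
rewrite /state_dom /noise_dom/= -!expRD ler_expR.
by have := normr_ge0 r; have := normr_ge0 x; have := normr_ge0 y; move: h; lra.
Qed.

Lemma step_dominated (phi : R -> R) (C : R) : measurable_fun [set: R] phi ->
  (forall r, `|phi r| <= C * expR (1 / 2 * `|r|)) ->
  measurable_fun [set: state R] (phi \o (@delta_step R)) /\
  forall m, `|phi (delta_step m)| <= C * state_dom m.
Proof.
move=> mp pC; split.
  have h := @measurable_delta_step R; exact: measurableT_comp mp h.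
move=> m; apply: le_trans (pC _) _; rewrite ler_wpM2l ?expR_delta_step_le//.
by have := le_trans (normr_ge0 _) (pC 0); rewrite normr0 mulr0 expR0 mulr1.
Qed.

Lemma pi_invariant_Rintegral (phi : R -> R) (C : R) : measurable_fun [set: R] phi ->
  (forall r, `|phi r| <= C * expR (1 / 2 * `|r|)) ->
  \int[pi_prob]_r phi r = \int[pi_prob]_r step_op phi r.
Proof.
move=> mp pC; have [ms sC] := step_dominated mp pC.
have [_ _ _ _ <-] := state_dominated ms sC.
apply: (law_Rintegral (@measurable_delta_step R) pi_invariant).
exact: intg_pi_dominated mp pC.
Qed.

Lemma pi_symmetric (A : set mR) : measurable A ->
  pi_prob A = pi_prob ((-%R : mR -> mR) @^-1` A).
Proof.
move=> mA; have mNA : measurable ((-%R : mR -> mR) @^-1` A).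
  by rewrite -[X in measurable X]setTI; exact: oppr_measurable.
have md : measurable_fun [set: mR] (EFin \o @pi_density R).
  by apply/measurable_EFinP; exact: measurable_pi_density.
transitivity (\int[mu]_(r in A) (pi_density r)%:E)%E; first by [].
transitivity (\int[mu]_(r in (-%R : mR -> mR) @^-1` A) (pi_density r)%:E)%E; last by [].
rewrite [LHS]integral_mkcond [RHS]integral_mkcond -[LHS]integral_lebesgueN.
- apply: eq_integral => r _; rewrite !patchE /pi_density !normrN.
  have -> // : (- r \in A) = (r \in (-%R : mR -> mR) @^-1` A).
  by apply/idP/idP; rewrite !inE.
- by apply/(measurable_restrictT _ _).1 => //; exact: measurable_funTS.
- by move=> r; rewrite patchE; case: ifP => // _; rewrite lee_fin pi_density_ge0.
Qed.

Definition mean_f (r : R) : R := \int[noise R]_w ladder_f (r, w).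

Lemma ladder_f_dominated (m : state R) : `|ladder_f m| <= 216 * state_dom m.
Proof. exact: le_trans (norm_ladder_f m) (growth_le m). Qed.

Lemma intg_ladder_f_section r : intg (noise R) (fun w => ladder_f (r, w)).
Proof.
by have [_ _ h _ _] := state_dominated (@measurable_ladder_f R) ladder_f_dominated; exact: h.
Qed.

Lemma intg_mean_f : intg (@pi_prob R) mean_f.
Proof. by have [] := state_dominated (@measurable_ladder_f R) ladder_f_dominated. Qed.

Let mabs : measurable_fun [set: R] (fun r : R => `|r|).
Proof. by []. Qed.

Let norm_dom (r : R) : `| `|r| | <= 2 * expR (1 / 2 * `|r|).
Proof. by rewrite normr_id; exact: norm_le_expR_half. Qed.

Lemma mean_f_sum r : mean_f r + mean_f (- r) =
  2 - (`|r| + expR (- `|r|)) + step_op (fun s => `|s|) r.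
Proof.
have [ms sC] := step_dominated mabs norm_dom.
have [_ _ is_ _ _] := state_dominated ms sC.
have isw : intg (noise R) (fun w => ladder_f (- r, noise_swap w)).
  apply: (intg_noise_dominated (c := 216 * expR (1 / 2 * `|r|))).
    apply: measurableT_comp; first exact: measurable_ladder_f.
    by apply: measurable_fun_pair => //; exact: measurable_noise_swap.
  move=> w; apply: le_trans (ladder_f_dominated _) _.
  rewrite /state_dom /noise_dom/= normrN -[leRHS]mulrA.
  by rewrite [X in _ * (_ * (X * _)) <= _]mulrC.
have E : mean_f (- r) = \int[noise R]_w ladder_f (- r, noise_swap w).
  by rewrite /mean_f (Rintegral_noise_swap (intg_ladder_f_section _)).
rewrite E /mean_f -RintegralD//; last exact: intg_ladder_f_section.
have ixy := intgD intg_noise_x intg_noise_y.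
transitivity (\int[noise R]_w (w.1.1 + w.1.2 - `|r + w.1.2 - w.1.1| + `|delta_step (r, w)|)).
  apply: eq_noise_Rintegral.
  - by apply: measurable_funD; apply: measurable_intg; [exact: intg_ladder_f_section|exact: isw].
  - apply: measurable_funD; last exact: measurable_intg (is_ r).
    by apply: measurable_funB; apply: measurable_intg; [exact: ixy|exact: intg_shift].
  - by move=> w _ _ z0; exact: ladder_f_sum.
rewrite RintegralD//; [|by apply: intgB => //; exact: intg_shift|exact: is_].
rewrite RintegralB//; [|exact: intg_shift].
rewrite RintegralD//; [|exact: intg_noise_x|exact: intg_noise_y].
by rewrite noise_mean_x noise_mean_y -mean_abs_shiftE.
Qed.

Let bnd_exp (r : R) : `|expR (- `|r|)| <= 1 * expR `|r|.
Proof.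
rewrite ger0_norm ?expR_ge0// mul1r ler_expR.
by have := normr_ge0 r; lra.
Qed.

Let mexpN : measurable_fun [set: R] (fun r : R => expR (- `|r|)).
Proof. by have := @measurable_expR_norm R (- 1); under eq_fun do rewrite mulN1r. Qed.

Lemma pi_expRN : \int[pi_prob]_r expR (- `|r|) = 2 * pi_const * (bessel 1 2 - bessel 2 (2 : R)).
Proof.
have [_ c] := pi_law_termwise mexpN bnd_exp.
apply: (cvg_unique _ c) => //.
have e k : \int[mu]_r (expR (- `|r|) * expR (- k.+2%:R * `|r|)) = 2 / k.+3%:R.
  under eq_Rintegral.
    move=> r _; rewrite -expRD (_ : - `|r| + _ = - k.+3%:R * `|r|); last first.
      by rewrite -[k.+3]addn1 natrD; ring.
    over.
  by rewrite /Rintegral integral_laplace.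
(* The weights $2/(k+3)$ match no Bessel series by themselves; with the recursion of the
   coefficients the sum becomes a difference of the series of $J_1(2)$ and $J_2(2)$, plus a boundary
   term that tends to $0$. *)
have telescope N : \sum_(0 <= k < N) a1 k * (2 / k.+3%:R) =
    2 * (series (alt_coeff 1) N - series (alt_coeff 2) N + a1 N * (N%:R / N.+2%:R)).
  elim: N => [|N IH].
    by rewrite big_geq// /series/= !big_geq// mul0r mulr0 subrr addr0 mulr0.
  rewrite big_nat_recr//= IH /series/= !big_nat_recr//= -alt_coeff12 alt_coeff_succ.
  have e3 : N.+3%:R = N%:R + 3 :> R by rewrite -[N.+3]addn3 natrD.
  have e2 : N.+2%:R = N%:R + 2 :> R by rewrite -[N.+2]addn2 natrD.
  have e1 : N.+1%:R = N%:R + 1 :> R by rewrite -[N.+1]addn1 natrD.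
  rewrite e3 e2 e1; have : 0 <= N%:R :> R by [].
  move: (N%:R : R) (bigop _ _ _) (bigop _ _ _) (a1 N) => x S T a x0.
  by field; apply/and3P; split; rewrite gt_eqF//; lra.
rewrite (_ : 2 * pi_const * _ = pi_const * (2 * (bessel 1 2 - bessel 2 2 + 0))); last by ring.
apply: cvgMr.
rewrite (_ : (fun N => _) = (fun N => 2 * (series (alt_coeff 1) N - series (alt_coeff 2) N +
    a1 N * (N%:R / N.+2%:R)))); last first.
  by apply/funext => N; rewrite -telescope; apply: eq_bigr => k _; rewrite e.
apply: cvgMr; apply: cvgD; first by apply: cvgB; exact: cvg_alt_coeff.
have h : (fun N => `|a1 N|) N @[N --> \oo] --> (0 : R).
  by rewrite -(normr0 R); apply: cvg_norm; exact: cvg_alt_coeff0.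
apply/cvgr0Pnorm_le => /= eps e0.
near=> N; rewrite normrM (@le_trans _ _ `|a1 N|)//.
  rewrite ler_piMr// ger0_norm ?divr_ge0// ler_pdivrMr// mul1r ler_nat.
  by rewrite leqW.
by rewrite -[leLHS]normr_id; near: N; move/cvgr0Pnorm_le : h; exact.
Unshelve. all: by end_near. Qed.

(** The law is symmetric, so twice the integral is that of [mean_f r + mean_f (- r)]. In
    [mean_f_sum] the mean of $|r|$ cancels against that of its image under one step, by invariance,
    and $2-\pi(e^{-|r|})$ remains. *)
Lemma pi_mean_f : \int[pi_prob]_r mean_f r = chi.
Proof.
have ia : intg (@pi_prob R) (fun r => `|r|).
  exact: intg_pi_dominated mabs norm_dom.
have ie : intg (@pi_prob R) (fun r => expR (- `|r|)).
  by have [] := pi_law_termwise mexpN bnd_exp.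
have iN : intg (@pi_prob R) (fun r => mean_f (- r)).
  have mN : measurable_fun [set: mR] (-%R : mR -> mR) by exact: oppr_measurable.
  by apply/(law_intg mN pi_symmetric (measurable_intg intg_mean_f)); exact: intg_mean_f.
have E : \int[pi_prob]_r mean_f r = \int[pi_prob]_r mean_f (- r).
  have mN : measurable_fun [set: mR] (-%R : mR -> mR) by exact: oppr_measurable.
  exact: (law_Rintegral mN pi_symmetric intg_mean_f).
have [ms sC] := step_dominated mabs norm_dom.
have [_ _ _ iq _] := state_dominated ms sC.
have : 2 * \int[pi_prob]_r mean_f r = 2 - \int[pi_prob]_r expR (- `|r|).
  rewrite [LHS](_ : _ = \int[pi_prob]_r mean_f r + \int[pi_prob]_r mean_f (- r)); last first.
    by rewrite -E; ring.
  rewrite -(RintegralD measurableT intg_mean_f iN).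
  under eq_Rintegral do rewrite mean_f_sum.
  have i2 := intg_cst (@pi_prob R) 2.
  have iae := intgD ia ie.
  rewrite (RintegralD measurableT (intgB i2 iae) iq) (RintegralB measurableT i2 iae).
  rewrite [X in X - _ + _ = _](_ : _ = 2); last exact: (Rintegral_cstp (@pi_prob R) 2).
  rewrite (RintegralD measurableT ia ie) (pi_invariant_Rintegral mabs norm_dom).
  by ring.
rewrite pi_expRN /chi /pi_const.
have b0 : bessel 2 (2 : R) != 0 := lt0r_neq0 bessel22_gt0.
move: (bessel 1 2) (bessel 2 2) b0 => J1 J2 b0 h.
have -> : \int[pi_prob]_r mean_f r = (2 - 2 * (2 * J2)^-1 * (J1 - J2)) / 2 by rewrite -h; field.
by field.
Qed.

End invariance.

Lemma intg_indic d (T : measurableType d) (R : realType) (P : probability T R) A :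
  measurable A -> intg P (\1_A : T -> R).
Proof.
move=> mA; apply: (@intg_bounded _ _ _ _ _ 1) => [|w]; first exact: measurable_indic.
by rewrite indicE; case: (_ \in _); rewrite ?normr1 ?normr0.
Qed.

(** * Geometric mixing and Poisson equations *)

Section doeblin.
Context {R : realType}.
Notation mR := (measurableTypeR R).
Notation NT := (mR * mR * mR)%type.
Notation Q := (@step_op R).
Implicit Types (phi psi : R -> R) (K L c : R).

Lemma bounded_section phi K : measurable_fun [set: R] phi -> (forall r, `|phi r| <= K) ->
  [/\ forall r, intg (noise R) (fun w => phi (delta_step (r, w))),
      measurable_fun [set: R] (Q phi) & forall r, `|Q phi r| <= K].
Proof.
move=> mp pK.
have K0 : 0 <= K by exact: le_trans (normr_ge0 _) (pK 0).
have pC r : `|phi r| <= K * expR (1 / 2 * `|r|).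
  apply: le_trans (pK r) _; rewrite ler_peMr// -expR0 ler_expR mulr_ge0//; lra.
have [ms sC] := step_dominated mp pC.
have [_ mQ is_ _ _] := state_dominated ms sC.
split => // r.
rewrite /step_op; apply: Rintegral_le_bound => //.
exact: measurable_intg (is_ r).
Qed.

Lemma step_opD phi psi K L : measurable_fun [set: R] phi -> (forall r, `|phi r| <= K) ->
  measurable_fun [set: R] psi -> (forall r, `|psi r| <= L) ->
  forall r, Q (fun s => phi s + psi s) r = Q phi r + Q psi r.
Proof.
move=> mp pK mq qL r; have [ip _ _] := bounded_section mp pK.
have [iq _ _] := bounded_section mq qL.
exact: (RintegralD measurableT (ip r) (iq r)).
Qed.

Lemma step_opB phi psi K L : measurable_fun [set: R] phi -> (forall r, `|phi r| <= K) ->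
  measurable_fun [set: R] psi -> (forall r, `|psi r| <= L) ->
  forall r, Q (fun s => phi s - psi s) r = Q phi r - Q psi r.
Proof.
move=> mp pK mq qL r; have [ip _ _] := bounded_section mp pK.
have [iq _ _] := bounded_section mq qL.
exact: (RintegralB measurableT (ip r) (iq r)).
Qed.

(** From $|r|\le1$ these weights force $r+y-x>1>z$: the new difference is $z$ and all starting
    points in $[-1,1]$ merge. The event [small_rung] brings the chain into $[-1,1]$ beforehand. *)
Definition coalescing : set NT := (`]-oo, 1[ `*` `]3, +oo[) `*` `]0, 1[.
Definition small_rung : set NT := setT `*` `]-1, 1[.

Lemma measurable_coalescing : measurable coalescing.
Proof. by apply: measurableX => //; apply: measurableX. Qed.

Lemma measurable_small_rung : measurable small_rung.
Proof. by apply: measurableX. Qed.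

Lemma coalescingP s s' (w : NT) : `|s| <= 1 -> `|s'| <= 1 -> coalescing w ->
  delta_step (s, w) = delta_step (s', w).
Proof.
case: w => [[x y] z]; rewrite !ler_norml => /andP[? ?] /andP[? ?] [[/=]].
rewrite !in_itv/= !andbT => x1 y3 /andP[z0 z1].
suff h (t a b c : R) : -1 <= t -> a < 1 -> 3 < b -> 0 < c -> c < 1 ->
    Num.min (t + b) (a + c) - Num.min (t + b + c) a = c by rewrite !h.
by move=> ? ? ? ? ?; case: (leP (t + b)) => ?; case: (leP (t + b + c)) => ?; lra.
Qed.

Lemma exp1_unit_gt0 (a b : R) : 0 <= a -> a < b -> (0 < exp1 R `]a, b[%classic)%E.
Proof.
move=> a0 ab.
have -> : exp1 R `]a, b[%classic = (expR (- a) - expR (- b))%:E.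
  have h : exp1 R `]a, +oo[%classic = (exp1 R `]a, b[%classic + exp1 R `[b, +oo[%classic)%E.
    rewrite -measureU//.
      by congr (exp1 R _); rewrite -itv_bndbnd_setU// bnd_simp// ltW.
    apply/seteqP; split => // x [/=]; rewrite !in_itv/= andbT => /andP[_ xb] bx; lra.
  move: h; rewrite !exp1_tail !max_l//; last lra.
  have f : exp1 R `]a, b[%classic \is a fin_num by exact: fin_num_measure.
  rewrite -(fineK f) -EFinD; move: (fine _) => t [e].
  by apply: (congr1 EFin); lra.
by rewrite lte_fin subr_gt0 ltr_expR ltrN2.
Qed.

Lemma noise_coalescing_gt0 : (0 < noise R coalescing)%E.
Proof.
have m1 : measurable (`]-oo, (1 : R)[%classic : set mR) by exact: measurable_itv.
rewrite /coalescing noise_setX//.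
apply: mule_gt0; last exact: exp1_unit_gt0.
apply: mule_gt0; last by rewrite exp1_tail lte_fin expR_gt0.
apply: (@lt_le_trans _ _ (exp1 R `]0, 1[%classic)); first exact: exp1_unit_gt0.
by apply: le_measure; rewrite ?inE//; apply: subset_itv => //; rewrite bnd_simp.
Qed.

Lemma noise_small_rung_gt0 : (0 < noise R small_rung)%E.
Proof.
rewrite /small_rung -setXTT noise_setX//.
have h := @probability_setT _ _ _ (exp1 R).
have -> : exp1 R setT = 1%E by exact: h.
rewrite !mul1e.
apply: (@lt_le_trans _ _ (exp1 R `]0, 1[%classic)); first exact: exp1_unit_gt0.
by apply: le_measure; rewrite ?inE//; apply: subset_itv => //; rewrite bnd_simp; lra.
Qed.

Definition prob_coalescing : R := fine (noise R coalescing).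
Definition prob_small_rung : R := fine (noise R small_rung).

Lemma noise_fine_gt0 (A : set NT) : measurable A -> (0 < noise R A)%E -> 0 < fine (noise R A) <= 1.
Proof.
move=> mA A0; have f : noise R A \is a fin_num by exact: fin_num_measure.
by rewrite -lte_fin -lee_fin fineK// A0 /=; exact: probability_le1.
Qed.

Lemma Rintegral_noise_indic (A : set NT) c : measurable A ->
  \int[noise R]_w (c * (1 - \1_A w)) = c * (1 - fine (noise R A)).
Proof.
move=> mA.
have iA := intg_indic (noise R) mA.
have i1 := intg_cst (noise R) (1 : R).
rewrite (RintegralZl _ measurableT (intgB i1 iA)) (RintegralB measurableT i1 iA).
rewrite [X in _ * (X - _)](_ : _ = 1); last exact: (Rintegral_cstp (noise R) 1).
by congr (_ * (_ - _)); rewrite /Rintegral -(measure_integral_indic (noise R) mA).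
Qed.

(** Two copies driven by the same noise: [small_rung] at the first step, then [coalescing] at the
    second, merges them; otherwise the oscillation bound [c] is kept. A single step does not
    contract uniformly, since from far to the right and far to the left it gives nearly $z$ and
    $-z$. *)
Lemma Doeblin phi K c : measurable_fun [set: R] phi -> (forall r, `|phi r| <= K) ->
  (forall r r', phi r - phi r' <= c) ->
  forall r r', Q (Q phi) r - Q (Q phi) r' <= (1 - prob_coalescing * prob_small_rung) * c.
Proof.
move=> mp pK osc r r'.
have [ip mQ bQ] := bounded_section mp pK.
have [iQ _ _] := bounded_section mQ bQ.
have c0 : 0 <= c by have := osc 0 0; rewrite subrr.
have mc := measurable_coalescing; have ms := measurable_small_rung.
have mA (A : set NT) k : measurable A -> intg (noise R) (fun w => k * (1 - \1_A w) : R).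
  by move=> mA; apply: intgZ; apply: intgB; [exact: intg_cst|exact: intg_indic].
have /andP[p0 p1] : 0 < prob_coalescing <= 1 := noise_fine_gt0 mc noise_coalescing_gt0.
have oscQ s s' : Q phi s - Q phi s' <= c.
  rewrite /step_op -(RintegralB measurableT (ip s) (ip s')).
  rewrite -[leRHS](Rintegral_cstp (noise R)).
  apply: le_Rintegral => //; [exact: intgB|exact: intg_cst].
have oscQ1 s s' : `|s| <= 1 -> `|s'| <= 1 -> Q phi s - Q phi s' <= c * (1 - prob_coalescing).
  move=> s1 s1'; rewrite /step_op -(RintegralB measurableT (ip s) (ip s')).
  rewrite -(Rintegral_noise_indic c mc).
  apply: le_Rintegral => //; [exact: intgB|exact: mA|].
  move=> w _; rewrite indicE; case: (boolP (w \in coalescing)) => [|_]; last by rewrite subr0 mulr1.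
  by rewrite inE subrr mulr0 => /(coalescingP s1 s1') ->; rewrite subrr.
have bound (w : NT) : Q phi (delta_step (r, w)) - Q phi (delta_step (r', w)) <=
    c * (1 - prob_coalescing) + c * prob_coalescing * (1 - \1_small_rung w).
  rewrite indicE; case: (boolP (w \in small_rung)) => [|_]; last first.
    by rewrite subr0 mulr1 -mulrDr subrK mulr1; exact: oscQ.
  rewrite inE subrr mulr0 addr0 => -[_ /=]; rewrite in_itv/= -ltr_norml => z1.
  by apply: oscQ1; [exact: (le_trans (norm_delta_step (r, w)) (ltW z1))|
    exact: (le_trans (norm_delta_step (r', w)) (ltW z1))].
rewrite -(RintegralB measurableT (iQ r) (iQ r')).
apply: (@le_trans _ _ (\int[noise R]_w (c * (1 - prob_coalescing) +
    c * prob_coalescing * (1 - \1_small_rung w)))).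
  apply: le_Rintegral => //; first exact: intgB.
  by apply: intgD; [exact: intg_cst|exact: mA].
rewrite (RintegralD measurableT (intg_cst (noise R) _) (mA _ _ ms)).
rewrite (Rintegral_noise_indic _ ms).
rewrite [X in X + _ <= _](_ : _ = c * (1 - prob_coalescing)); last exact: (Rintegral_cstp (noise R)).
rewrite -/prob_small_rung le_eqVlt; apply/orP; left; apply/eqP.
by move: prob_coalescing prob_small_rung => p q; ring.
Qed.

Lemma pi_bounded_iter phi K : measurable_fun [set: R] phi -> (forall r, `|phi r| <= K) ->
  \int[pi_prob]_r phi r = 0 -> forall n,
  [/\ measurable_fun [set: R] (iter n Q phi), forall r, `|iter n Q phi r| <= K &
      \int[pi_prob]_r iter n Q phi r = 0].
Proof.
move=> mp pK p0; elim=> [//|n [mn nK n0]].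
have K0 : 0 <= K by exact: le_trans (normr_ge0 _) (pK 0).
have [_ mQ bQ] := bounded_section mn nK.
split => //; rewrite -[RHS]n0 (@pi_invariant_Rintegral R (iter n Q phi) K)// => r.
by apply: le_trans (nK r) _; rewrite ler_peMr// -expR0 ler_expR mulr_ge0//; lra.
Qed.

(** The arithmetic mean of $1$ and the two-step factor, hence at least its square root: a rate per
    step. It is also at least $1/2$, which pays for odd times in [mixing]. *)
Definition mixing_rate : R := (1 + (1 - prob_coalescing * prob_small_rung)) / 2.

Lemma mixing_rate_bounds : [/\ 1 / 2 <= mixing_rate, mixing_rate < 1 &
  1 - prob_coalescing * prob_small_rung <= mixing_rate ^+ 2].
Proof.
have : 0 < prob_coalescing <= 1 := noise_fine_gt0 measurable_coalescing noise_coalescing_gt0.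
have : 0 < prob_small_rung <= 1 := noise_fine_gt0 measurable_small_rung noise_small_rung_gt0.
rewrite /mixing_rate; move: prob_coalescing prob_small_rung => p q /andP[q0 q1] /andP[p0 p1].
have pq0 : 0 < p * q by rewrite mulr_gt0.
have pq1 : p * q <= 1 by rewrite mulr_ile1// ltW.
move: (p * q) pq0 pq1 => t t0 t1.
split; [lra|lra|].
rewrite -subr_ge0 (_ : _ - _ = (t / 2) ^+ 2) ?sqr_ge0//; by field.
Qed.

Lemma mixing phi K : measurable_fun [set: R] phi -> (forall r, `|phi r| <= K) ->
  \int[pi_prob]_r phi r = 0 ->
  forall n r, `|iter n Q phi r| <= 4 * K * mixing_rate ^+ n.
Proof.
move=> mp pK p0.
have K0 : 0 <= K by exact: le_trans (normr_ge0 _) (pK 0).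
have it := pi_bounded_iter mp pK p0.
have [h1 h2 h3] := mixing_rate_bounds.
(* A function of mean zero is bounded by its oscillation: it equals the average of its
   differences. *)
have ct (psi : R -> R) c : measurable_fun [set: R] psi -> (forall r, `|psi r| <= K) ->
    \int[pi_prob]_r psi r = 0 -> (forall r r', psi r - psi r' <= c) -> forall r, `|psi r| <= c.
  move=> mq qK q0 osc r.
  have iq := @intg_bounded _ _ _ (@pi_prob R) psi K mq qK.
  have E : psi r = \int[pi_prob]_r' (psi r - psi r').
    rewrite (RintegralB measurableT (intg_cst (@pi_prob R) (psi r)) iq) q0 subr0.
    exact/esym/(Rintegral_cstp (@pi_prob R)).
  rewrite E; apply: Rintegral_le_bound => [|r'].
    by apply: measurable_funB.
  by rewrite ler_norml osc andbT lerNl opprB osc.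
have osc2 n : forall r r', iter n.*2 Q phi r - iter n.*2 Q phi r' <= (2 * K) * (mixing_rate ^+ 2) ^+ n.
  elim: n => [|n IH] r r'.
    rewrite expr0 mulr1; have := pK r; have := pK r'; rewrite !ler_norml => /andP[? ?] /andP[? ?].
    by rewrite /=; lra.
  have [mn nK n0] := it n.*2.
  apply: le_trans (Doeblin mn nK IH r r') _.
  rewrite [X in _ <= _ * X]exprS [leRHS]mulrCA; apply: ler_wpM2r => //.
  by rewrite !mulr_ge0// exprn_ge0// exprn_ge0//; lra.
have b2 n r : `|iter n.*2 Q phi r| <= 2 * K * mixing_rate ^+ n.*2.
  have [mn nK n0] := it n.*2.
  by rewrite -mul2n exprM mul2n; apply: ct => //; exact: osc2.
(* At odd times the last step is not contracted; the loss of a factor $\theta$ is covered by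
   $2\theta\ge1$, hence the constant $4$ in place of $2$. *)
move=> n r; rewrite -[n]odd_double_half; case: (odd n); last first.
  rewrite add0n; apply: le_trans (b2 _ _) _; rewrite ler_wpM2r ?exprn_ge0//; lra.
rewrite add1n /=.
have [mn nK n0] := it n./2.*2.
have [_ _ bQ] := bounded_section mn (b2 n./2).
apply: le_trans (bQ r) _; rewrite exprS.
have y0 : 0 <= mixing_rate ^+ n./2.*2 by rewrite exprn_ge0//; lra.
move: (_ ^+ _) y0 => y y0.
rewrite -subr_ge0 (_ : _ - _ = 2 * K * y * (2 * mixing_rate - 1)); last by ring.
by rewrite mulr_ge0 ?mulr_ge0//; lra.
Qed.

End doeblin.

Section poisson.
Context {R : realType}.
Notation mR := (measurableTypeR R).
Notation NT := (mR * mR * mR)%type.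
Notation Q := (@step_op R).
Notation theta := (@mixing_rate R).
Implicit Types (phi psi : R -> R) (K L c : R).

Lemma sum_geometric_le (t : R) N : 0 <= t -> t < 1 -> \sum_(0 <= k < N) t ^+ k <= (1 - t)^-1.
Proof.
move=> t0 t1; have t1' : 0 < 1 - t by rewrite subr_gt0.
have E : (1 - t) * \sum_(0 <= k < N) t ^+ k = 1 - t ^+ N.
  elim: N => [|N IH]; first by rewrite big_geq// mulr0 expr0 subrr.
  by rewrite big_nat_recr//= mulrDr IH exprS; ring.
by rewrite -[leRHS]mul1r ler_pdivlMr// mulrC E gerBl exprn_ge0.
Qed.

Lemma step_op_sum phi K : measurable_fun [set: R] phi -> (forall r, `|phi r| <= K) ->
  \int[pi_prob]_r phi r = 0 -> forall N,
  [/\ measurable_fun [set: R] (fun r => \sum_(0 <= k < N) iter k Q phi r),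
   exists L, forall r, `|\sum_(0 <= k < N) iter k Q phi r| <= L &
   forall r, Q (fun s => \sum_(0 <= k < N) iter k Q phi s) r =
     \sum_(0 <= k < N) iter k.+1 Q phi r].
Proof.
move=> mp pK p0; have it := pi_bounded_iter mp pK p0.
elim=> [|N [mS [L SL] QS]].
  split.
  - by apply: measurable_sum => k; have [] := it k.
  - by exists 0 => r; rewrite big_geq// normr0.
  - move=> r; rewrite [RHS]big_geq// (_ : (fun s => _) = fun=> 0).
      exact: (Rintegral_cstp (noise R)).
    by apply/funext => s; rewrite big_geq.
have [mN NK N0] := it N.
split.
- by apply: measurable_sum => k; have [] := it k.
- exists (L + K) => r; rewrite big_nat_recr//= (le_trans (ler_normD _ _))// lerD//.
- move=> r; rewrite (_ : (fun s => _) = (fun s => \sum_(0 <= k < N) iter k Q phi s + iter N Q phi s)).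
    by rewrite (step_opD mS SL mN NK) QS [RHS]big_nat_recr.
  by apply/funext => s; rewrite big_nat_recr.
Qed.

(** The solution is the Neumann series $\sum_k Q^k\varphi$, convergent by [mixing]. Its tail after
    $N$ terms is at most $4K\theta^N/(1-\theta)$, which is the last claim; the Green-Kubo series
    needs that rate. *)
Lemma poisson phi K : measurable_fun [set: R] phi -> (forall r, `|phi r| <= K) ->
  \int[pi_prob]_r phi r = 0 -> exists (g : R -> R) (C : R),
  [/\ measurable_fun [set: R] g, forall r, `|g r| <= C,
   forall r, g r - Q g r = phi r &
   forall N r, `|g r - \sum_(0 <= k < N) iter k Q phi r| <= C * theta ^+ N].
Proof.
move=> mp pK p0.
have K0 : 0 <= K by exact: le_trans (normr_ge0 _) (pK 0).
have [t2 t1 _] := @mixing_rate_bounds R.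
have t0 : 0 <= theta by lra.
have mix := mixing mp pK p0.
pose u N r := \sum_(0 <= k < N) iter k Q phi r.
pose C := 4 * K / (1 - theta).
have C0 : 0 <= C by rewrite divr_ge0 ?mulr_ge0// subr_ge0 ltW.
have part N M r : `|u (N + M)%N r - u N r| <= C * theta ^+ N.
  rewrite /u (big_cat_nat (leq0n N) (leq_addr M N))/= addrAC subrr add0r.
  rewrite -{1}[N]add0n big_addn addKn.
  apply: le_trans (ler_norm_sum _ _ _) _.
  apply: (@le_trans _ _ (\sum_(0 <= k < M) (4 * K * theta ^+ N) * theta ^+ k)).
    by apply: ler_sum => k _; rewrite -mulrA -exprD addnC; exact: mix.
  rewrite -mulr_sumr /C [leRHS]mulrAC ler_wpM2l ?mulr_ge0 ?exprn_ge0//.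
  exact: sum_geometric_le.
have cu r : cvgn (u ^~ r).
  apply: (@normed_cvg _ R^o (fun k => iter k Q phi r)).
  apply: (@series_le_cvg _ _ (fun k => 4 * K * theta ^+ k)) => //.
  - by move=> k /=.
  - by move=> k; rewrite !mulr_ge0// exprn_ge0.
  - by move=> k; exact: mix.
  - by apply: is_cvg_geometric_series; rewrite ger0_norm.
pose g r := limn (u ^~ r).
have gu N r : `|g r - u N r| <= C * theta ^+ N.
  have h : (fun M => `|u (M + N)%N r - u N r|) M @[M --> \oo] --> `|g r - u N r|.
    apply: cvg_norm; apply: cvgB; last exact: cvg_cst.
    by rewrite (@cvg_shiftn N _ (u ^~ r)); exact: cu.
  rewrite -(cvg_lim _ h)//; apply: limr_le; first by apply/cvg_ex; eexists; exact: h.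
  by apply: nearW => M; rewrite addnC; exact: part.
have us := step_op_sum mp pK p0.
have mg : measurable_fun [set: R] g.
  apply: (@measurable_fun_cvg _ _ _ _ u) => //.
  by move=> N; have [] := us N.
have gC r : `|g r| <= C.
  by have := gu 0 r; rewrite /u big_geq// subr0 expr0 mulr1.
exists g, C; split => // r.
(* No exchange of $Q$ with the infinite sum: $\varphi=u_{N+1}-Qu_N$ holds exactly, and putting $g$
   for both partial sums costs at most $2C\theta^N$. *)
have approx N : `|g r - Q g r - phi r| <= 2 * C * theta ^+ N.
  have [muN [L uL] QuN] := us N.
  have e : phi r = u N.+1 r - Q (u N) r.
    rewrite /u QuN big_nat_recl//= addrK //.
  have -> : g r - Q g r - phi r = (g r - u N.+1 r) - Q (fun s => g s - u N s) r.
    by rewrite (step_opB mg gC muN uL) e; ring.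
  apply: le_trans (ler_normB _ _) _.
  have mgu : measurable_fun [set: R] (fun s => g s - u N s) by exact: measurable_funB.
  have [_ _ b] := bounded_section mgu (gu N).
  have e0 : 0 <= theta ^+ N by rewrite exprn_ge0.
  have := gu N.+1 r; have := b r; rewrite exprS.
  have : C * (theta * theta ^+ N) <= C * theta ^+ N.
    by rewrite ler_wpM2l// ler_piMl// ltW.
  by lra.
have h : (fun N => 2 * C * theta ^+ N) N @[N --> \oo] --> (0 : R).
  rewrite -(mulr0 (2 * C)); apply: cvgMr; apply: cvg_expr; by rewrite ger0_norm.
apply/eqP; rewrite -subr_eq0 -normr_le0.
rewrite -(cvg_lim _ h)//; apply: limr_ge; first by apply/cvg_ex; eexists; exact: h.
by apply: nearW => N; exact: approx.
Qed.

End poisson.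

Lemma Rintegral_gt0 d (T : measurableType d) (R : realType) (P : probability T R) (v : T -> R) :
  intg P v -> (forall x, 0 < v x) -> 0 < \int[P]_x v x.
Proof.
move=> iv v0; rewrite lt_def Rintegral_ge0 ?andbT; last by move=> x _; exact: ltW.
apply/eqP => e; have mv := measurable_intg iv.
have : (\int[P]_x `|(v x)%:E|)%E = 0%R.
  under eq_integral do rewrite gee0_abs ?lee_fin ?ltW//.
  by rewrite -(EFin_Rintegral iv) e.
have mE : measurable_fun setT (EFin \o v) by exact/measurable_EFinP.
move/(ae_eq_integral_abs P measurableT mE).1 => [N [mN N0 hN]].
have : (P setT <= P N)%E.
  apply: le_measure; rewrite ?inE// => x _; apply: hN => /= /(_ I) [] /eqP.
  by rewrite gt_eqF.
by rewrite N0 probability_setT lee_fin ler10.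
Qed.

(** * The corrector and the asymptotic variance *)

Section corrector.
Context {R : realType}.
Notation mR := (measurableTypeR R).
Notation NT := (mR * mR * mR)%type.
Notation Q := (@step_op R).
Notation theta := (@mixing_rate R).

Definition noise_growth (w : NT) : R := growth (0, w).

Lemma noise_growthE w : noise_growth w = 1 + `|w.1.1| + `|w.1.2| + `|w.2|.
Proof. by rewrite /noise_growth /growth /= normr0 addr0. Qed.

Lemma noise_growth_ge1 w : 1 <= noise_growth w.
Proof. exact: growth_ge1. Qed.

Let sd0 w : state_dom (0 : mR, w) = noise_dom w :> R.
Proof. by rewrite /state_dom/= normr0 mulr0 expR0 mul1r. Qed.

Lemma noise_growthX_le w k : (k <= 3)%N -> noise_growth w ^+ k <= 216 * noise_dom w.
Proof.
move=> k3; rewrite -sd0; apply: le_trans (growth3_le _).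
by apply: ler_weXn2l => //; exact: growth_ge1.
Qed.

Lemma measurable_noise_growth : measurable_fun [set: NT] noise_growth.
Proof.
rewrite (_ : noise_growth = fun w => 1 + `|w.1.1| + `|w.1.2| + `|w.2|); last first.
  by apply/funext => w; exact: noise_growthE.
have m1 := measurable_intg (@intg_noise_x R); have m2 := measurable_intg (@intg_noise_y R).
apply: measurable_funD; last exact: measurable_intg (@intg_noise_z R).
apply: measurable_funD; last exact: measurableT_comp m2.
by apply: measurable_funD => //; exact: measurableT_comp m1.
Qed.

Lemma intg_noise_growthX k : (k <= 3)%N -> intg (noise R) (fun w => noise_growth w ^+ k).
Proof.
move=> k3; apply: (@intg_noise_dominated _ _ 216).
  by apply: measurable_funX; exact: measurable_noise_growth.
move=> w; rewrite ger0_norm; first exact: noise_growthX_le.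
by rewrite exprn_ge0// (le_trans _ (noise_growth_ge1 w)).
Qed.

Lemma intg_noise_growth : intg (noise R) noise_growth.
Proof. exact: (@intg_noise_growthX 1). Qed.

Definition growth_mean : R := \int[noise R]_w noise_growth w.

(** By [ladder_f_lip], $f$ is Lipschitz in the weights with a constant free of $r$. Its fluctuation
    about the mean is thus controlled by the weights, although $f$ itself is unbounded in $r$. *)
Lemma ladder_f_centered r w : `|ladder_f (r, w) - mean_f r| <= noise_growth w + growth_mean.
Proof.
have il := intg_ladder_f_section r.
have -> : ladder_f (r, w) - mean_f r = \int[noise R]_w' (ladder_f (r, w) - ladder_f (r, w')).
  rewrite (RintegralB measurableT (intg_cst (noise R) (ladder_f (r, w))) il).
  by congr (_ - _); exact/esym/(Rintegral_cstp (noise R)).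
have -> : noise_growth w + growth_mean = \int[noise R]_w' (noise_growth w + noise_growth w').
  rewrite (RintegralD measurableT (intg_cst (noise R) (noise_growth w)) intg_noise_growth).
  by congr (_ + _); exact/esym/(Rintegral_cstp (noise R)).
apply: le_norm_Rintegral.
- by apply: measurable_funB => //; exact: measurable_intg il.
- by apply: intgD; [exact: intg_cst|exact: intg_noise_growth].
- move=> w'; apply: le_trans (ladder_f_lip _ _ _) _.
  rewrite !noise_growthE.
  have := ler_normB w.1.1 w'.1.1; have := ler_normB w.1.2 w'.1.2.
  have := ler_normB w.2 w'.2; lra.
Qed.

Lemma norm_mean_f r : `|mean_f r| <= `|r| + growth_mean.
Proof.
have il := intg_ladder_f_section r.
have -> : `|r| + growth_mean = \int[noise R]_w (`|r| + noise_growth w).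
  rewrite (RintegralD measurableT (intg_cst (noise R) `|r|) intg_noise_growth).
  by congr (_ + _); exact/esym/(Rintegral_cstp (noise R)).
apply: le_norm_Rintegral.
- exact: measurable_intg il.
- by apply: intgD; [exact: intg_cst|exact: intg_noise_growth].
- move=> w; apply: le_trans (norm_ladder_f _) _.
  by rewrite noise_growthE /growth/=; lra.
Qed.

(* Functions of linear growth have a bounded image under Q, since |delta_step m| <= z. *)
Lemma linear_growth_dominated (phi : R -> R) c : (forall r, `|phi r| <= `|r| + c) ->
  forall r, `|phi r| <= (2 + c) * expR (1 / 2 * `|r|).
Proof.
move=> pc r; have c0 : 0 <= c by have := le_trans (normr_ge0 _) (pc 0); rewrite normr0 add0r.
apply: le_trans (pc r) _; rewrite mulrDl lerD ?norm_le_expR_half//.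
by rewrite ler_peMr// -expR0 ler_expR mulr_ge0//; lra.
Qed.

Lemma linear_growth_step (phi : R -> R) c : measurable_fun [set: R] phi ->
  (forall r, `|phi r| <= `|r| + c) ->
  [/\ forall r, intg (noise R) (fun w => phi (delta_step (r, w))),
      measurable_fun [set: R] (Q phi) & forall r, `|Q phi r| <= growth_mean + c].
Proof.
move=> mp pc; have [ms sC] := step_dominated mp (linear_growth_dominated pc).
have [_ mQ is_ _ _] := state_dominated ms sC; split => //.
move=> r; have -> : growth_mean + c = \int[noise R]_w (noise_growth w + c).
  rewrite (RintegralD measurableT intg_noise_growth (intg_cst (noise R) c)).
  by congr (_ + _); exact/esym/(Rintegral_cstp (noise R)).
apply: le_norm_Rintegral.
- exact: measurable_intg (is_ r).
- by apply: intgD; [exact: intg_noise_growth|exact: intg_cst].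
- move=> w; apply: le_trans (pc _) _; rewrite lerD2r.
  apply: le_trans (norm_delta_step _) _.
  rewrite noise_growthE /=; have := normr_ge0 w.1.1; have := normr_ge0 w.1.2; lra.
Qed.

Definition centered_mean (r : R) : R := mean_f r - chi.

Lemma measurable_centered_mean : measurable_fun [set: R] centered_mean.
Proof. by apply: measurable_funB => //; exact: measurable_intg (@intg_mean_f R). Qed.

Lemma norm_centered_mean r : `|centered_mean r| <= `|r| + (growth_mean + `|chi|).
Proof.
rewrite addrA; apply: le_trans (ler_normB _ _) _.
by rewrite lerD2r; exact: norm_mean_f.
Qed.

Lemma pi_centered_mean : \int[pi_prob]_r centered_mean r = 0.
Proof.
rewrite (RintegralB measurableT (@intg_mean_f R) (intg_cst (@pi_prob R) chi)).
rewrite pi_mean_f [X in _ - X](_ : _ = chi) ?subrr//.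
exact: (Rintegral_cstp (@pi_prob R)).
Qed.

(** The right-hand side is unbounded, so [poisson] is applied to its image under $Q$, which is
    bounded and still of mean zero by invariance. Adding [centered_mean] to that solution prepends
    one term to the Neumann series, which is why $N+1$ terms go with $\theta^N$. *)
Lemma corrector : exists (h : R -> R) (C : R),
  [/\ measurable_fun [set: R] h, forall r, `|h r| <= `|r| + C,
   forall r, h r - Q h r = centered_mean r &
   forall N r, `|h r - \sum_(0 <= k < N.+1) iter k Q centered_mean r| <= C * theta ^+ N].
Proof.
have mF := measurable_centered_mean; have FC := norm_centered_mean.
have [iF mQF QFC] := linear_growth_step mF FC.
have p0 : \int[pi_prob]_r Q centered_mean r = 0.
  by rewrite -(pi_invariant_Rintegral mF (linear_growth_dominated FC)) pi_centered_mean.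
have [g [C [mg gC gP gN]]] := poisson mQF QFC p0.
exists (fun r => centered_mean r + g r), (growth_mean + `|chi| + C).
have gm0 : 0 <= growth_mean + `|chi|.
  by have := le_trans (normr_ge0 _) (FC 0); rewrite normr0 add0r.
split.
- exact: measurable_funD.
- by move=> r; apply: le_trans (ler_normD _ _) _; rewrite addrA lerD.
- move=> r; have [ig _ _] := bounded_section mg gC.
  have -> : Q (fun s => centered_mean s + g s) r = Q centered_mean r + Q g r.
    exact: (RintegralD measurableT (iF r) (ig r)).
  by have := gP r; lra.
- move=> N r; rewrite big_nat_recl//= opprD addrACA subrr add0r.
  have t0 : 0 <= theta ^+ N.
    by have [? ? _] := @mixing_rate_bounds R; rewrite exprn_ge0//; lra.
  have -> : \sum_(0 <= k < N) iter k.+1 Q centered_mean r = \sum_(0 <= k < N) iter k Q (Q centered_mean) r.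
    by apply: eq_bigr => k _; rewrite iterSr.
  by apply: le_trans (gN N r) _; rewrite ler_wpM2r// lerDr.
Qed.

Section variance.
Variables (h : R -> R) (C : R).
Hypothesis mh : measurable_fun [set: R] h.
Hypothesis hC : forall r, `|h r| <= `|r| + C.
Hypothesis hP : forall r, h r - Q h r = centered_mean r.

Definition increment (m : state R) : R := ladder_fbar m + h (delta_step m) - h m.1.

Lemma measurable_ladder_fbar : measurable_fun [set: state R] (@ladder_fbar R).
Proof. by apply: measurable_funB => //; exact: measurable_ladder_f. Qed.

Let mhs : measurable_fun [set: state R] (fun m => h (delta_step m)).
Proof. by have d := @measurable_delta_step R; exact: measurableT_comp mh d. Qed.

Let mh1 : measurable_fun [set: state R] (fun m => h m.1).
Proof. exact: (measurableT_comp mh (@measurable_fst _ _ mR NT)). Qed.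

Lemma measurable_increment : measurable_fun [set: state R] increment.
Proof.
apply: measurable_funB; last exact: mh1.
by apply: measurable_funD; [exact: measurable_ladder_fbar|exact: mhs].
Qed.

Let C0 : 0 <= C.
Proof. by have := le_trans (normr_ge0 _) (hC 0); rewrite normr0 add0r. Qed.

Definition increment_const : R := 2 + growth_mean + C + (growth_mean + C).

Let gm0 : 0 <= growth_mean.
Proof. by have := le_trans (normr_ge0 _) (norm_mean_f 0); rewrite normr0 add0r. Qed.

Lemma increment_const_ge0 : 0 <= increment_const.
Proof. by rewrite !addr_ge0. Qed.

(** The Poisson equation rewrites $h(r)+\chi$ as the mean of $f$ plus $Qh(r)$. The increment becomes
    $(f-Ef)+h(\Delta')-Qh(r)$, with each piece bounded independently of $r$. *)
Lemma norm_increment r w : `|increment (r, w)| <= increment_const * noise_growth w.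
Proof.
have -> : increment (r, w) = (ladder_f (r, w) - mean_f r) + h (delta_step (r, w)) - Q h r.
  by rewrite /increment /ladder_fbar/=; have := hP r; rewrite /centered_mean; lra.
have [_ _ QC] := linear_growth_step mh hC.
have h1 := ladder_f_centered r w.
have h2 : `|h (delta_step (r, w))| <= noise_growth w + C.
  apply: le_trans (hC _) _; rewrite lerD2r; apply: le_trans (norm_delta_step _) _.
  rewrite noise_growthE /=; have := normr_ge0 w.1.1; have := normr_ge0 w.1.2; lra.
have h3 := QC r.
have g1 := noise_growth_ge1 w.
apply: le_trans (ler_normB _ _) _.
apply: le_trans (lerD (ler_normD _ _) (lexx _)) _.
rewrite /increment_const !mulrDl.
have : growth_mean <= growth_mean * noise_growth w by rewrite ler_peMr.
have : C <= C * noise_growth w by rewrite ler_peMr.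
lra.
Qed.

Lemma norm_incrementX r w k : (k <= 3)%N ->
  `|increment (r, w) ^+ k| <= increment_const ^+ k * 216 * noise_dom w.
Proof.
move=> k3; rewrite normrX -mulrA.
apply: (@le_trans _ _ ((increment_const * noise_growth w) ^+ k)).
  by rewrite lerXn2r ?nnegrE ?mulr_ge0 ?increment_const_ge0 ?norm_increment//
    (le_trans _ (noise_growth_ge1 w)).
by rewrite exprMn ler_wpM2l ?exprn_ge0 ?increment_const_ge0// noise_growthX_le.
Qed.

Let incX k : (k <= 3)%N ->
  [/\ intg pi_state (fun m => increment m ^+ k),
   measurable_fun [set: R] (fun r => \int[noise R]_w increment (r, w) ^+ k),
   forall r, intg (noise R) (fun w => increment (r, w) ^+ k) &
   \int[pi_state]_m increment m ^+ k = \int[pi_prob]_r \int[noise R]_w increment (r, w) ^+ k].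
Proof.
move=> k3.
have mi : measurable_fun [set: state R] (fun m => increment m ^+ k).
  by apply: measurable_funX; exact: measurable_increment.
have b m : `|increment m ^+ k| <= increment_const ^+ k * 216 * state_dom m.
  case: m => r w; apply: le_trans (norm_incrementX r w k3) _.
  rewrite ler_wpM2l ?mulr_ge0 ?exprn_ge0 ?increment_const_ge0// /state_dom/=.
  by rewrite ler_peMl ?noise_dom_ge0// -expR0 ler_expR mulr_ge0//; lra.
by have [? ? ? _ ?] := state_dominated mi b.
Qed.

Lemma intg_incrementX r k : (k <= 3)%N -> intg (noise R) (fun w => increment (r, w) ^+ k).
Proof. by move=> k3; have [_ _ i _] := incX k3; exact: i. Qed.

Lemma increment_mean0 r : \int[noise R]_w increment (r, w) = 0.
Proof.
have [ih _ _] := linear_growth_step mh hC.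
have il := intg_ladder_f_section r.
have ic := intg_cst (noise R) (@chi R); have ir := intg_cst (noise R) (h r).
rewrite [LHS](RintegralB measurableT (intgD (intgB il ic) (ih r)) ir).
rewrite (RintegralD measurableT (intgB il ic) (ih r)) (RintegralB measurableT il ic).
rewrite [X in _ - X + _](_ : _ = chi); last exact: (Rintegral_cstp (noise R)).
rewrite [X in _ + _ - X](_ : _ = h r); last exact: (Rintegral_cstp (noise R)).
rewrite -/(mean_f r) -/(Q h r).
by have := hP r; rewrite /centered_mean; lra.
Qed.

Definition cond_variance (r : R) : R := \int[noise R]_w increment (r, w) ^+ 2.
Definition variance_bound : R := increment_const ^+ 2 * 216 * noise_const.

Lemma measurable_cond_variance : measurable_fun [set: R] cond_variance.
Proof. by have [] := @incX 2 isT. Qed.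

Lemma norm_cond_variance r : `|cond_variance r| <= variance_bound.
Proof.
apply: norm_Rintegral_noise_dominated; first exact: measurable_intg (@intg_incrementX r 2 isT).
by move=> w; exact: norm_incrementX.
Qed.

Definition asymptotic_variance : R := \int[pi_prob]_r cond_variance r.

Lemma third_moment r : \int[noise R]_w `|increment (r, w)| ^+ 3 <= increment_const ^+ 3 * 216 * noise_const.
Proof.
have i3 := intg_norm (@intg_incrementX r 3 isT).
have m3 : measurable_fun [set: NT] (fun w => `|increment (r, w)| ^+ 3).
  by have := measurable_intg i3; under eq_fun do rewrite normrX.
have b w : `| `|increment (r, w)| ^+ 3| <= increment_const ^+ 3 * 216 * noise_dom w.
  by rewrite -normrX normr_id; exact: norm_incrementX.
by apply: le_trans (ler_norm _) _; exact: norm_Rintegral_noise_dominated m3 b.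
Qed.

Lemma growth_product_le (f g : state R -> R) K L :
  (forall m, `|f m| <= K * growth m) -> (forall m, `|g m| <= L * growth m) ->
  forall m, `|f m * g m| <= K * L * 216 * state_dom m.
Proof.
move=> fK gL m; have gr1 := growth_ge1 m.
have K0 : 0 <= K by have := le_trans (normr_ge0 _) (fK m); rewrite pmulr_lge0//; lra.
have L0 : 0 <= L by have := le_trans (normr_ge0 _) (gL m); rewrite pmulr_lge0//; lra.
rewrite normrM; apply: le_trans (ler_pM _ _ (fK m) (gL m)) _ => //.
rewrite mulrACA -[leRHS]mulrA ler_wpM2l ?mulr_ge0// -expr2; exact: growth2_le.
Qed.

Lemma growth_product (f g : state R -> R) K L :
  measurable_fun [set: state R] f -> measurable_fun [set: state R] g ->
  (forall m, `|f m| <= K * growth m) -> (forall m, `|g m| <= L * growth m) ->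
  intg pi_state (fun m => f m * g m) /\
  \int[pi_state]_m (f m * g m) = \int[pi_prob]_r \int[noise R]_w (f (r, w) * g (r, w)).
Proof.
move=> mf mg fK gL; have mfg : measurable_fun [set: state R] (fun m => f m * g m).
  exact: measurable_funM.
by have [? _ _ _ ?] := state_dominated mfg (growth_product_le fK gL).
Qed.

(** With $h'=h(\Delta')$ and $\xi=\bar f+h'-h$, pointwise $\bar f^2+2\bar fh'=\xi^2-h'^2+h^2+2h\xi$.
    In stationarity $h'^2$ and $h^2$ have equal means, and $h\xi$ has mean zero because $\xi$ is
    centered given $r$. *)
Lemma asymptotic_varianceE : asymptotic_variance =
  \int[pi_state]_m ladder_fbar m ^+ 2 +
  2 * \int[pi_state]_m (ladder_fbar m * h (delta_step m)).
Proof.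
have fb (m : state R) : `|ladder_fbar m| <= (1 + `|chi|) * growth m.
  apply: le_trans (ler_normB _ _) _; rewrite mulrDl mul1r lerD ?norm_ladder_f//.
  by rewrite ler_peMr// growth_ge1.
have hb1 (m : state R) : `|h m.1| <= (1 + C) * growth m.
  apply: le_trans (hC _) _; rewrite mulrDl mul1r lerD ?ler_peMr ?growth_ge1//.
  rewrite /growth; have := normr_ge0 m.2.1.1; have := normr_ge0 m.2.1.2.
  have := normr_ge0 m.2.2; lra.
have hb2 m : `|h (delta_step m)| <= (1 + C) * growth m.
  apply: le_trans (hC _) _; rewrite mulrDl mul1r lerD ?ler_peMr ?growth_ge1//.
  apply: le_trans (norm_delta_step _) _.
  rewrite /growth; have := normr_ge0 m.2.1.1; have := normr_ge0 m.2.1.2.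
  have := normr_ge0 m.1; lra.
have xb m : `|increment m| <= increment_const * growth m.
  case: m => r w; apply: le_trans (norm_increment r w) _.
  rewrite ler_wpM2l ?increment_const_ge0// noise_growthE /growth/=; have := normr_ge0 r; lra.
have mf := measurable_ladder_fbar; have mx := measurable_increment.
have [iaa _] := growth_product mf mf fb fb.
have [iah _] := growth_product mf mhs fb hb2.
have [ixx xxE] := growth_product mx mx xb xb.
have [ihh hhE] := growth_product mh1 mh1 hb1 hb1.
have [iss ssE] := growth_product mhs mhs hb2 hb2.
have [ihx hxE] := growth_product mh1 mx hb1 xb.
have hx0 : \int[pi_state]_m (h m.1 * increment m) = 0.
  rewrite hxE -[RHS](Rintegral_cstp (@pi_prob R) 0); apply: eq_Rintegral => r _ /=.
  rewrite (RintegralZl _ measurableT (@intg_incrementX r 1 isT)).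
  by rewrite increment_mean0 mulr0.
have hs : \int[pi_state]_m (h m.1 * h m.1) = \int[pi_state]_m (h (delta_step m) * h (delta_step m)).
  rewrite hhE ssE.
  transitivity (\int[pi_prob]_r (h r * h r)).
    apply: eq_Rintegral => r _ /=; exact: (Rintegral_cstp (noise R)).
  apply: (@pi_invariant_Rintegral R (fun r => h r * h r) ((1 + C) ^+ 2 * 216)).
    exact: measurable_funM.
  move=> r; have b := hb1 (r, (0, 0, 0)); have g2 := growth2_le (r, (0, 0, 0) : NT).
  rewrite normrM -expr2; apply: (@le_trans _ _ (((1 + C) * growth (r, (0, 0, 0) : NT)) ^+ 2)).
    by rewrite lerXn2r ?nnegrE// (le_trans _ b).
  rewrite exprMn -mulrA ler_wpM2l ?exprn_ge0 ?addr_ge0//; apply: le_trans g2 _.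
  by rewrite /state_dom /noise_dom/= !normr0 !mulr0 !expR0 !mulr1.
have E : \int[pi_state]_m (ladder_fbar m ^+ 2) + 2 * \int[pi_state]_m (ladder_fbar m * h (delta_step m)) =
   \int[pi_state]_m (increment m * increment m) - \int[pi_state]_m (h (delta_step m) * h (delta_step m))
   + \int[pi_state]_m (h m.1 * h m.1) + 2 * \int[pi_state]_m (h m.1 * increment m).
  rewrite -(RintegralZl _ measurableT iah) -(RintegralZl _ measurableT ihx).
  rewrite -(RintegralD measurableT iaa (intgZ 2 iah)).
  rewrite -(RintegralB measurableT ixx iss) -(RintegralD measurableT (intgB ixx iss) ihh).
  rewrite -(RintegralD measurableT (intgD (intgB ixx iss) ihh) (intgZ 2 ihx)).
  by apply: eq_Rintegral => m _; rewrite /increment/=; ring.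
rewrite E hs hx0 mulr0 addr0 subrK xxE.
by apply: eq_Rintegral => r _.
Qed.

Lemma cond_variance_gt0 r : 0 < cond_variance r.
Proof.
have mz : measurable_fun [set: mR] (fun z : mR => h z - h r - chi).
  by apply: measurable_funB => //; exact: measurable_funB.
(* Whatever the value of the measurable shift [s z], moving x in a unit interval
   keeps x + s z away from 0 on a set of positive measure. *)
pose s z := h z - h r - chi.
(* A large $y$ gives $r+y-x>z$: the passage time grows by $x$ and the new difference is $z$, so the
   increment depends on $x$ through the bare summand $x$. *)
have incE (x y z : R) : 0 < x < 1 -> `|r| + 2 < y -> 0 < z < 1 ->
    increment (r, ((x, y), z)) = x + s z.
  move=> /andP[x0 x1] yr /andP[z0 z1]; have rN := ler_norm (- r); rewrite normrN in rN.
  have -> : increment (r, (x, y, z)) = Num.min (r + y + z) x - chi +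
      h (Num.min (r + y) (x + z) - Num.min (r + y + z) x) - h r by [].
  rewrite [Num.min (r + y) _]min_r; last lra.
  rewrite min_r; last lra.
  by rewrite (_ : x + z - x = z) /s; lra.
(* The value $1/16$ is $(1/4)^2$. Where $s(z)\ge-1/2$ take $x>3/4$, elsewhere $x<1/4$; in both cases
   $|x+s(z)|\ge1/4$, and one of the two sets of $z$ in $(0,1)$ has positive mass. *)
suff [A [mA A0 Ax]] : exists A : set NT, [/\ measurable A, (0 < noise R A)%E &
    forall w, A w -> 1 / 16 <= increment (r, w) ^+ 2].
  have /andP[n0 _] := noise_fine_gt0 mA A0.
  apply: (@lt_le_trans _ _ (1 / 16 * fine (noise R A))); first by rewrite mulr_gt0.
  have iA := intg_indic (noise R) mA.
  have -> : fine (noise R A) = \int[noise R]_w \1_A w by rewrite (measure_RintegralE (noise R) mA).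
  rewrite -(RintegralZl _ measurableT iA); apply: le_Rintegral => //.
  - exact: intgZ.
  - exact: intg_incrementX.
  - move=> w _; rewrite indicE; case: (boolP (w \in A)) => [|_].
      by rewrite inE => /Ax; rewrite mulr1.
    by rewrite mulr0 sqr_ge0.
pose t : R := `|r| + 2; have t0 : 0 <= t by rewrite addr_ge0.
have mB : measurable [set z : mR | - (1 / 2) <= s z].
  rewrite -[X in measurable X]setTI; apply: measurable_fun_le => //.
have mI (a b : R) : measurable (`]a, b[%classic : set mR) by exact: measurable_itv.
have mU : measurable (`]t, +oo[%classic : set mR) by exact: measurable_itv.
have U0 : (0 < exp1 R `]t, +oo[%classic)%E.
  by rewrite exp1_tail ?lte_fin ?expR_gt0.
pose B1 := `]0, 1[%classic `&` [set z : mR | - (1 / 2) <= s z].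
pose B2 := `]0, 1[%classic `&` ~` [set z : mR | - (1 / 2) <= s z].
have mB1 : measurable B1 by exact: measurableI.
have mB2 : measurable B2 by apply: measurableI => //; exact: measurableC.
have [b1|b1] := ltP 0%E (exp1 R B1).
- exists ((`]3 / 4, 1[%classic `*` `]t, +oo[%classic) `*` B1); split.
  + by apply: measurableX => //; exact: measurableX.
  + rewrite noise_setX//; apply: mule_gt0 => //; apply: mule_gt0 => //.
    by apply: exp1_unit_gt0; lra.
  + move=> [[x y] z] [[/=]]; rewrite !in_itv/= andbT => /andP[x0 x1] yr [/=].
    rewrite in_itv/= => zI zs; rewrite incE ?x1 ?andbT//; last lra.
    rewrite [1 / 16](_ : _ = (1 / 4) ^+ 2); last by field.
    by rewrite lerXn2r ?nnegrE//; lra.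
- exists ((`]0, 1 / 4[%classic `*` `]t, +oo[%classic) `*` B2); split.
  + by apply: measurableX => //; exact: measurableX.
  + rewrite noise_setX//; apply: mule_gt0; first apply: mule_gt0 => //.
      by apply: exp1_unit_gt0; lra.
    have e : exp1 R (`]0, 1[%classic : set mR) = (exp1 R B2 + exp1 R B1)%E.
      exact: (@measureDI _ _ _ (exp1 R) _ _ (mI 0 1) mB).
    have b0 : exp1 R B1 = 0%E by apply/eqP; rewrite eq_le b1 measure_ge0.
    rewrite b0 adde0 in e; rewrite -e; exact: (exp1_unit_gt0 (lexx 0) ltr01).
  + move=> [[x y] z] [[/=]]; rewrite !in_itv/= andbT => /andP[x0 x1] yr [/=].
    rewrite in_itv/= => zI /negP; rewrite -ltNge => zs; rewrite incE ?x0//=; last lra.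
    rewrite [1 / 16](_ : _ = (1 / 4) ^+ 2); last by field.
    by rewrite -[leRHS]sqrrN lerXn2r ?nnegrE//; lra.
Qed.

Lemma asymptotic_variance_gt0 : 0 < asymptotic_variance.
Proof.
apply: Rintegral_gt0; last exact: cond_variance_gt0.
 apply: (@intg_bounded _ _ _ _ _ variance_bound).
- exact: measurable_cond_variance.
- exact: norm_cond_variance.
Qed.

End variance.

End corrector.

(** * The iterated kernel and the Green-Kubo formula *)

Section iterated_kernel.
Context {R : realType}.
Notation mR := (measurableTypeR R).
Notation NT := (mR * mR * mR)%type.
Notation Q := (@step_op R).

Lemma ge0_integral_transition (m : state R) (f : state R -> \bar R) :
  measurable_fun [set: state R] f -> (forall m', (0 <= f m')%E) ->
  (\int[transition m]_m' f m' = \int[noise R]_w f (delta_step m, w))%E.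
Proof.
move=> mf f0; pose d : {measure set mR -> \bar R} := \d_(delta_step m).
have -> : (\int[transition m]_m' f m' = \int[(d \x noise R)%E]_m' f m')%E by [].
rewrite fubini_tonelli1// integral_dirac//; last exact: measurable_fun_fubini_tonelli_F.
by rewrite diracT mul1e.
Qed.

Lemma ge0_integral_ntransition n (m : state R) (f : state R -> \bar R) :
  measurable_fun [set: state R] f -> (forall m', (0 <= f m')%E) ->
  (\int[ntransition n.+1 m]_m' f m' =
   \int[noise R]_w \int[ntransition n (delta_step m, w)]_m' f m')%E.
Proof.
move=> mf f0.
transitivity (\int[kcomp (@transition R) (kernel.kernel_snd (@ntransition R n)) m]_m' f m')%E.
  by apply: eq_measure_integral => A mA _.
rewrite integral_kcomp//.
rewrite (@ge0_integral_transition _ (fun m' => \int[ntransition n m']_z f z)%E)//.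
- apply: measurable_fun_integral_kernel => // U mU; exact: measurable_kernel.
- by move=> m'; apply: integral_ge0.
Qed.

Lemma measurable_growth : measurable_fun [set: state R] (@growth R).
Proof.
rewrite (_ : @growth R = fun m => noise_growth m.2 + `|m.1|); last first.
  by apply/funext => m; rewrite noise_growthE /growth; lra.
apply: measurable_funD.
  exact: (measurableT_comp (@measurable_noise_growth R) (@measurable_snd _ _ mR NT)).
have h : measurable_fun [set: mR] (fun r : mR => `|r|) by exact: normr_measurable.
exact: (measurableT_comp h (@measurable_fst _ _ mR NT)).
Qed.

Lemma growthE (r : R) (w : NT) : growth (r, w) = `|r| + noise_growth w.
Proof. by rewrite noise_growthE /growth; lra. Qed.

Lemma intg_growth (r : R) : intg (noise R) (fun w => growth (r, w)).
Proof.
have := intgD (intg_cst (noise R) `|r|) (@intg_noise_growth R).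
by under eq_fun do rewrite -growthE.
Qed.

(** Each step brings $|\Delta|$ below the current rung weight and draws fresh weights of finite
    mean. The bound holds from every starting point and makes functions of linear growth integrable
    for all iterated kernels. *)
Lemma ntransition_growth n m : (\int[@ntransition R n m]_m' (growth m')%:E <=
  (growth m + n%:R * growth_mean)%:E)%E.
Proof.
have mg : measurable_fun [set: state R] (EFin \o @growth R).
  by apply/measurable_EFinP; exact: measurable_growth.
have g0 (m' : state R) : (0 <= (growth m')%:E)%E by rewrite lee_fin (le_trans _ (growth_ge1 _)).
elim: n m => [|n IH] m.
  have -> : (\int[ntransition 0 m]_m' (growth m')%:E = \int[\d_ m]_m' (growth m')%:E)%E by [].
  by rewrite integral_dirac// diracT mul1e mul0r addr0.
rewrite ge0_integral_ntransition//.
have i := intgD (intg_growth (delta_step m)) (intg_cst (noise R) (n%:R * growth_mean)).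
apply: (@le_trans _ _ (\int[noise R]_w (growth (delta_step m, w) + n%:R * growth_mean)%:E)%E).
  apply: ge0_le_integral => //.
  - by move=> w _; apply: integral_ge0.
  - have h : measurable_fun [set: state R] (fun m => \int[ntransition n m]_m' (growth m')%:E)%E.
      by apply: measurable_fun_integral_kernel => // U mU; exact: measurable_kernel.
    exact: (measurableT_comp h (measurable_pair1 _)).
  - exact: measurable_int i.
rewrite -(EFin_Rintegral i) lee_fin.
rewrite (RintegralD measurableT (intg_growth _) (intg_cst _ _)).
rewrite [X in _ + X <= _](_ : _ = n%:R * growth_mean); last exact: (Rintegral_cstp (noise R)).
have -> : \int[noise R]_w growth (delta_step m, w) = `|delta_step m| + growth_mean.
  under eq_Rintegral do rewrite growthE.
  rewrite (RintegralD measurableT (intg_cst _ _) (@intg_noise_growth R)).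
  by congr (_ + _); exact: (Rintegral_cstp (noise R)).
rewrite -natr1 mulrDl mul1r -addrA [growth_mean + _]addrC lerD2r.
apply: le_trans (norm_delta_step _) _; rewrite /growth.
have := normr_ge0 m.2.1.1; have := normr_ge0 m.2.1.2; have := normr_ge0 m.1; lra.
Qed.

Section linear_growth.
Variables (phi : state R -> R) (c : R).
Hypothesis mphi : measurable_fun [set: state R] phi.
Hypothesis phic : forall m, `|phi m| <= c * growth m.

Let c0 : 0 <= c.
Proof.
have := le_trans (normr_ge0 _) (phic (0, (0, 0, 0))).
by rewrite pmulr_lge0// (lt_le_trans _ (growth_ge1 _)).
Qed.

Let abs_le n m : (\int[@ntransition R n m]_m' `|(phi m')%:E| <=
  (c * (growth m + n%:R * growth_mean))%:E)%E.
Proof.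
have mg : measurable_fun [set: state R] (EFin \o @growth R).
  by apply/measurable_EFinP; exact: measurable_growth.
apply: (@le_trans _ _ (\int[@ntransition R n m]_m' (c%:E * (growth m')%:E))%E).
  apply: ge0_le_integral => //.
  - exact/measurableT_comp/measurable_EFinP.
  - exact: measurable_funeM.
  - by move=> x _; rewrite -EFinM lee_fin.
rewrite ge0_integralZl//; first by rewrite EFinM lee_wpmul2l ?lee_fin// ntransition_growth.
by move=> m' _; rewrite lee_fin (le_trans _ (growth_ge1 _)).
Qed.

Lemma intg_ntransition n m : intg (@ntransition R n m) phi.
Proof.
apply/integrableP; split; first exact/measurable_EFinP.
by apply: le_lt_trans (abs_le n m) _; rewrite ltry.
Qed.

Lemma norm_ntransition n m :
  `|\int[@ntransition R n m]_m' phi m'| <= c * (growth m + n%:R * growth_mean).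
Proof.
rewrite -lee_fin; apply: le_trans (abs_le n m).
rewrite -abse_EFin (EFin_Rintegral (intg_ntransition n m)).
by apply: le_abse_integral => //; exact/measurable_EFinP.
Qed.

Lemma measurable_ntransition n :
  measurable_fun [set: state R] (fun m => \int[@ntransition R n m]_m' phi m').
Proof.
have m1 (k : state R -> \bar R) : measurable_fun [set: state R] k -> (forall m, (0 <= k m)%E) ->
    measurable_fun [set: state R] (fun m => fine (\int[@ntransition R n m]_m' k m')%E).
  move=> mk k0; apply: measurableT_comp => //.
  by apply: measurable_fun_integral_kernel => // U mU; exact: measurable_kernel.
have mE : measurable_fun [set: state R] (EFin \o phi) by exact/measurable_EFinP.
have -> : (fun m => \int[@ntransition R n m]_m' phi m') =
    (fun m => fine (\int[@ntransition R n m]_m' ((EFin \o phi)^\+ m'))%E -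
              fine (\int[@ntransition R n m]_m' ((EFin \o phi)^\- m'))%E).
  apply/funext => m; have i := intg_ntransition n m.
  rewrite /Rintegral integralE fineB//.
    exact: (integrable_pos_fin_num measurableT i).
  exact: (integrable_neg_fin_num measurableT i).
by apply: measurable_funB; apply: m1 => //;
  [exact: measurable_funepos|exact: measurable_funeneg].
Qed.

Lemma intg_noise_ntransition n r :
  intg (noise R) (fun w => \int[@ntransition R n (r, w)]_m' phi m').
Proof.
apply: (@intg_dom _ _ _ _ (fun w => c * growth (r, w) + c * (n%:R * growth_mean))).
- exact: (measurableT_comp (measurable_ntransition n) (measurable_pair1 _)).
- by apply: intgD; [exact/intgZ/intg_growth|exact: intg_cst].
- by move=> w; rewrite -mulrDr; exact: norm_ntransition.
Qed.

End linear_growth.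

Let ge0_ntransitionS (phi : state R -> R) c n m : measurable_fun [set: state R] phi ->
  (forall m, `|phi m| <= c * growth m) -> (forall m, 0 <= phi m) ->
  \int[@ntransition R n.+1 m]_m' phi m' =
  \int[noise R]_w \int[@ntransition R n (delta_step m, w)]_m' phi m'.
Proof.
move=> mp pc p0; apply: EFin_inj.
rewrite (EFin_Rintegral (intg_ntransition mp pc _ _)).
rewrite (EFin_Rintegral (intg_noise_ntransition mp pc _ _)).
rewrite ge0_integral_ntransition//; last exact/measurable_EFinP.
by apply: eq_integral => w _; rewrite (EFin_Rintegral (intg_ntransition mp pc _ _)).
Qed.

(** Tonelli covers nonnegative functions only; a signed [phi] is the difference of the nonnegative
    functions [phi + c * growth] and [c * growth], both of linear growth. *)
Lemma ntransitionS (phi : state R -> R) c n m : measurable_fun [set: state R] phi ->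
  (forall m, `|phi m| <= c * growth m) ->
  \int[@ntransition R n.+1 m]_m' phi m' =
  \int[noise R]_w \int[@ntransition R n (delta_step m, w)]_m' phi m'.
Proof.
move=> mp pc.
have c0 : 0 <= c.
  have := le_trans (normr_ge0 _) (pc (0, (0, 0, 0))).
  by rewrite pmulr_lge0// (lt_le_trans _ (growth_ge1 _)).
pose b m := c * growth m : R; pose a m := phi m + b m.
have b0 m' : 0 <= b m' by rewrite mulr_ge0// (le_trans _ (growth_ge1 _)).
have mb : measurable_fun [set: state R] b by apply: measurable_funM => //; exact: measurable_growth.
have ma : measurable_fun [set: state R] a by exact: measurable_funD.
have bc m' : `|b m'| <= c * growth m' by rewrite ger0_norm.
have a0 m' : 0 <= a m' by have := pc m'; rewrite ler_norml /a /b => /andP[]; lra.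
have ac m' : `|a m'| <= 2 * c * growth m'.
  by rewrite (ger0_norm (a0 m')); have := pc m'; rewrite ler_norml /a /b => /andP[]; lra.
have E k m' : \int[@ntransition R k m']_z phi z =
    \int[@ntransition R k m']_z a z - \int[@ntransition R k m']_z b z.
  rewrite -(RintegralB measurableT (intg_ntransition ma ac _ _) (intg_ntransition mb bc _ _)).
  by apply: eq_Rintegral => z _; rewrite /a addrK.
rewrite E (ge0_ntransitionS _ _ ma ac a0) (ge0_ntransitionS _ _ mb bc b0).
rewrite -(RintegralB measurableT (intg_noise_ntransition ma ac _ _) (intg_noise_ntransition mb bc _ _)).
by apply: eq_Rintegral => w _; rewrite E.
Qed.

(** The first step is deterministic in the first coordinate and leads to [delta_step m]. The weights
    at the final time are fresh and average [phi] to a function of the difference; in between, $Q$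
    acts $n$ times. *)
Lemma ntransition_step_op (phi : state R -> R) c n m : measurable_fun [set: state R] phi ->
  (forall m, `|phi m| <= c * growth m) ->
  \int[@ntransition R n.+1 m]_m' phi m' =
  iter n Q (fun r => \int[noise R]_w phi (r, w)) (delta_step m).
Proof.
move=> mp pc; elim: n m => [|n IH] m; rewrite (ntransitionS _ _ mp pc).
  apply: eq_Rintegral => w _.
  have -> : \int[ntransition 0 (delta_step m, w)]_m' phi m' =
      fine (\int[\d_((delta_step m, w) : state R)]_m' (phi m')%:E)%E by [].
  by rewrite integral_dirac// ?diracT ?mul1e//; exact/measurable_EFinP.
by rewrite iterS; apply: eq_Rintegral => w _; exact: IH.
Qed.

Lemma measurable_state_space : measurable (@state_space R).
Proof.
have -> : @state_space R = setT `*` @noise_pos R.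
  apply/seteqP; split => -[r [[x y] z]] /=.
    by move=> [x0 y0 z0]; split => //; split; [split|]; rewrite /= in_itv/= andbT.
  by move=> [_ [[/=]]]; rewrite !in_itv/= !andbT.
by apply: measurableX => //; exact: measurable_noise_pos.
Qed.

Let in_state_space (r : R) (w : NT) : 0 < w.1.1 -> 0 < w.1.2 -> 0 < w.2 ->
  (r, w) \in @state_space R.
Proof. by case: w => [[x y] z] /= *; rewrite inE. Qed.

Let restrict_norm (phi : state R -> R) m : `|(phi \_ state_space) m| <= `|phi m|.
Proof. by rewrite patchE; case: ifP => //; rewrite normr0. Qed.

Let measurable_restrict (phi : state R -> R) : measurable_fun [set: state R] phi ->
  measurable_fun [set: state R] (phi \_ state_space).
Proof.
move=> mp; exact: ((measurable_restrictT _ measurable_state_space).1 (measurable_funTS mp)).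
Qed.

Lemma pi_tilde_state_space (psi : state R -> R) C : measurable_fun [set: state R] psi ->
  (forall m, `|psi m| <= C * state_dom m) ->
  (pi_tilde R).-integrable state_space (EFin \o psi) /\
  \int[pi_tilde R]_(m in state_space) psi m = \int[pi_state]_m psi m.
Proof.
move=> mp pC; have mr := measurable_restrict mp.
have rC m : `|(psi \_ state_space) m| <= C * state_dom m by exact: le_trans (restrict_norm _ _) _.
have [i _ _ _ E] := state_dominated mp pC; have [_ _ _ _ Er] := state_dominated mr rC.
split; first exact: (integrableS measurableT measurable_state_space (@subsetT _ _) i).
rewrite Rintegral_mkcond.
have -> : \int[pi_tilde R]_m (psi \_ state_space) m = \int[pi_state]_m (psi \_ state_space) m by [].
rewrite Er E; apply: eq_Rintegral => r _; apply: eq_noise_Rintegral.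
- exact: (measurableT_comp mr (measurable_pair1 _)).
- exact: (measurableT_comp mp (measurable_pair1 _)).
- by move=> w x0 y0 z0; rewrite patchE in_state_space.
Qed.

Lemma norm_ladder_fbar (m : state R) : `|ladder_fbar m| <= (1 + `|chi|) * growth m.
Proof.
apply: le_trans (ler_normB _ _) _; rewrite mulrDl mul1r lerD ?norm_ladder_f//.
by rewrite ler_peMr// growth_ge1.
Qed.

(** After at least one step the weights are fresh, hence almost surely positive, and restricting to
    [state_space] loses no mass even from a point outside it. At $n=0$ the kernel is a Dirac mass,
    without averaging. *)
Lemma iter_fbarE n m : (0 < n)%N ->
  iter_fbar n m = iter n.-1 Q (@centered_mean R) (delta_step m).
Proof.
case: n => // n _; rewrite /iter_fbar Rintegral_mkcond.
have mf := @measurable_ladder_fbar R; have mr := measurable_restrict mf.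
rewrite (@ntransition_step_op _ (1 + `|chi|))//; last first.
  by move=> m'; apply: le_trans (restrict_norm _ _) _; exact: norm_ladder_fbar.
congr (iter n Q _ _); apply/funext => r.
transitivity (\int[noise R]_w ladder_fbar (r, w)).
  apply: eq_noise_Rintegral.
  - exact: (measurableT_comp mr (measurable_pair1 _)).
  - exact: (measurableT_comp mf (measurable_pair1 _)).
  - by move=> w x0 y0 z0; rewrite patchE in_state_space.
rewrite [LHS](RintegralB measurableT (intg_ladder_f_section r) (intg_cst (noise R) chi)).
by congr (_ - _); exact: (Rintegral_cstp (noise R)).
Qed.

Lemma intg_ntransition_fbar n m :
  (@ntransition R n m).-integrable state_space (EFin \o ladder_fbar).
Proof.
have := intg_ntransition (@measurable_ladder_fbar R) norm_ladder_fbar n m.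
by apply: integrableS => //; exact: measurable_state_space.
Qed.

Lemma norm_delta_growth (m : state R) c : 0 <= c ->
  `|delta_step m| + c <= (1 + c) * growth m.
Proof.
move=> c0; rewrite mulrDl mul1r lerD ?ler_peMr ?growth_ge1//.
apply: le_trans (norm_delta_step _) _; rewrite /growth.
have := normr_ge0 m.2.1.1; have := normr_ge0 m.2.1.2; have := normr_ge0 m.1; lra.
Qed.

Lemma iter_step_op_centered k : exists2 c, 0 <= c &
  measurable_fun [set: R] (iter k Q (@centered_mean R)) /\
  forall r, `|iter k Q (@centered_mean R) r| <= `|r| + c.
Proof.
have gm0 : 0 <= @growth_mean R.
  by have := le_trans (normr_ge0 _) (@norm_mean_f R 0); rewrite normr0 add0r.
elim: k => [|k [c c0 [mk kc]]].
  exists (growth_mean + `|chi|); first by rewrite addr_ge0.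
  by split; [exact: measurable_centered_mean|exact: norm_centered_mean].
have [_ mQ Qc] := linear_growth_step mk kc.
exists (growth_mean + c); first by rewrite addr_ge0.
by split => // r; apply: le_trans (Qc r) _; rewrite lerDr.
Qed.

Lemma fbar_iter_dominated n : (0 < n)%N -> exists2 c : R,
  measurable_fun [set: state R] (fun m => ladder_fbar m * iter_fbar n m) &
  forall m, `|ladder_fbar m * iter_fbar n m| <= c * state_dom m.
Proof.
move=> n0; have [c c0 [mk kc]] := iter_step_op_centered n.-1.
have bi m : `|iter_fbar n m| <= (1 + c) * growth m.
  by rewrite iter_fbarE//; apply: le_trans (kc _) _; exact: norm_delta_growth.
eexists; last exact: (growth_product_le norm_ladder_fbar bi).
apply: measurable_funM; first exact: measurable_ladder_fbar.
rewrite (_ : iter_fbar n = fun m => iter n.-1 Q (@centered_mean R) (delta_step m)); last first.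
  by apply/funext => m; exact: iter_fbarE.
by have d := @measurable_delta_step R; exact: measurableT_comp mk d.
Qed.

(** Truncating the series of $h$ costs $C\theta^N$ uniformly in $r$, so the partial sums converge
    geometrically to the integral of $\bar f\,h(\Delta')$, the cross term of
    [asymptotic_varianceE]. *)
Lemma green_kubo (h : R -> R) (C : R) : measurable_fun [set: R] h ->
  (forall r, `|h r| <= `|r| + C) -> (forall r, h r - Q h r = centered_mean r) ->
  (forall N r, `|h r - \sum_(0 <= k < N.+1) iter k Q (@centered_mean R) r|
     <= C * mixing_rate ^+ N) ->
  let u N := \sum_(1 <= n < N) \int[pi_tilde R]_(m in state_space) (ladder_fbar m * iter_fbar n m) in
  [/\ (pi_tilde R).-integrable state_space (EFin \o (fun m => ladder_fbar m ^+ 2)),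
      forall n : nat, (0 < n)%N -> (pi_tilde R).-integrable state_space
        (EFin \o (fun m => ladder_fbar m * iter_fbar n m)),
      cvgn u &
      asymptotic_variance h = \int[pi_tilde R]_(m in state_space) (ladder_fbar m ^+ 2) + 2 * limn u].
Proof.
move=> mh hC hP hN u.
have [t12 t1 _] := @mixing_rate_bounds R.
have mf := @measurable_ladder_fbar R.
have C0 : 0 <= C by have := le_trans (normr_ge0 _) (hC 0); rewrite normr0 add0r.
have ffE : (fun m : state R => ladder_fbar m ^+ 2) = fun m => ladder_fbar m * ladder_fbar m.
  by apply/funext => m; rewrite expr2.
have mff : measurable_fun [set: state R] (fun m : state R => ladder_fbar m ^+ 2).
  exact: measurable_funX.
have ffb : forall m : state R, `|ladder_fbar m ^+ 2| <= (1 + `|chi|) * (1 + `|chi|) * 216 * state_dom m.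
  by move=> m; rewrite expr2; exact: (growth_product_le norm_ladder_fbar norm_ladder_fbar).
have [iff ffI] := pi_tilde_state_space mff ffb.
have mhd : measurable_fun [set: state R] (fun m : state R => h (delta_step m)).
  by have d := @measurable_delta_step R; exact: measurableT_comp mh d.
have hdb (m : state R) : `|h (delta_step m)| <= (1 + C) * growth m.
  by apply: le_trans (hC _) _; exact: norm_delta_growth.
have [ifh _] := growth_product mf mhd norm_ladder_fbar hdb.
have iabs : intg pi_state (fun m : state R => `|ladder_fbar m|).
  have fb (m : state R) : `|ladder_fbar m| <= (1 + `|chi|) * 216 * state_dom m.
    apply: le_trans (norm_ladder_fbar m) _; rewrite -mulrA ler_wpM2l ?addr_ge0//.
    exact: growth_le.
  by have [i _ _ _ _] := state_dominated mf fb; exact: intg_norm.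
pose S N (m : state R) := \sum_(0 <= k < N) iter k Q (@centered_mean R) (delta_step m).
have uE N : intg pi_state (fun m => ladder_fbar m * S N m) /\
    u N.+1 = \int[pi_state]_m (ladder_fbar m * S N m).
  elim: N => [|N [iN uN]].
    have -> : (fun m => ladder_fbar m * S 0 m) = (fun=> 0) :> (state R -> R).
      by apply/funext => m; rewrite /S big_geq// mulr0.
    by split; [exact: intg_cst|rewrite /u big_geq// (Rintegral_cstp (@pi_state R))].
  have [c mc bc] := fbar_iter_dominated (ltn0Sn N).
  have [i _ _ _ _] := state_dominated mc bc.
  have -> : (fun m => ladder_fbar m * S N.+1 m) =
      (fun m => ladder_fbar m * S N m + ladder_fbar m * iter_fbar N.+1 m).
    by apply/funext => m; rewrite /S big_nat_recr//= iter_fbarE// mulrDr.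
  split; first exact: intgD.
  rewrite (RintegralD measurableT iN i) -uN -(pi_tilde_state_space mc bc).2.
  by rewrite /u big_nat_recr.
have ulim : u n @[n --> \oo] --> \int[pi_state]_m (ladder_fbar m * h (delta_step m)).
  (* The shift by two combines the sum in [u] starting at $1$ with the bound of index $n$ on $h$,
     which concerns $n+1$ terms. *)
  rewrite -(@cvg_shiftn 2 _ u); apply/cvgrPdist_le => /= e e0.
  pose K := C * \int[pi_state]_m `|ladder_fbar m|.
  have h0 : geometric K (@mixing_rate R) n @[n --> \oo] --> (0 : R).
    by apply: cvg_geometric; rewrite ger0_norm//; lra.
  near=> n; apply: (@le_trans _ _ `|geometric K (@mixing_rate R) n|); last first.
    by near: n; move/cvgr0Pnorm_le : h0; exact.
  rewrite addn2; have [iS ->] := uE n.+1.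
  rewrite -(RintegralB measurableT ifh iS) /geometric/= /K.
  have -> : C * (\int[pi_state]_m `|ladder_fbar m|) * mixing_rate ^+ n =
      \int[pi_state]_m (C * mixing_rate ^+ n * `|ladder_fbar m|).
    by rewrite (RintegralZl _ measurableT iabs); ring.
  apply: le_trans (ler_norm _); apply: le_norm_Rintegral.
  - exact: measurable_intg (intgB ifh iS).
  - exact: intgZ.
  - by move=> m; rewrite -mulrBr normrM mulrC ler_wpM2r// hN.
split => //.
- move=> n n0; have [c mc bc] := fbar_iter_dominated n0.
  exact: (pi_tilde_state_space mc bc).1.
- by apply/cvg_ex; eexists; exact: ulim.
- by rewrite (cvg_lim _ ulim)// ffI (asymptotic_varianceE mh hC hP).
Unshelve. all: by end_near. Qed.

End iterated_kernel.

(** * Passage times on the ladder *)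

Section ladder_recursion.
Context {R : realType}.
Variable w : ladder_edge -> R.
Notation vertex := (nat * bool)%type.
Implicit Types (n : nat) (c : bool) (u v x : vertex) (p q : seq vertex).

(** The ladder with columns indexed by all natural numbers: paths in ladders of different lengths
    share one type, which the induction on the length needs. *)
Definition nadj : rel vertex := fun u v =>
  (u.2 == v.2) && ((v.1 == u.1.+1) || (u.1 == v.1.+1)) || (u.1 == v.1) && (u.2 != v.2).

Definition nedge u v : ladder_edge :=
  if u.1 == v.1 then rung u.1 else rail (minn u.1 v.1) u.2.

Fixpoint nweight u p : R := if p is v :: p' then w (nedge u v) + nweight v p' else 0.

Lemma nweight_rcons u p v : nweight u (rcons p v) = nweight u p + w (nedge (last u p) v).
Proof. by elim: p u => [|y p IH] u /=; rewrite ?addr0 ?add0r// IH addrA. Qed.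

Definition root : vertex := (0%N, false).

Definition npath n c p : Prop :=
  [/\ path nadj root p, last root p = (n, c), uniq (root :: p) &
      all (fun v => v.1 <= n)%N p].

Lemma nadj_top n c u : (u.1 <= n.+1)%N -> nadj u (n.+1, c) -> u = (n, c) \/ u = (n.+1, ~~ c).
Proof.
case: u => i b /= iN /orP[/andP[/eqP /= -> /orP[/eqP [->]|/eqP]]|/andP[/eqP /= ->]].
- by left.
- by move=> iE; rewrite iE ltnn in iN.
- by case: b c => -[] //= _; right.
Qed.

Lemma nadj_top_sym u v : nadj u v = nadj v u.
Proof.
rewrite /nadj orbC [in RHS]orbC [u.1 == _]eq_sym [u.2 == _]eq_sym.
by congr (_ && _ || (_ && _)); rewrite ?[_ == v.1]eq_sym// orbC.
Qed.

Lemma all_le_top n c p : all (fun v => v.1 <= n.+1)%N p ->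
  (n.+1, c) \notin p -> (n.+1, ~~ c) \notin p -> all (fun v => v.1 <= n)%N p.
Proof.
move=> /allP pa nc nc'; apply/allP => -[i b] ip; have := pa _ ip; rewrite /= leq_eqVlt.
case/orP => // /eqP iE; subst i.
by case: b c ip nc nc' => -[] /= ->.
Qed.

(* The top rung can only be left through the rail by which it was reached. *)
Lemma top_last n c p : path nadj root p -> uniq (root :: p) ->
  all (fun v => v.1 <= n.+1)%N p -> (n.+1, c) \notin p -> (n.+1, ~~ c) \in p ->
  last root p = (n.+1, ~~ c).
Proof.
move=> pp pu pa cp /splitPr ps; case: ps pp pu pa cp => p1 p2.
rewrite cat_path last_cat -cat_cons cat_uniq /= all_cat mem_cat /= inE.
move=> /and3P[pp1 a1 pp2] /and3P[_ /norP[_ ud] _] /and3P[pa1 _ pa2].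
rewrite !negb_or => /and3P[cp1 _ cp2].
have [e1|e1] : last root p1 = (n, ~~ c) \/ last root p1 = (n.+1, ~~ ~~ c).
- apply: nadj_top a1; have := mem_last root p1; rewrite inE => /orP[/eqP -> //|].
  by move/allP : pa1; exact.
- case: p2 pp2 ud pa2 cp2 => [//|y p2] /= /andP[ay _] /norP[yd _] /andP[ya _].
  rewrite negb_or => /andP[yc _].
  have [ye|ye] : y = (n, ~~ c) \/ y = (n.+1, ~~ ~~ c).
  + by apply: nadj_top => //; rewrite nadj_top_sym.
  + by move: yd; rewrite ye -e1 mem_last.
  + by move: yc; rewrite ye negbK eqxx.
- rewrite negbK in e1; have := mem_last root p1; rewrite e1 inE => /orP[/eqP //|].
  by rewrite (negbTE cp1).
Qed.

Definition npassage n c : set R := [set nweight root p | p in npath n c].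

Lemma npassage0 c : npassage 0 c = [set if c then w (rung 0) else 0].
Proof.
apply/seteqP; split => s /=; last first.
  move=> ->; exists (if c then [:: (0%N, true)] else [::]); case: c => //=.
  by rewrite /nedge/= addr0.
move=> [p [pp pl pu pa] <-]; case: c pl => pl.
- case: p pp pl pu pa => [//|y p] /= /andP[ay pp] pl /and3P[_ yp _] /andP[y0 _].
  have ye : y = (0%N, true).
    by case: y y0 ay {pp pl yp} => [[|//] [|]].
  case/lastP: p pl yp {pp} => [_ _|p z]; first by rewrite ye /nedge/= addr0.
  by rewrite last_rcons => ->; rewrite ye mem_rcons inE eqxx.
- case/lastP: p pl pu {pp pa} => [//|p z]; rewrite last_rcons => ->.
  by rewrite /= mem_rcons inE eqxx.
Qed.

(** By inspection of the last edge. If it is a rail, [top_last] shows that the path avoided the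
    other end of the last rung. If it is the rung, the edge before it is the other rail. In both
    cases self-avoidance puts the remaining path in the shorter ladder. *)
Lemma npassageS n c s : npassage n.+1 c s <->
  (exists2 s', npassage n c s' & s = s' + w (rail n c)) \/
  (exists2 s', npassage n (~~ c) s' & s = s' + w (rail n (~~ c)) + w (rung n.+1)).
Proof.
have eS b : nedge (n, b) (n.+1, b) = rail n b.
  by rewrite /nedge/= -[n == n.+1]negbK neq_ltn ltnSn /minn ltnSn.
have eR b b' : nedge (n.+1, b) (n.+1, b') = rung n.+1 by rewrite /nedge/= eqxx.
have aS b : nadj (n, b) (n.+1, b) by rewrite /nadj/= !eqxx.
have aR b : nadj (n.+1, ~~ b) (n.+1, b) by rewrite /nadj/= !eqxx; case: b.
have newtop b p m : all (fun v => v.1 <= n)%N p -> (n < m)%N -> (m, b) \notin root :: p.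
  move=> pa nm; rewrite inE negb_or; apply/andP; split; first by case: m nm => // -[].
  by apply/negP => /(allP pa) /=; rewrite leqNgt nm.
have weak p : all (fun v => v.1 <= n)%N p -> all (fun v => v.1 <= n.+1)%N p.
  by apply: sub_all => v vn; exact: leqW.
split; last first.
  move=> [[_ [p [pp pl pu pa] <-] ->]|[_ [p [pp pl pu pa] <-] ->]].
  - exists (rcons p (n.+1, c)); last by rewrite nweight_rcons pl eS.
    split; rewrite ?last_rcons ?rcons_path ?pp ?pl ?aS//.
    + by rewrite -rcons_cons rcons_uniq pu newtop.
    + by rewrite all_rcons /= leqnn weak.
  - exists (rcons (rcons p (n.+1, ~~ c)) (n.+1, c)).
      split; rewrite ?last_rcons ?rcons_path ?last_rcons ?pp ?pl ?aS ?aR//.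
      + rewrite -!rcons_cons !rcons_uniq pu andbT; apply/andP; split; last exact: newtop.
        by rewrite mem_rcons inE negb_or newtop// andbT; apply/eqP => -[]; case: c {pl}.
      + by rewrite !all_rcons /= leqnn weak.
    by rewrite !nweight_rcons last_rcons pl eS eR.
move=> [p [pp pl pu pa] <-].
case/lastP: p pp pl pu pa => [//|q v].
rewrite last_rcons rcons_path => /andP[pq aq] ve; subst v.
rewrite -rcons_cons rcons_uniq all_rcons => /andP[qu uq] /andP[_ qa].
have lq : ((last root q).1 <= n.+1)%N.
  by have := mem_last root q; rewrite inE => /orP[/eqP -> //|]; move/allP : qa; exact.
have qc : (n.+1, c) \notin q by move: qu; rewrite inE negb_or => /andP[].
have [le|le] := nadj_top lq aq.
- left; exists (nweight root q); last by rewrite nweight_rcons le eS.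
  exists q => //; split => //.
  suff qnc : (n.+1, ~~ c) \notin q.
    exact: all_le_top qc qnc.
  apply/negP => /(top_last pq uq qa qc); rewrite le => -[] /eqP.
  by rewrite -[_ == _]negbK neq_ltn ltnSn.
- right; case/lastP: q pq uq qa qc le {lq qu aq} => [//|q v].
  rewrite last_rcons rcons_path => /andP[pq aq]; rewrite -rcons_cons rcons_uniq all_rcons.
  move=> /andP[qu uq] /andP[_ qa]; rewrite mem_rcons inE negb_or => /andP[_ qc] ve; subst v.
  have lq : ((last root q).1 <= n.+1)%N.
    by have := mem_last root q; rewrite inE => /orP[/eqP -> //|]; move/allP : qa; exact.
  have qnc : (n.+1, ~~ c) \notin q by move: qu; rewrite inE negb_or => /andP[].
  have [le|le] := nadj_top lq aq; last first.
    have := mem_last root q; rewrite le inE negbK => /orP[/eqP //|].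
    by rewrite (negbTE qc).
  exists (nweight root q); last by rewrite !nweight_rcons last_rcons le eS eR.
  exists q => //; split => //.
  exact: all_le_top qc qnc.
Qed.

Fixpoint passage n c : R :=
  if n is n'.+1 then
    Num.min (passage n' c + w (rail n' c))
            (passage n' (~~ c) + w (rail n' (~~ c)) + w (rung n))
  else if c then w (rung 0) else 0.

Lemma passageP n c : npassage n c (passage n c) /\ forall s, npassage n c s -> passage n c <= s.
Proof.
elim: n c => [|n IH] c; first by rewrite npassage0; split => // s /= ->.
have [i1 l1] := IH c; have [i2 l2] := IH (~~ c); split.
- apply/npassageS; rewrite /= /Num.min; case: ifP => _; [left|right]; by eexists; first eassumption.
- move=> s /npassageS[[s' /l1 h ->]|[s' /l2 h ->]]; rewrite /= ge_min.
    by rewrite lerD2r h.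
  by rewrite !lerD2r h orbT.
Qed.

Lemma inf_passage n c : inf (npassage n c) = passage n c.
Proof.
have [i l] := passageP n c; apply/eqP; rewrite eq_le; apply/andP; split.
- by apply: ge_inf => //; exists (passage n c) => s /l.
- by apply: lb_le_inf; [exists (passage n c)|move=> s /l].
Qed.

Definition nat_vertex n (v : ladder_vertex n) : vertex := (v.1 : nat, v.2).

Lemma nat_vertex_inj n : injective (@nat_vertex n).
Proof. by move=> [i b] [j b'] [] /val_inj -> ->. Qed.

Lemma path_weight_nat n (v : ladder_vertex n) (p' : seq (ladder_vertex n)) :
  path_weight (fun a b : ladder_vertex n => w (ladder_edge_of a b)) v p' =
  nweight (nat_vertex v) (map (@nat_vertex n) p').
Proof.
by elim: p' v => [//|y p IH] v /=; rewrite IH.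
Qed.

Lemma first_passage_timeE n :
  first_passage_time (@ladder n) (fun a b : ladder_vertex n => w (ladder_edge_of a b))
    (ord0, false) (ord_max, false) = passage n false.
Proof.
rewrite -inf_passage /first_passage_time; congr inf; apply/seteqP; split => s /=.
- move=> [p [pp pl pu] <-]; exists (map (@nat_vertex n) p); last exact/esym/path_weight_nat.
  have r0 : root = @nat_vertex n (ord0, false) by [].
  split.
  + by rewrite r0 path_map; apply: sub_path pp => u v.
  + by rewrite r0 last_map pl.
  + by rewrite r0 -map_cons map_inj_uniq//; exact: nat_vertex_inj.
  + by apply/allP => _ /mapP[v _ ->] /=; rewrite -ltnS.
- move=> [p [pp pl pu pa] <-].
  (* This inverts [nat_vertex] on columns up to $n$ only, which the last condition of [npath]
     guarantees. *)
  pose f (v : vertex) : ladder_vertex n := (inord v.1, v.2).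
  have fK : map (@nat_vertex n) (map f p) = p.
    rewrite -map_comp -[RHS]map_id; apply/eq_in_map => -[i b] /(allP pa) /= ip.
    by rewrite /nat_vertex/= inordK.
  have r0 : root = @nat_vertex n (ord0, false) by [].
  exists (map f p); last by rewrite path_weight_nat fK.
  split.
  + by move: pp; rewrite -{1}fK r0 path_map; apply: sub_path => u v.
  + by apply: nat_vertex_inj; rewrite -last_map -r0 fK pl.
  + suff : uniq (((ord0, false) : ladder_vertex n) :: map f p) by [].
    by rewrite -(map_inj_uniq (@nat_vertex_inj n)) map_cons fK.
Qed.

(** The weights read between times $n$ and $n+1$, that is $(X_{n+1},Y_{n+1},Z_{n+1})$: rails are
    counted from $0$, so [rail n] leaves column $n$. *)
Definition column n : (measurableTypeR R * measurableTypeR R * measurableTypeR R)%type :=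
  ((w (rail n false), w (rail n true)), w (rung n.+1)).

(** The initial value is $Z_0$, since in $G_0$ the rung is the only path between the two
    vertices. *)
Fixpoint delta n : measurableTypeR R :=
  if n is n'.+1 then delta_step (delta n', column n') else w (rung 0).

Lemma passage_delta n : passage n true = passage n false + delta n.
Proof.
elim: n => [|n IH]; first by rewrite /= add0r.
rewrite /= {}IH; move: (passage n false) (delta n) => l r.
move: (w (rail n false)) (w (rail n true)) (w (rung n.+1)) => x y z.
rewrite /Num.min; repeat case: ltP => ?; lra.
Qed.

Lemma passageS n : passage n.+1 false = passage n false + ladder_f (delta n, column n).
Proof.
rewrite /= passage_delta; move: (passage n false) (delta n) => l r.
move: (w (rail n false)) (w (rail n true)) (w (rung n.+1)) => x y z.
rewrite /Num.min; repeat case: ltP => ?; lra.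
Qed.

End ladder_recursion.

Lemma measure_eq_rectangles d1 d2 (T1 : measurableType d1) (T2 : measurableType d2) (R : realType)
    (m1 m2 : {measure set (T1 * T2) -> \bar R}) :
  (m1 setT < +oo)%E ->
  (forall A B, measurable A -> measurable B -> m1 (A `*` B) = m2 (A `*` B)) ->
  forall C, measurable C -> m1 C = m2 C.
Proof.
move=> m1fin m12 C mC.
apply: (measure_unique _ (fun=> setT) (measurable_prod_measurableType T1 T2)) => //.
- move=> _ _ [A1 mA1 [B1 mB1 <-]] [A2 mA2 [B2 mB2 <-]]; rewrite -setXI.
  by exists (A1 `&` A2); [exact: measurableI|exists (B1 `&` B2) => //; exact: measurableI].
- by move=> _; exists setT => //; exists setT => //; rewrite setXTT.
- by apply/seteqP; split => // x _; exists 0%N.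
- by move=> _ [A mA [B mB <-]]; exact: m12.
Qed.

(** * Independence *)

Section independence.
Context d (T : measurableType d) (R : realType) (P : probability T R) (I : eqType).
Variable W : I -> {RV P >-> R}.
Notation mR := (measurableTypeR R).
Implicit Types (D : pred I) (s : seq I) (A : I -> set R) (E : set T).

Definition cylinder s A : set T := \bigcap_(i in [set` s]) W i @^-1` A i.
Definition weight s A : \bar R := (\prod_(i <- s) P (W i @^-1` A i))%E.

(** Independence is tested on finite cylinders, which avoids the generated sigma-algebras and
    suffices for feeding in the weights one at a time. *)
Definition indep_event D E : Prop := forall s A, uniq s -> all D s ->
  (forall i, measurable (A i)) -> P (E `&` cylinder s A) = (P E * weight s A)%E.

(* U has law mu and is independent of any event independent of the family D;
   moreover it leaves the family D' independent of both. *)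
Definition fresh d' (S : measurableType d') (U : T -> S) (mu : set S -> \bar R) D D' : Prop :=
  forall E, measurable E -> indep_event D E -> forall C, measurable C ->
  forall s A, uniq s -> all D' s -> (forall i, measurable (A i)) ->
    P (E `&` U @^-1` C `&` cylinder s A) = (P E * mu C * weight s A)%E.

Let measurable_pre i (A : set R) : measurable A -> measurable (W i @^-1` A).
Proof. by move=> mA; rewrite -[X in measurable X]setTI; exact: measurable_funP. Qed.

Lemma measurable_cylinder s A : (forall i, measurable (A i)) -> measurable (cylinder s A).
Proof.
move=> mA; apply: fin_bigcap_measurable; first exact: finite_seq.
by move=> i _; exact: measurable_pre.
Qed.

Lemma cylinder_nil A : cylinder [::] A = setT.
Proof. by apply/seteqP; split => // t _ i. Qed.

(** A condition on the weight [i] together with a cylinder over [D'] is a cylinder over [D], because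
    [D'] omits [i]; the product formula for [D] then splits off the factor of [i]. *)
Lemma fresh_edge i (mu : set mR -> \bar R) D D' :
  (forall C, measurable C -> P (W i @^-1` C) = mu C) ->
  D i -> (forall j, D' j -> D j && (j != i)) -> fresh (W i : T -> mR) mu D D'.
Proof.
move=> Wmu Di D'D E mE EI C mC s A us sD mA.
have is_ : i \notin s by apply/negP => /(allP sD) /D'D; rewrite eqxx andbF.
pose A' j := if j == i then C else A j.
have mA' j : measurable (A' j) by rewrite /A'; case: ifP => _; [exact: mC|exact: mA].
have A'i : A' i = C by rewrite /A' eqxx.
have A's j : j \in s -> A' j = A j.
  by move=> js; rewrite /A'; case: eqP => // ji; rewrite -ji js in is_.
have := EI (i :: s) A'; rewrite /= us is_ Di => /(_ isT).
have -> : all D s by apply/allP => j /(allP sD) /D'D /andP[].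
move=> /(_ isT mA'); rewrite /weight big_cons A'i Wmu// muleA.
under eq_big_seq => j js do rewrite A's//.
move=> <-; congr (P _); rewrite -setIA; congr (_ `&` _).
apply/seteqP; split => t.
- move=> [Ct st] j; rewrite /= inE => /orP[/eqP ->|js]; first by rewrite A'i.
  by rewrite A's//; exact: st.
- move=> h; split; first by have := h i; rewrite /= inE eqxx A'i; exact.
  by move=> j js; have := h j; rewrite /= inE (A's _ js) js orbT; exact.
Qed.

Lemma weight_fin s A : (forall i, measurable (A i)) ->
  (0 <= weight s A)%E /\ weight s A \is a fin_num.
Proof.
move=> mA; rewrite /weight; split; first by apply: prode_ge0 => i _; exact: measure_ge0.
elim: s => [|i s IH]; first by rewrite big_nil.
by rewrite big_cons fin_numM//; apply: fin_num_measure; exact: measurable_pre.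
Qed.

Lemma indep_eventI d' (S : measurableType d') (U : T -> S) mu D D' E C :
  fresh U mu D D' -> measurable E -> indep_event D E -> measurable C ->
  P (E `&` U @^-1` C) = (P E * mu C)%E /\ indep_event D' (E `&` U @^-1` C).
Proof.
move=> fU mE EI mC.
have e : P (E `&` U @^-1` C) = (P E * mu C)%E.
  have := @fU E mE EI C mC [::] (fun=> setT) isT isT (fun=> measurableT).
  by rewrite cylinder_nil setIT /weight big_nil mule1.
by split => // s A us sD mA; rewrite (fU _ mE EI _ mC _ _ us sD mA) e.
Qed.

(** On a rectangle the two hypotheses apply in turn, the event [E] being first cut down by the
    condition on [U1]. Both sides are finite measures in [C], so rectangles determine them. *)
Lemma fresh_pair d1 d2 (S1 : measurableType d1) (S2 : measurableType d2)
    (U1 : T -> S1) (U2 : T -> S2) (mu1 : probability S1 R) (mu2 : probability S2 R) D D1 D2 :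
  measurable_fun setT U1 -> measurable_fun setT U2 ->
  fresh U1 mu1 D D1 -> fresh U2 mu2 D1 D2 ->
  fresh (fun t => (U1 t, U2 t)) (mu1 \x mu2)%E D D2.
Proof.
move=> mU1 mU2 f1 f2 E mE EI C mC s A us sD mA.
have mU : measurable_fun setT (fun t => (U1 t, U2 t)) by exact: measurable_fun_pair.
have mcyl := measurable_cylinder s mA.
have mEc : measurable (E `&` cylinder s A) by exact: measurableI.
have [w0 wfin] := weight_fin s mA.
have c0 : 0 <= fine (P E * weight s A)%E by rewrite fine_ge0// mule_ge0.
have cfin : (P E * weight s A)%E \is a fin_num.
  by rewrite fin_numM//; exact: fin_num_measure.
pose m1f : {measure set (S1 * S2) -> \bar R} :=
  pushforward (mrestr P mEc) (fun t => (U1 t, U2 t)).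
pose m1 := m1f mU.
have m1E B : m1 B = P ((fun t => (U1 t, U2 t)) @^-1` B `&` (E `&` cylinder s A)) by [].
pose m2 : {measure set (S1 * S2) -> \bar R} := mscale (NngNum c0) (mu1 \x mu2)%E.
have -> : P (E `&` (fun t => (U1 t, U2 t)) @^-1` C `&` cylinder s A) = m1 C.
  by rewrite m1E; congr (P _); apply/seteqP; split => t /=; tauto.
have m2E B : m2 B = ((fine (P E * weight s A))%:E * (mu1 \x mu2) B)%E by [].
have -> : (P E * (mu1 \x mu2) C * weight s A)%E = m2 C.
  by rewrite m2E fineK// muleAC.
apply: measure_eq_rectangles => //.
- rewrite m1E preimage_setT setTI.
  by apply: le_lt_trans (probability_le1 _ _) _; rewrite ?ltry.
- move=> A1 A2 mA1 mA2.
  have [e1 i1] := indep_eventI f1 mE EI mA1.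
  have mE1 : measurable (E `&` U1 @^-1` A1).
    by apply: measurableI => //; rewrite -[X in measurable X]setTI; exact: mU1.
  have := f2 _ mE1 i1 _ mA2 _ _ us sD mA; rewrite e1 => e2.
  rewrite m1E m2E product_measure1E// fineK//.
  rewrite muleAC muleA -e2; congr (P _); apply/seteqP; split => t /=; tauto.
Qed.

Definition indep_variable d' (S : measurableType d') D (V : T -> S) : Prop :=
  forall B, measurable B -> indep_event D (V @^-1` B).

Section variable_and_fresh.
Context d1 d2 (S1 : measurableType d1) (S2 : measurableType d2).
Variables (V : T -> S1) (U : T -> S2) (mu : probability S2 R) (D D' : pred I).
Hypotheses (mV : measurable_fun setT V) (mU : measurable_fun setT U).
Hypotheses (VD : indep_variable D V) (UD : fresh U mu D D').

Let mVpre B : measurable B -> measurable (V @^-1` B).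
Proof. by move=> mB; rewrite -[X in measurable X]setTI; exact: mV. Qed.

Let mVU : measurable_fun setT (fun t => (V t, U t)).
Proof. exact: measurable_fun_pair. Qed.

Definition mfun_of d' (S : measurableType d') (f : T -> S) (mf : measurable_fun setT f) :
  {mfun T >-> S} := HB.pack f (isMeasurableFun.Build _ _ _ _ f mf).

Lemma law_pair C : measurable C ->
  (distribution P (mfun_of mV) \x mu)%E C = P ((fun t => (V t, U t)) @^-1` C).
Proof.
move=> mC; pose m1f : {measure set (S1 * S2) -> \bar R} := pushforward P (fun t => (V t, U t)).
rewrite (@product_measure_unique _ _ _ _ _ _ _ (m1f mVU))// => A B mA mB.
have [e _] := indep_eventI UD (mVpre mA) (VD mA) mB.
exact: e.
Qed.

Lemma indep_variable_pair : indep_variable D' (fun t => (V t, U t)).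
Proof.
move=> C mC s A us sD mA.
have mcyl := measurable_cylinder s mA; have [w0 wfin] := weight_fin s mA.
have c0 : 0 <= fine (weight s A) by rewrite fine_ge0.
pose m1f : {measure set (S1 * S2) -> \bar R} :=
  pushforward (mrestr P mcyl) (fun t => (V t, U t)).
pose m1 := m1f mVU.
pose m2f : {measure set (S1 * S2) -> \bar R} := pushforward P (fun t => (V t, U t)).
pose m2 : {measure set (S1 * S2) -> \bar R} := mscale (NngNum c0) (m2f mVU).
have m1E B : m1 B = P ((fun t => (V t, U t)) @^-1` B `&` cylinder s A) by [].
have m2E B : m2 B = ((fine (weight s A))%:E * P ((fun t => (V t, U t)) @^-1` B))%E by [].
rewrite -m1E muleC -(fineK wfin) -m2E.
apply: measure_eq_rectangles => //.
- rewrite m1E preimage_setT setTI.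
  by apply: le_lt_trans (probability_le1 _ _) _; rewrite ?ltry.
- move=> A1 A2 mA1 mA2; rewrite m1E m2E fineK// muleC.
  have [_ i1] := indep_eventI UD (mVpre mA1) (VD mA1) mA2.
  exact: (i1 s A us sD mA).
Qed.

(** By [law_pair] the joint law is a product, so Fubini integrates out the fresh variable: this is
    the Markov property in integrated form. *)
Lemma Rintegral_fresh (Psi : S1 * S2 -> R) (g : S2 -> R) (c : R) :
  measurable_fun [set: S1 * S2] Psi -> intg mu g ->
  (forall v u, `|Psi (v, u)| <= c * g u) ->
  intg P (fun t => Psi (V t, U t)) /\
  \int[P]_t Psi (V t, U t) = \int[P]_t \int[mu]_u Psi (V t, u).
Proof.
move=> mPsi ig Pg.
pose PV : probability S1 R := distribution P (mfun_of mV).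
have ic := intg_cst PV c.
have iprod := intg_prod mPsi ic ig Pg.
split.
  have h := (law_intg mVU law_pair mPsi).
  exact: h.1 iprod.
rewrite -(law_Rintegral mVU law_pair iprod) (Rintegral_prod mPsi ic ig Pg).
have PVE (B : set S1) : measurable B -> PV B = P (V @^-1` B) by [].
exact: (law_Rintegral mV PVE (intg_Rintegral1 mPsi ic ig Pg)).
Qed.

End variable_and_fresh.

Lemma indep_variable_comp d1 d2 (S1 : measurableType d1) (S2 : measurableType d2)
    (V : T -> S1) (G : S1 -> S2) D :
  measurable_fun setT G -> indep_variable D V -> indep_variable D (fun t => G (V t)).
Proof.
move=> mG VD B mB; apply: (VD (G @^-1` B)).
by rewrite -[X in measurable X]setTI; exact: mG.
Qed.

Lemma mutually_independent_setT : mutually_independent W -> indep_event predT setT.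
Proof. by move=> WI s A us _ mA; rewrite setTI probability_setT mul1e; exact: WI. Qed.

End independence.

(** * The Markov chain carried by the edge weights *)

Section ladder_chain.
Context d (T : measurableType d) (R : realType) (P : probability T R).
Variable W : ladder_edge -> {RV P >-> R}.
Hypothesis W_indep : mutually_independent W.
Hypothesis W_law : forall (e : ladder_edge) (A : set R), measurable A ->
  distribution P (W e) A = exponential_prob 1 A.
Notation mR := (measurableTypeR R).
Notation NT := (mR * mR * mR)%type.

(** The edges not yet read at time $k$. The inequality is strict for rungs because $Z_k$ already
    enters $\Delta_k$, while the rails leaving column $k$ are still unread. *)
Definition later (k : nat) : pred ladder_edge := fun e =>
  match e with inl (i, _) => (k <= i)%N | inr i => (k < i)%N end.

Definition chain k (t : T) : mR * mR :=
  (passage (fun e => W e t) k false, delta (fun e => W e t) k).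

Definition chain_column k (t : T) : NT := column (fun e => W e t) k.

Definition chain_map (p : mR * mR * NT) : mR * mR :=
  (p.1.1 + ladder_f (p.1.2, p.2), delta_step (p.1.2, p.2)).

Lemma chainS k t : chain k.+1 t = chain_map (chain k t, chain_column k t).
Proof. by rewrite /chain passageS. Qed.

Lemma measurable_chain_map : measurable_fun [set: mR * mR * NT] chain_map.
Proof.
have m12 : measurable_fun [set: mR * mR * NT] (fun p => (p.1.2, p.2)).
  apply: measurable_fun_pair; last exact: measurable_snd.
  exact: measurableT_comp measurable_snd measurable_fst.
apply: measurable_fun_pair.
- apply: measurable_funD; first exact: measurableT_comp measurable_fst measurable_fst.
  exact: measurableT_comp (@measurable_ladder_f R) m12.
- exact: measurableT_comp (@measurable_delta_step R) m12.
Qed.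

Let mW e : measurable_fun [set: T] (W e : T -> mR).
Proof. exact: (@measurable_funP _ _ _ _ _ (W e)). Qed.

Lemma measurable_chain_column k : measurable_fun [set: T] (chain_column k).
Proof. by do 2 apply: measurable_fun_pair => //. Qed.

Let W_exp1 e C : measurable C -> P (W e @^-1` C) = exp1 R C.
Proof. exact: W_law. Qed.

(** The column is read edge by edge; removing two rails and one rung from [later k] leaves all of
    [later k.+1]. *)
Lemma fresh_column k : fresh W (chain_column k) (noise R) (later k) (later k.+1).
Proof.
pose D1 := predI (later k) (predC1 (rail k false)).
pose D2 := predI D1 (predC1 (rail k true)).
have f1 : fresh W (W (rail k false) : T -> mR) (exp1 R) (later k) D1.
  apply: fresh_edge; [by move=> C; exact: W_exp1|by rewrite /= leqnn|by []].
have f2 : fresh W (W (rail k true) : T -> mR) (exp1 R) D1 D2.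
  apply: fresh_edge; [by move=> C; exact: W_exp1|by rewrite /= leqnn; apply/eqP => -[]|by []].
have f3 : fresh W (W (rung k.+1) : T -> mR) (exp1 R) D2 (later k.+1).
  apply: fresh_edge; [by move=> C; exact: W_exp1|by rewrite /= ltnS leqnn|].
  move=> [[i b]|i] /= ki.
  - rewrite (ltnW ki) andbT /=; apply/andP; split; apply/eqP => -[] ik _;
      by rewrite ik ltnn in ki.
  - by rewrite (ltnW ki) /=; apply/eqP => -[] ik; rewrite ik ltnn in ki.
have mXY : measurable_fun setT (fun t => (W (rail k false) t : mR, W (rail k true) t : mR)).
  exact: measurable_fun_pair.
have f12 := fresh_pair (mW _) (mW _) f1 f2.
exact: (fresh_pair (mu1 := @noise_xy R) mXY (mW _) f12 f3).
Qed.

Lemma chain_indep k : measurable_fun [set: T] (chain k) /\ indep_variable W (later k) (chain k).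
Proof.
elim: k => [|k [mk ik]].
- have mG : measurable_fun [set: mR] (fun r : mR => (0, r) : mR * mR).
    exact: measurable_fun_pair.
  split; first exact: (measurableT_comp mG (mW (rung 0))).
  apply: (indep_variable_comp (V := W (rung 0) : T -> mR) mG) => B mB.
  rewrite -[X in indep_event _ _ X]setTI.
  apply: (indep_eventI (mu := exp1 R) (D := predT) _ _ (mutually_independent_setT W_indep) mB).2 => //.
  apply: fresh_edge; [by move=> C; exact: W_exp1|by []|].
  by move=> [[i b]|[|i]].
- have mc := measurable_chain_column k.
  have e : chain k.+1 = fun t => chain_map (chain k t, chain_column k t).
    by apply/funext => t; exact: chainS.
  rewrite e; split.
    apply: (measurableT_comp measurable_chain_map); exact: measurable_fun_pair.
  apply: (indep_variable_comp (V := fun t => (chain k t, chain_column k t)) measurable_chain_map).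
  exact: (indep_variable_pair mk mc ik (@fresh_column k)).
Qed.

Lemma chain_markov k (Psi : mR * mR * NT -> R) c :
  measurable_fun setT Psi -> (forall v w, `|Psi (v, w)| <= c * noise_dom w) ->
  intg P (fun t => Psi (chain k t, chain_column k t)) /\
  \int[P]_t Psi (chain k t, chain_column k t) = \int[P]_t \int[noise R]_w Psi (chain k t, w).
Proof.
move=> mPsi Pc; have [mk ik] := chain_indep k.
exact: (Rintegral_fresh mk (measurable_chain_column k) ik (@fresh_column k) mPsi (@intg_noise_dom R) Pc).
Qed.

End ladder_chain.

Lemma integral_lebesgue_shift (R : realType) (c : R) (f : R -> \bar R) :
  measurable_fun [set: R] f -> (forall x, (0 <= f x)%E) ->
  (\int[lebesgue_measure]_x f x = \int[lebesgue_measure]_x f (x + c)%R)%E.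
Proof.
move=> mf f0; pose sh : measurableTypeR R -> measurableTypeR R := fun x => x + c.
have mc : measurable_fun setT sh by exact: measurable_funD.
pose m1f : {measure set (measurableTypeR R) -> \bar R} := pushforward (@lebesgue_measure R) sh.
have h (A : set (measurableTypeR R)) : measurable A ->
    @lebesgue_measure R A = @lebesgue_measure R (sh @^-1` A).
  move=> mA; apply: (@lebesgue_measure_unique _ (m1f mc)) => // _ [[a b]] _ <-.
  have -> : m1f mc `](a, b).1, (a, b).2]%classic = @lebesgue_measure R `](a - c), (b - c)]%classic.
    rewrite /m1f /= /pushforward; congr (lebesgue_measure _).
    by apply/seteqP; split => x /=; rewrite !in_itv/= ltrBlDr lerBrDr.
  by rewrite !lebesgue_measure_itv/= !lte_fin ltrD2r -!EFinD opprB addrA subrK.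
exact: (law_integralE mc h mf f0).
Qed.

(** * Gaussian laws *)

Section gaussian.
Context {R : realType}.
Notation mu := (@lebesgue_measure R).
Notation mR := (measurableTypeR R).
Implicit Types (s t x y : R).

Definition gauss s : probability mR R := normal_prob 0 s.
Arguments gauss : simpl never.

Lemma gaussE s A : measurable A ->
  gauss s A = (\int[mu]_(x in A) (normal_pdf 0 s x)%:E)%E.
Proof. by []. Qed.

Lemma normal_pdf_exp m s x : s != 0 ->
  normal_pdf m s x = normal_peak s * expR (- (x - m) ^+ 2 / (s ^+ 2 *+ 2)).
Proof. by move=> s0; rewrite normal_pdfE. Qed.

Let peak_alg (p s t r : R) : r != 0 ->
  t ^+ 2 * p *+ 2 * (s ^+ 2 * p *+ 2) = r ^+ 2 * p *+ 2 * ((s * t / r) ^+ 2 * p *+ 2).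
Proof. by move=> r0; field. Qed.

Let exponent_alg (s t x y r2 : R) : s != 0 -> t != 0 -> r2 != 0 -> r2 = s ^+ 2 + t ^+ 2 ->
  - (x - y) ^+ 2 / (t ^+ 2 *+ 2) + - y ^+ 2 / (s ^+ 2 *+ 2) =
  - x ^+ 2 / (r2 *+ 2) + - (y - x * s ^+ 2 / r2) ^+ 2 / (s ^+ 2 * t ^+ 2 / r2 *+ 2).
Proof.
move=> s0 t0 r0 r2E; have r0' : s ^+ 2 + t ^+ 2 != 0 by rewrite -r2E.
by rewrite r2E; field; rewrite s0 t0 r0'.
Qed.

(** Completing the square in $y$: the joint density is the density of the sum at $x$ times the
    conditional density of $y$, which is Gaussian with mean $xs^2/r^2$ and deviation $st/r$. *)
Lemma normal_pdf_convolution s t x y : 0 < s -> 0 < t ->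
  let r := Num.sqrt (s ^+ 2 + t ^+ 2) in
  normal_pdf 0 t (x - y) * normal_pdf 0 s y =
  normal_pdf 0 r x * normal_pdf (x * s ^+ 2 / r ^+ 2) (s * t / r) y.
Proof.
move=> s0 t0 r.
have r2 : r ^+ 2 = s ^+ 2 + t ^+ 2 by rewrite sqr_sqrtr// addr_ge0 ?sqr_ge0.
have r0 : 0 < r by rewrite sqrtr_gt0 ltr_pwDl ?exprn_gt0// sqr_ge0.
rewrite !normal_pdf_exp ?lt0r_neq0 ?divr_gt0 ?mulr_gt0//.
rewrite mulrACA [RHS]mulrACA; congr (_ * _).
  rewrite /normal_peak -!invfM -!sqrtrM ?mulrn_wge0 ?mulr_ge0 ?sqr_ge0 ?pi_ge0 ?ltW//.
  by rewrite (@peak_alg pi s t r)// lt0r_neq0.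
rewrite -!expRD; congr expR; rewrite !subr0 exprMn exprVn exprMn.
apply: exponent_alg => //; rewrite ?lt0r_neq0// ?exprn_gt0//.
Qed.

Let mpdf m s : measurable_fun [set: R] (normal_pdf m s).
Proof. exact: measurable_normal_pdf. Qed.

Let mpdfE m s : measurable_fun [set: R] (fun x => (normal_pdf m s x)%:E).
Proof. exact/measurable_EFinP. Qed.

Lemma ge0_integral_gauss s (f : R -> \bar R) : measurable_fun [set: R] f ->
  (forall x, (0 <= f x)%E) ->
  (\int[gauss s]_x f x = \int[mu]_x (f x * (normal_pdf 0 s x)%:E))%E.
Proof.
move=> mf f0; apply: ge0_integral_density => //.
- exact: mpdf.
- by move=> x; exact: normal_pdf_ge0.
Qed.

(** After a translation and Tonelli, the conditional density of [normal_pdf_convolution] integrates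
    to $1$ and only the density of the sum remains. *)
Lemma gauss_convolution s t (A : set mR) : 0 < s -> 0 < t -> measurable A ->
  gauss (Num.sqrt (s ^+ 2 + t ^+ 2)) A =
  (gauss s \x gauss t)%E ((fun p : mR * mR => p.1 + p.2) @^-1` A).
Proof.
move=> s0 t0 mA; set r := Num.sqrt _; set X := _ @^-1` A.
have madd : measurable_fun [set: mR * mR] (fun p : mR * mR => p.1 + p.2).
  exact: measurable_funD.
have mX : measurable X by rewrite -[X in measurable X]setTI; exact: madd.
have m1 : measurable_fun [set: mR] (fun x : mR => (\1_A x)%:E : \bar R).
  exact/measurable_EFinP.
have msec y : measurable_fun [set: mR] (fun z : mR => (\1_A (y + z))%:E : \bar R).
  by apply/measurable_EFinP; apply: (measurableT_comp (measurable_indic mA)); exact: measurable_funD.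
rewrite -[RHS](_ : \int[(gauss s \x gauss t)%E]_p (\1_A (p.1 + p.2))%:E = _)%E; last first.
  by rewrite -(setIT X) -integral_indic.
rewrite fubini_tonelli1//; last first.
  by apply/measurable_EFinP; apply: (measurableT_comp (measurable_indic mA)).
rewrite /fubini_F.
have mpair : measurable_fun [set: mR * mR] (fun p : mR * mR =>
    (\1_A p.2 * (normal_pdf 0 t (p.2 - p.1) * normal_pdf 0 s p.1))%:E : \bar R).
  apply/measurable_EFinP; apply: measurable_funM.
    exact: (measurableT_comp (measurable_indic mA)).
  apply: measurable_funM; last exact: (measurableT_comp (mpdf 0 s)).
  by apply: (measurableT_comp (mpdf 0 t)); exact: measurable_funB.
transitivity (\int[mu]_y \int[mu]_x
    (\1_A x * (normal_pdf 0 t (x - y) * normal_pdf 0 s y))%:E)%E; last first.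
  rewrite ge0_integral_gauss//; last 2 first.
  - have mp : measurable_fun [set: mR * mR] (fun p : mR * mR => (\1_A (p.1 + p.2))%:E : \bar R).
      by apply/measurable_EFinP; apply: (measurableT_comp (measurable_indic mA)).
    have p0 (p : mR * mR) : (0 <= (\1_A (p.1 + p.2))%:E :> \bar R)%E by rewrite lee_fin.
    exact: (@measurable_fun_fubini_tonelli_F _ _ _ _ _ (gauss t) _ mp p0).
  - by move=> y; apply: integral_ge0 => z _; rewrite lee_fin.
  apply: eq_integral => y _.
  have mz : measurable_fun [set: R] (fun z => (\1_A (y + z) * normal_pdf 0 t z)%:E).
    apply/measurable_EFinP; apply: measurable_funM; last exact: mpdf.
    by apply/measurable_EFinP; exact: msec.
  have p0 z : (0 <= (\1_A (y + z))%:E :> \bar R)%E by rewrite lee_fin.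
  transitivity (\int[gauss t]_z (\1_A (y + z))%:E * (normal_pdf 0 s y)%:E)%E; last by [].
  rewrite (ge0_integral_gauss t (msec y) p0).
  transitivity (\int[mu]_z ((\1_A (y + z) * normal_pdf 0 t z)%:E * (normal_pdf 0 s y)%:E))%E.
    rewrite (integral_lebesgue_shift y); last 2 first.
    + have := measurableT_comp mpair (measurable_pair1 y); exact.
    + by move=> x; rewrite lee_fin !mulr_ge0 ?normal_pdf_ge0.
    by apply: eq_integral => z _; rewrite addrK [z + y]addrC mulrA EFinM.
  rewrite ge0_integralZr//.
  - by move=> z _; rewrite lee_fin mulr_ge0 ?normal_pdf_ge0.
  - by rewrite lee_fin normal_pdf_ge0.
rewrite (@fubini_tonelli _ _ _ _ _ mu mu (fun p : mR * mR =>
    (\1_A p.2 * (normal_pdf 0 t (p.2 - p.1) * normal_pdf 0 s p.1))%:E : \bar R))//; last first.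
  by move=> p; rewrite lee_fin !mulr_ge0 ?normal_pdf_ge0.
rewrite gaussE// integral_mkcond; apply: eq_integral => x _.
transitivity (\int[mu]_y ((\1_A x * normal_pdf 0 r x)%:E *
    (normal_pdf (x * s ^+ 2 / r ^+ 2) (s * t / r) y)%:E))%E; last first.
  by apply: eq_integral => y _; rewrite (normal_pdf_convolution _ _ s0 t0) mulrA EFinM.
rewrite ge0_integralZl//; last 3 first.
- exact: mpdfE.
- by move=> y _; rewrite lee_fin normal_pdf_ge0.
- by rewrite lee_fin mulr_ge0 ?normal_pdf_ge0.
by rewrite integral_normal_pdf mule1 patchE indicE; case: ifP; rewrite ?mul1r ?mul0r.
Qed.

Let exp_dom (q : R) : 0 <= q -> [/\ q <= expR q, 4 * q <= 16 * expR q & 4 * q + 4 * q ^+ 2 <= 16 * expR q].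
Proof.
move=> q0; have h : (1 + q / 2) ^+ 2 <= expR q.
  rewrite -[X in expR X](_ : q / 2 + q / 2 = _); last lra.
  by rewrite expRD -expr2 lerXn2r ?nnegrE ?expR_ge1Dx ?expR_ge0//; lra.
have q2 := sqr_ge0 q; move: h; rewrite sqrrD expr1n mul1r exprMn.
by move: (expR q) => E h; split; lra.
Qed.

Let pow_dom (a : R) k : 0 <= a -> (k <= 3)%N -> a ^+ k <= 16 * expR (a ^+ 2 / 4).
Proof.
move=> a0 k3; have q0 : 0 <= a ^+ 2 / 4 by rewrite divr_ge0// sqr_ge0.
have [h1 h2 h3] := exp_dom q0.
have e1 : 1 <= expR (a ^+ 2 / 4) by rewrite -[leLHS]expR0 ler_expR.
have a1 : a <= 1 + a ^+ 2 / 4 by have := sqr_ge0 (1 - a / 2); rewrite sqrrB exprMn; lra.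
case: k k3 => [|[|[|[|//]]]] _.
- by rewrite expr0; lra.
- by rewrite expr1; lra.
- by lra.
- rewrite exprS; apply: le_trans (ler_wpM2r (sqr_ge0 a) a1) _; apply: le_trans h3.
  by move: (a ^+ 2) => b; rewrite mulrDl mul1r; lra.
Qed.

(* A Gaussian majorant of the polynomials of degree 3 in y/s. *)
Definition gauss_dom s y : R := 16 * expR ((y / s) ^+ 2 / 4).

Lemma norm_gauss_dom s y k : 0 < s -> (k <= 3)%N -> `|y| ^+ k <= s ^+ k * gauss_dom s y.
Proof.
move=> s0 k3; have -> : `|y| = s * `|y / s|.
  by rewrite normrM normfV (gtr0_norm s0) mulrC divfK// gt_eqF.
rewrite exprMn ler_wpM2l ?exprn_ge0 ?(ltW s0)// /gauss_dom.
by rewrite -(real_normK (num_real (y / s))) pow_dom.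
Qed.

Lemma measurable_gauss_dom s : measurable_fun [set: R] (gauss_dom s).
Proof.
apply: measurable_funM => //; apply: measurableT_comp => //.
by apply: measurable_funM => //; apply: measurable_funX; exact: measurable_funM.
Qed.

(** The factor $e^{(y/s)^2/4}$ doubles the variance: the integrand is $16\sqrt2$ times the density
    of deviation $\sqrt2\,s$. This is the constant of the later Gaussian bounds. *)
Lemma intg_gauss_dom s : 0 < s ->
  intg (gauss s) (gauss_dom s) /\ \int[gauss s]_y gauss_dom s y = 16 * Num.sqrt 2.
Proof.
move=> s0; pose r := Num.sqrt 2 * s.
have r0 : 0 < r by rewrite mulr_gt0// sqrtr_gt0.
have E : (\int[gauss s]_y (gauss_dom s y)%:E = (16 * Num.sqrt 2)%:E)%E.
  rewrite ge0_integral_gauss//; last 2 first.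
  - apply/measurable_EFinP; exact: measurable_gauss_dom.
  - by move=> y; rewrite lee_fin mulr_ge0 ?expR_ge0.
  transitivity (\int[mu]_y ((16 * Num.sqrt 2)%:E * (normal_pdf 0 r y)%:E))%E.
    apply: eq_integral => y _; rewrite -!EFinM; congr (_%:E).
    rewrite !normal_pdf_exp ?lt0r_neq0// /gauss_dom !subr0.
    have -> : normal_peak s = Num.sqrt 2 * normal_peak r.
      rewrite /normal_peak /r exprMn sqr_sqrtr// -[Num.sqrt 2]invrK -invfM; congr (_ ^-1).
      rewrite (_ : 2 * s ^+ 2 * pi *+ 2 = 2 * (s ^+ 2 * pi *+ 2)); last first.
        by move: (pi : R) => p; ring.
      by rewrite sqrtrM// mulKf// gt_eqF// sqrtr_gt0.
    have -> : expR (- y ^+ 2 / (r ^+ 2 *+ 2)) =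
        expR ((y / s) ^+ 2 / 4) * expR (- y ^+ 2 / (s ^+ 2 *+ 2)).
      rewrite -expRD; congr expR; rewrite /r exprMn sqr_sqrtr//; field.
      exact: lt0r_neq0.
    by move: (normal_peak r) (Num.sqrt 2) (expR _) (expR _) => a b c e; ring.
  rewrite ge0_integralZl//; last 2 first.
  - exact: mpdfE.
  - by move=> y _; rewrite lee_fin normal_pdf_ge0.
  by rewrite integral_normal_pdf mule1.
split; last by rewrite /Rintegral E.
apply/integrableP; split; first by apply/measurable_EFinP; exact: measurable_gauss_dom.
under eq_integral do rewrite /= ger0_norm ?mulr_ge0 ?expR_ge0//.
by rewrite E ltry.
Qed.

Lemma intg_gauss s (f : R -> R) (c : R) k : 0 < s -> (k <= 3)%N -> measurable_fun [set: R] f ->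
  (forall y, `|f y| <= c * `|y| ^+ k) ->
  intg (gauss s) f /\ `|\int[gauss s]_y f y| <= c * s ^+ k * (16 * Num.sqrt 2).
Proof.
move=> s0 k3 mf fc; have [id <-] := intg_gauss_dom s0.
have c0 : 0 <= c by have := le_trans (normr_ge0 _) (fc 1); rewrite normr1 expr1n mulr1.
have fd y : `|f y| <= c * s ^+ k * gauss_dom s y.
  by apply: le_trans (fc y) _; rewrite -mulrA ler_wpM2l// norm_gauss_dom.
have iz := intgZ (c * s ^+ k) id.
split; first exact: (@intg_dom _ mR _ _ _ f mf iz fd).
by rewrite -(RintegralZl _ measurableT id); exact: le_norm_Rintegral.
Qed.

Lemma gauss_mean0 s : 0 < s -> \int[gauss s]_y y = 0.
Proof.
move=> s0; have mN : measurable_fun [set: mR] (-%R : mR -> mR) by exact: oppr_measurable.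
have hid (y : R) : `|id y| <= 1 * `|y| ^+ 1 by rewrite expr1 mul1r.
have [i _] := @intg_gauss s id 1 1 s0 isT (@measurable_id _ _ _) hid.
have sym (A : set mR) : measurable A -> gauss s A = gauss s ((-%R : mR -> mR) @^-1` A).
  move=> mA; have mA' : measurable ((-%R : mR -> mR) @^-1` A).
    by rewrite -[X in measurable X]setTI; exact: mN.
  transitivity (\int[mu]_(x in A) (normal_pdf 0 s x)%:E)%E; first by [].
  transitivity (\int[mu]_(x in (-%R : mR -> mR) @^-1` A) (normal_pdf 0 s x)%:E)%E; last by [].
  rewrite [LHS]integral_mkcond [RHS]integral_mkcond -[LHS]integral_lebesgueN.
  - apply: eq_integral => y _; rewrite !patchE.
    have -> : (- y \in A) = (y \in (-%R : mR -> mR) @^-1` A) by [].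
    case: ifP => // _; congr (_%:E).
    by rewrite /normal_pdf /normal_fun !subr0 sqrrN; case: ifP => // /eqP s0'; move: s0; rewrite s0' ltxx.
  - exact: ((measurable_restrictT _ mA).1 (measurable_funTS (mpdfE 0 s))).
  - by move=> y; rewrite patchE; case: ifP => // _; rewrite lee_fin normal_pdf_ge0.
have := law_Rintegral mN sym i.
have -> : \int[gauss s]_x - x = - \int[gauss s]_x x.
  have := RintegralZl (-1) measurableT i; rewrite [RHS]mulN1r => <-.
  by apply: eq_Rintegral => x _; rewrite mulN1r.
by move: (\int[gauss s]_x x) => c h; lra.
Qed.

Let dpdf s (x : R^o) : s != 0 ->
  is_derive x 1 (fun u : R => - (s ^+ 2 * normal_pdf 0 s u)) (x * normal_pdf 0 s x).
Proof.
move=> s0; under eq_fun do rewrite normal_pdf_exp// /normal_fun subr0.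
rewrite normal_pdf_exp// /normal_fun subr0.
apply: is_derive_eq; rewrite /GRing.scale/= .
by move: (normal_peak s) (expR _) => a b; field.
Qed.

Let cvg_pdf s : 0 < s -> normal_pdf 0 s u @[u --> +oo%R] --> (0 : R).
Proof.
move=> s0; have s0' : s != 0 by rewrite gt_eqF.
have c : 0 < 1 / (s ^+ 2 *+ 2) by rewrite divr_gt0// mulrn_wgt0// exprn_gt0.
have h := @cvg_expRN_pinfty R _ c.
have h2 : normal_peak s * expR (- (1 / (s ^+ 2 *+ 2)) * u) @[u --> +oo] --> normal_peak s * 0.
  by apply: cvgMr.
rewrite mulr0 in h2.
apply: (squeeze_cvgr _ (cvg_cst 0) h2).
near=> u; rewrite normal_pdf_ge0/= normal_pdf_exp// ler_wpM2l ?normal_peak_ge0// ler_expR subr0.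
rewrite mulNr mulNr lerN2 mul1r [leLHS]mulrC ler_wpM2r ?invr_ge0 ?mulrn_wge0 ?sqr_ge0//.
have u1 : 1 <= u by near: u; exact: nbhs_pinfty_ge.
by rewrite expr2 ler_peMl// (le_trans ler01).
Unshelve. all: by end_near. Qed.

Let tail_pdf s a : 0 < s -> 0 <= a ->
  (\int[mu]_(u in `[a, +oo[) (u * normal_pdf 0 s u)%:E = (s ^+ 2 * normal_pdf 0 s a)%:E)%E.
Proof.
move=> s0 a0; have s0' : s != 0 by rewrite gt_eqF.
rewrite (@ge0_continuous_FTC2y _ _ (fun u => - (s ^+ 2 * normal_pdf 0 s u)) _ 0).
- by rewrite sub0e -EFinN opprK.
- by move=> u au; rewrite mulr_ge0 ?normal_pdf_ge0// (le_trans a0).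
- apply: continuous_subspaceT => u; apply: cvgM; first exact: cvg_id.
  exact: continuous_normal_pdf.
- rewrite -[X in _ --> X](_ : - (s ^+ 2 * 0) = 0); last by rewrite mulr0 oppr0.
  apply: cvgN; apply: cvgMr; exact: cvg_pdf.
- by move=> u _; have [] := dpdf u s0'.
- apply: cvg_at_right_filter; exact: is_derive_continuous (dpdf a s0').
- by move=> u _; rewrite derive1E; have [_] := dpdf u s0'.
Qed.

Let pdf_even s : s != 0 -> forall x, normal_pdf 0 s (- x) = normal_pdf 0 s x.
Proof. by move=> s0 x; rewrite !normal_pdf_exp// !subr0 sqrrN. Qed.

Let half_pdf s : s != 0 -> (\int[mu]_(u in `[0%R, +oo[) (normal_pdf 0 s u)%:E = (1 / 2)%:E)%E.
Proof.
move=> s0; have := @integral_normal_pdf R 0 s.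
rewrite (integral_even_split (mpdfE 0 s)); last by move=> x; rewrite lee_fin normal_pdf_ge0.
under [X in (_ + X)%E]eq_integral do rewrite pdf_even//.
set J := integral _ _ _.
have J0 : (0 <= J)%E by apply: integral_ge0 => x _; rewrite lee_fin normal_pdf_ge0.
move: J J0 => [j| |]// _; rewrite -EFinD => -[] h; congr (_%:E); lra.
Qed.

(** Write $u^2=\int_0^u u\,dy$ and exchange integrals over the triangle $0\le y\le u$. By [tail_pdf]
    the inner integral is $s^2$ times the density at $y$, whose half-line mass is $1/2$. *)
Let half_moment s : 0 < s ->
  (\int[mu]_(u in `[0%R, +oo[) (u ^+ 2 * normal_pdf 0 s u)%:E = (s ^+ 2 / 2)%:E)%E.
Proof.
move=> s0; have s0' : s != 0 by rewrite gt_eqF.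
pose tri : set (mR * mR) := [set p | 0 <= p.1] `&` [set p | p.1 <= p.2].
have mtri : measurable tri.
  apply: measurableI.
    rewrite -[X in measurable X]setTI; apply: measurable_fun_le => //.
  rewrite -[X in measurable X]setTI; apply: measurable_fun_le => //.
pose h (p : mR * mR) : \bar R := (\1_tri p * (p.2 * normal_pdf 0 s p.2))%:E.
have mh : measurable_fun [set: mR * mR] h.
  apply/measurable_EFinP; apply: measurable_funM; first exact: measurable_indic.
  apply: measurable_funM => //; exact: (measurableT_comp (mpdf 0 s)).
have h0 p : (0 <= h p)%E.
  rewrite /h lee_fin indicE; case: (boolP (p \in tri)) => [|_]; last by rewrite mul0r.
  by rewrite inE => -[/= p1 p2]; rewrite mul1r mulr_ge0 ?normal_pdf_ge0// (le_trans p1).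
have := @fubini_tonelli _ _ _ _ _ mu mu h mh h0.
have -> : (\int[mu]_x \int[mu]_y h (x, y) = (s ^+ 2 / 2)%:E)%E.
  transitivity (\int[mu]_(y in `[0%R, +oo[) (s ^+ 2 * normal_pdf 0 s y)%:E)%E.
    rewrite [RHS]integral_mkcond; apply: eq_integral => y _; rewrite patchE.
    case: ifPn => [|yN].
      rewrite inE/= in_itv/= andbT => y0; rewrite -(tail_pdf s0 y0) [RHS]integral_mkcond.
      apply: eq_integral => u _; rewrite patchE /h indicE.
      have -> : ((y, u) \in tri) = (u \in `[y, +oo[%classic).
        by apply/idP/idP; rewrite !inE/= in_itv/= andbT; [case|split].
      by case: ifP; rewrite ?mul1r ?mul0r.
    apply: integral0_eq => u _; rewrite /h indicE memNset ?mul0r// => -[/= y0 _].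
    by move/negP : yN; apply; rewrite inE/= in_itv/= y0.
  under eq_integral do rewrite EFinM.
  rewrite ge0_integralZl_EFin; last 4 first.
  - exact: measurable_itv.
  - by move=> x _; rewrite lee_fin normal_pdf_ge0.
  - by apply: measurable_funTS; exact: mpdfE.
  - exact: sqr_ge0.
  by rewrite half_pdf// -EFinM; congr (_%:E); lra.
move=> ->; rewrite integral_mkcond; apply: eq_integral => u _; rewrite patchE.
case: ifPn => [|uN]; last first.
  rewrite integral0_eq// => y _; rewrite /h indicE memNset ?mul0r// => -[/= y0 yu].
  by move/negP : uN; apply; rewrite inE/= in_itv/= (le_trans y0 yu).
rewrite inE/= in_itv/= andbT => u0.
transitivity (\int[mu]_(y in `[0%R, u]) (u * normal_pdf 0 s u)%:E)%E; last first.
  rewrite [LHS]integral_mkcond; apply: eq_integral => y _; rewrite patchE /h indicE.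
  have -> : ((y, u) \in tri) = (y \in `[0%R, u]%classic).
    by apply/idP/idP; rewrite !inE/= in_itv/=; [move=> [/= -> ->]|move=> /andP[]].
  by case: ifP; rewrite ?mul1r ?mul0r.
rewrite integral_cst//= lebesgue_measure_itv/= lte_fin.
case: ltP => u0'; first by rewrite -EFinD subr0 -EFinM; congr (_%:E); ring.
have -> : u = 0 by apply/eqP; rewrite eq_le u0 u0'.
by rewrite mule0 expr0n/= mul0r.
Qed.

Lemma gauss_variance s : 0 < s -> \int[gauss s]_y y ^+ 2 = s ^+ 2.
Proof.
move=> s0; have s0' : s != 0 by rewrite gt_eqF.
rewrite /Rintegral ge0_integral_gauss; last 2 first.
- by apply/measurable_EFinP; exact: measurable_funX.
- by move=> y; rewrite lee_fin sqr_ge0.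
rewrite integral_even_split; last 2 first.
- apply: emeasurable_funM; last exact: mpdfE.
  by apply/measurable_EFinP; exact: measurable_funX.
- by move=> y; rewrite mule_ge0// lee_fin ?sqr_ge0 ?normal_pdf_ge0.
under [X in (_ + X)%E]eq_integral do rewrite pdf_even// sqrrN -EFinM.
under [X in (X + _)%E]eq_integral do rewrite -EFinM.
by rewrite half_moment// -EFinD /=; lra.
Qed.

End gaussian.

(** * The exchange argument *)

Section smoothing.
Context {R : realType}.
Notation mR := (measurableTypeR R).
Implicit Types (u : R -> R) (s t a k B C : R).
Notation gK := (16 * Num.sqrt 2 : R).

(** [u1] and [u2] stand for the first two derivatives but enter only through a uniform expansion
    with cubic remainder. In this form the class is stable under averaging over translations, with
    the same constants and without differentiation under the integral. *)
Definition taylor2 B C u u1 u2 : Prop :=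
  [/\ [/\ measurable_fun [set: R] u, measurable_fun [set: R] u1 & measurable_fun [set: R] u2],
      [/\ forall a, `|u a| <= B, forall a, `|u1 a| <= B & forall a, `|u2 a| <= B],
      forall a k, `|u (a + k) - u a| <= B * `|k|,
      forall a k, `|u2 (a + k) - u2 a| <= C * `|k| &
      forall a k, `|u (a + k) - u a - u1 a * k - u2 a / 2 * k ^+ 2| <= C * `|k| ^+ 3].

Definition smooth s u a : R := \int[gauss s]_y u (a + y).

Lemma smooth_bounded s u B : measurable_fun [set: R] u -> (forall a, `|u a| <= B) ->
  [/\ forall a, intg (gauss s) (fun y => u (a + y)), measurable_fun [set: R] (smooth s u) &
      forall a, `|smooth s u a| <= B].
Proof.
move=> mu uB.
have mua a : measurable_fun [set: mR] (fun y : mR => u (a + y)).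
  by apply: (measurableT_comp mu); exact: measurable_funD.
have mp : measurable_fun [set: mR * mR] (fun p : mR * mR => u (p.1 + p.2)).
  by apply: (measurableT_comp mu); exact: measurable_funD.
have i1 := intg_cst (gauss s) B; have i2 := intg_cst (gauss s) (1 : R).
split.
- by move=> a; apply: (@intg_bounded _ _ _ _ _ B) => // y.
- by apply: (measurable_Rintegral1 mp i1 i2) => x y; rewrite mulr1.
- by move=> a; exact: Rintegral_le_bound.
Qed.

Lemma smooth_lip s u B C : measurable_fun [set: R] u -> (forall a, `|u a| <= B) ->
  (forall a k, `|u (a + k) - u a| <= C * `|k|) ->
  forall a k, `|smooth s u (a + k) - smooth s u a| <= C * `|k|.
Proof.
move=> mu uB uC a k; have [iu _ _] := smooth_bounded s mu uB.
rewrite /smooth -(RintegralB measurableT (iu (a + k)) (iu a)).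
apply: Rintegral_le_bound; first exact: measurable_intg (intgB (iu (a + k)) (iu a)).
by move=> y; rewrite addrAC; exact: uC.
Qed.

Lemma smooth_taylor2 s B C u u1 u2 : taylor2 B C u u1 u2 ->
  taylor2 B C (smooth s u) (smooth s u1) (smooth s u2).
Proof.
move=> [[mu mu1 mu2] [uB u1B u2B] ul u2l ut].
have [iu msu suB] := smooth_bounded s mu uB.
have [iu1 msu1 su1B] := smooth_bounded s mu1 u1B.
have [iu2 msu2 su2B] := smooth_bounded s mu2 u2B.
split => //.
- exact: smooth_lip mu uB ul.
- exact: smooth_lip mu2 u2B u2l.
move=> a k.
have i1 := intgZ k (iu1 a); have i2 := intgZ (k ^+ 2 / 2) (iu2 a).
have i0 := intgB (iu (a + k)) (iu a); have i01 := intgB i0 i1.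
have -> : smooth s u (a + k) - smooth s u a - smooth s u1 a * k - smooth s u2 a / 2 * k ^+ 2 =
  \int[gauss s]_y (u (a + k + y) - u (a + y) - k * u1 (a + y) - k ^+ 2 / 2 * u2 (a + y)).
  rewrite (RintegralB measurableT i01 i2) (RintegralB measurableT i0 i1).
  rewrite (RintegralB measurableT (iu (a + k)) (iu a)).
  rewrite (RintegralZl _ measurableT (iu1 a)) (RintegralZl _ measurableT (iu2 a)).
  by rewrite /smooth; field.
apply: Rintegral_le_bound; first exact: measurable_intg (intgB i01 i2).
move=> y; have -> : u (a + k + y) - u (a + y) - k * u1 (a + y) - k ^+ 2 / 2 * u2 (a + y) =
    u (a + y + k) - u (a + y) - u1 (a + y) * k - u2 (a + y) / 2 * k ^+ 2.
  by rewrite (addrAC a k y); field.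
exact: ut.
Qed.

Lemma smooth_comp s t u B : 0 < s -> 0 < t -> measurable_fun [set: R] u ->
  (forall a, `|u a| <= B) ->
  forall a, smooth s (smooth t u) a = smooth (Num.sqrt (s ^+ 2 + t ^+ 2)) u a.
Proof.
move=> s0 t0 mu uB a; set r := Num.sqrt _.
have mp : measurable_fun [set: mR * mR] (fun p : mR * mR => u (a + (p.1 + p.2))).
  by apply: (measurableT_comp mu); apply: measurable_funD => //; exact: measurable_funD.
have madd : measurable_fun [set: mR * mR] (fun p : mR * mR => p.1 + p.2 : mR).
  exact: measurable_funD.
have i1 := intg_cst (gauss s) B; have i2 := intg_cst (gauss t) (1 : R).
have pB (x y : mR) : `|u (a + ((x, y).1 + (x, y).2))| <= B * 1 by rewrite mulr1.
have [iu _ _] := smooth_bounded r mu uB.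
rewrite /smooth (law_Rintegral madd (fun A mA => gauss_convolution s0 t0 mA) (iu a)).
rewrite (Rintegral_prod mp i1 i2 pB).
by apply: eq_Rintegral => y _; apply: eq_Rintegral => z _; rewrite /= addrA.
Qed.

Lemma iter_smooth s u B n : 0 < s -> measurable_fun [set: R] u -> (forall a, `|u a| <= B) ->
  iter n.+1 (smooth s) u = smooth (s * Num.sqrt n.+1%:R) u.
Proof.
move=> s0 mu uB; elim: n => [|n IH]; first by rewrite sqrtr1 mulr1.
rewrite iterS IH; apply/funext => a.
have t0 : 0 < s * Num.sqrt n.+1%:R by rewrite mulr_gt0// sqrtr_gt0.
rewrite (smooth_comp s0 t0 mu uB); congr (smooth _ u a).
rewrite exprMn (sqr_sqrtr (ler0n _ _)).
have -> : s ^+ 2 + s ^+ 2 * n.+1%:R = s ^+ 2 * n.+2%:R by rewrite -[n.+2%:R]natr1; ring.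
by rewrite (sqrtrM _ (sqr_ge0 s)) sqrtr_sqr (gtr0_norm s0).
Qed.

(** Under the Gaussian law the linear Taylor term vanishes and the quadratic one gives exactly
    $s^2/2$ times [u2 a]; the remainder is a third absolute moment, at most $16\sqrt2\,s^3$ up to
    the factor $C$. *)
Lemma smooth_step s B C u u1 u2 a : 0 < s -> taylor2 B C u u1 u2 ->
  `|smooth s u a - u a - u2 a / 2 * s ^+ 2| <= C * s ^+ 3 * gK /\
  `|smooth s u2 a - u2 a| <= C * s * gK.
Proof.
move=> s0 [[mu mu1 mu2] [uB u1B u2B] ul u2l ut].
have [iu _ _] := smooth_bounded s mu uB; have [iu2 _ _] := smooth_bounded s mu2 u2B.
have e1 (y : R) : `|id y| <= 1 * `|y| ^+ 1 by rewrite expr1 mul1r.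
have e2 (y : R) : `|y ^+ 2| <= 1 * `|y| ^+ 2 by rewrite normrX mul1r.
have m2 : measurable_fun [set: R] (fun y : R => y ^+ 2) by exact: measurable_funX.
have [iy _] := @intg_gauss R s id 1 1 s0 isT (@measurable_id _ _ _) e1.
have [iy2 _] := @intg_gauss R s (fun y => y ^+ 2) 1 2 s0 isT m2 e2.
have ic := intg_cst (gauss s) (u a); have ic2 := intg_cst (gauss s) (u2 a).
have iZ1 := intgZ (u1 a) iy; have iZ2 := intgZ (u2 a / 2) iy2.
have i0 := intgB (iu a) ic; have i1 := intgB i0 iZ1; have i2 := intgB i1 iZ2.
have i3 := intgB (iu2 a) ic2; split.
- have -> : smooth s u a - u a - u2 a / 2 * s ^+ 2 =
      \int[gauss s]_y (u (a + y) - u a - u1 a * y - u2 a / 2 * y ^+ 2).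
    rewrite (RintegralB measurableT i1 iZ2) (RintegralB measurableT i0 iZ1).
    rewrite (RintegralB measurableT (iu a) ic) (RintegralZl _ measurableT iy).
    rewrite (RintegralZl _ measurableT iy2) (gauss_variance s0).
    rewrite [X in _ - _ * X - _](gauss_mean0 s0) mulr0 subr0.
    by congr (_ - _ - _); exact/esym/(Rintegral_cstp (gauss s)).
  by have [_] := @intg_gauss R s _ C 3 s0 isT (measurable_intg i2) (fun y => ut a y).
- have -> : smooth s u2 a - u2 a = \int[gauss s]_y (u2 (a + y) - u2 a).
    rewrite (RintegralB measurableT (iu2 a) ic2).
    by congr (_ - _); exact/esym/(Rintegral_cstp (gauss s)).
  have b y : `|u2 (a + y) - u2 a| <= C * `|y| ^+ 1 by rewrite expr1.
  by have [_] := @intg_gauss R s _ C 1 s0 isT (measurable_intg i3) b.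
Qed.

End smoothing.

Section one_step.
Context {R : realType}.
Notation mR := (measurableTypeR R).
Notation NT := (mR * mR * mR)%type.
Notation Q := (@step_op R).
Notation gK := (16 * Num.sqrt 2 : R).
Variables (h : R -> R) (Ch : R).
Hypothesis mh : measurable_fun [set: R] h.
Hypothesis hC : forall r, `|h r| <= `|r| + Ch.
Hypothesis hP : forall r, h r - Q h r = centered_mean r.
Notation xi := (increment h).
Notation v := (cond_variance h).
Notation ic := (increment_const Ch).
Variables (g : R -> R) (Bg sigma : R).
Hypothesis mg : measurable_fun [set: R] g.
Hypothesis gB : forall r, `|g r| <= Bg.
Hypothesis sigma0 : 0 < sigma.
Hypothesis gP : forall r, g r - Q g r = v r - sigma ^+ 2.
Variables (e B C : R) (u u1 u2 : R -> R).
Hypothesis e0 : 0 < e.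
Hypothesis uT : taylor2 B C u u1 u2.

Let C0 : 0 <= C.
Proof.
have [_ _ _ ul _] := uT; have := le_trans (normr_ge0 _) (ul 0 1).
by rewrite normr1 mulr1.
Qed.

Let mxi r : measurable_fun [set: NT] (fun w : NT => xi (r, w)).
Proof. exact: (measurableT_comp (measurable_increment mh) (measurable_pair1 _)). Qed.

Let mbxi (f : R -> R) b r : measurable_fun [set: R] f ->
  measurable_fun [set: NT] (fun w : NT => f (b + e * xi (r, w))).
Proof.
move=> mf; apply: (measurableT_comp mf); apply: measurable_funD => //.
by apply: measurable_funM => //; exact: mxi.
Qed.

(** The expansion of [smooth_step] for the increment of the chain, centered by [increment_mean0].
    The quadratic term now carries [v r], which varies with $r$. *)
Lemma increment_step b r :
  `|\int[noise R]_w u (b + e * xi (r, w)) - u b - u2 b / 2 * (e ^+ 2 * v r)| <=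
  C * e ^+ 3 * (ic ^+ 3 * 216 * noise_const).
Proof.
have [[mu mu1 mu2] [uB u1B u2B] ul u2l ut] := uT.
have iu : intg (noise R) (fun w => u (b + e * xi (r, w))).
  by apply: (@intg_bounded _ _ _ _ _ B) => [|w]; [exact: mbxi|exact: uB].
have ix := @intg_incrementX R h Ch mh hC hP r 1 isT.
have ix2 := @intg_incrementX R h Ch mh hC hP r 2 isT.
have ix3 := intg_norm (@intg_incrementX R h Ch mh hC hP r 3 isT).
have icst := intg_cst (noise R) (u b).
have iZ1 := intgZ (u1 b * e) ix; have iZ2 := intgZ (u2 b / 2 * e ^+ 2) ix2.
have i0 := intgB iu icst; have i1 := intgB i0 iZ1; have i2 := intgB i1 iZ2.
have -> : \int[noise R]_w u (b + e * xi (r, w)) - u b - u2 b / 2 * (e ^+ 2 * v r) =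
    \int[noise R]_w (u (b + e * xi (r, w)) - u b - u1 b * e * xi (r, w) -
       u2 b / 2 * e ^+ 2 * xi (r, w) ^+ 2).
  rewrite (RintegralB measurableT i1 iZ2) (RintegralB measurableT i0 iZ1).
  rewrite (RintegralB measurableT iu icst) (RintegralZl _ measurableT ix).
  rewrite (RintegralZl _ measurableT ix2) -/(v r).
  rewrite [X in _ - _ * X - _](increment_mean0 mh hC hP r) mulr0 subr0 mulrA.
  by congr (_ - _ - _); exact/esym/(Rintegral_cstp (noise R)).
have h3 := third_moment mh hC hP r.
apply: (@le_trans _ _ (C * e ^+ 3 * \int[noise R]_w `|xi (r, w) ^+ 3|)).
  rewrite -(RintegralZl _ measurableT ix3); apply: le_norm_Rintegral.
  - exact: measurable_intg i2.
  - exact: intgZ.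
  - move=> w; have := ut b (e * xi (r, w)).
    rewrite normrM (gtr0_norm e0) !exprMn normrX !mulrA; exact.
rewrite ler_wpM2l ?mulr_ge0 ?exprn_ge0 ?(ltW e0)//.
by apply: le_trans h3; under eq_Rintegral do rewrite normrX.
Qed.

(** Freezing [u2] at [b] costs one order in [e]; this is affordable because the term has weight
    $e^2/2$ in [potential]. *)
Lemma corrector_step b r :
  `|\int[noise R]_w (u2 (b + e * xi (r, w)) * g (delta_step (r, w))) - u2 b * Q g r| <=
  C * e * (ic * growth_mean) * Bg.
Proof.
have [[mu mu1 mu2] [uB u1B u2B] ul u2l ut] := uT.
have [ig _ _] := bounded_section mg gB.
have iug : intg (noise R) (fun w => u2 (b + e * xi (r, w)) * g (delta_step (r, w))).
  apply: (@intg_bounded _ _ _ _ _ (B * Bg)) => [|w].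
    by apply: measurable_funM; [exact: mbxi|exact: measurable_intg (ig r)].
  by rewrite normrM ler_pM.
have iZ := intgZ (u2 b) (ig r).
rewrite /step_op -(RintegralZl _ measurableT (ig r)) -(RintegralB measurableT iug iZ).
have ing := intgZ (C * e * ic * Bg) (@intg_noise_growth R).
have -> : C * e * (ic * growth_mean) * Bg = \int[noise R]_w (C * e * ic * Bg * noise_growth w).
  by rewrite (RintegralZl _ measurableT (@intg_noise_growth R)) -/growth_mean; ring.
apply: le_norm_Rintegral.
- exact: measurable_intg (intgB iug iZ).
- exact: ing.
- move=> w; rewrite -mulrBl normrM.
  have -> : C * e * ic * Bg * noise_growth w = C * (e * (ic * noise_growth w)) * Bg by ring.
  apply: ler_pM => //; apply: le_trans (u2l b _) _; rewrite ler_wpM2l//.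
  by rewrite normrM (gtr0_norm e0) ler_wpM2l ?(ltW e0)// (norm_increment mh hC hP).
Qed.

Definition potential (f f2 : R -> R) (b r : R) : R := f b + e ^+ 2 / 2 * (f2 b * g r).

Definition one_step_const : R :=
  C * (ic ^+ 3 * 216 * noise_const) + C * (ic * growth_mean) * Bg / 2 +
  C * sigma ^+ 3 * gK + C * sigma * gK * Bg / 2.

Lemma one_step b r :
  `|\int[noise R]_w potential u u2 (b + e * xi (r, w)) (delta_step (r, w)) -
    potential (smooth (sigma * e) u) (smooth (sigma * e) u2) b r| <= one_step_const * e ^+ 3.
Proof.
have [[mu mu1 mu2] [uB u1B u2B] ul u2l ut] := uT.
have [ig _ _] := bounded_section mg gB.
have iu : intg (noise R) (fun w => u (b + e * xi (r, w))).
  by apply: (@intg_bounded _ _ _ _ _ B) => [|w]; [exact: mbxi|exact: uB].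
have iug : intg (noise R) (fun w => u2 (b + e * xi (r, w)) * g (delta_step (r, w))).
  apply: (@intg_bounded _ _ _ _ _ (B * Bg)) => [|w].
    by apply: measurable_funM; [exact: mbxi|exact: measurable_intg (ig r)].
  by rewrite normrM ler_pM.
have s0 : 0 < sigma * e by rewrite mulr_gt0.
have [h3 h4] := smooth_step b s0 uT.
have h1 := increment_step b r; have h2 := corrector_step b r.
rewrite /potential (RintegralD measurableT iu (intgZ _ iug)) (RintegralZl _ measurableT iug).
have gr := gP r.
move: h1 h2 h3 h4; rewrite /one_step_const.
set X1 := \int[noise R]_w u _; set X2 := \int[noise R]_w (_ * _).
set X3 := smooth _ u b; set X4 := smooth _ u2 b.
set K1 := ic ^+ 3 * 216 * noise_const; set K2 := ic * growth_mean; set K3 : R := gK.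
move=> h1 h2 h3 h4.
(* The second-order terms drop out by the Poisson equation for [g]. Four errors of order $e^3$
   remain: the two Taylor remainders, the freezing of [u2], and the effect of smoothing on [u2]. *)
have -> : X1 + e ^+ 2 / 2 * X2 - (X3 + e ^+ 2 / 2 * (X4 * g r)) =
   (X1 - u b - u2 b / 2 * (e ^+ 2 * v r)) + e ^+ 2 / 2 * (X2 - u2 b * Q g r)
   - (X3 - u b - u2 b / 2 * (sigma * e) ^+ 2) - e ^+ 2 / 2 * ((X4 - u2 b) * g r).
  have -> : v r = g r - Q g r + sigma ^+ 2 by rewrite gr subrK.
  by field.
have e2 : 0 <= e ^+ 2 / 2 by rewrite divr_ge0 ?sqr_ge0.
apply: le_trans (ler_normB _ _) _; apply: le_trans (lerD (ler_normB _ _) (lexx _)) _.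
apply: le_trans (lerD (lerD (ler_normD _ _) (lexx _)) (lexx _)) _.
rewrite (normrM _ (X2 - _)) (normrM _ (_ * g r)) (normrM (X4 - _)) !(ger0_norm e2).
have -> : (C * K1 + C * K2 * Bg / 2 + C * sigma ^+ 3 * K3 + C * sigma * K3 * Bg / 2) * e ^+ 3 =
  C * e ^+ 3 * K1 + e ^+ 2 / 2 * (C * e * K2 * Bg) + C * (sigma * e) ^+ 3 * K3 +
  e ^+ 2 / 2 * (C * (sigma * e) * K3 * Bg) by field.
by rewrite !lerD// ler_wpM2l// ler_pM.
Qed.

End one_step.

(** * Convergence for smooth test functions *)

Section clt.
Context d (T : measurableType d) (R : realType) (P : probability T R).
Variable W : ladder_edge -> {RV P >-> R}.
Hypothesis W_indep : mutually_independent W.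
Hypothesis W_law : forall (e : ladder_edge) (A : set R), measurable A ->
  distribution P (W e) A = exponential_prob 1 A.
Notation mR := (measurableTypeR R).
Notation NT := (mR * mR * mR)%type.
Notation Q := (@step_op R).
Notation chn := (chain W).
Notation col := (chain_column W).

(** As $|\Delta_{n+1}|\le Z_{n+1}$, the bound is free of $n$; it makes $h(\Delta_n)$ negligible
    after division by $\sqrt n$. *)
Lemma delta_bound : exists D : R, forall n,
  intg P (fun t => `|(chn n t).2|) /\ \int[P]_t `|(chn n t).2| <= D.
Proof.
have mabs : measurable_fun [set: R] (fun r : R => `|r|) by exact: normr_measurable.
have gm0 : 0 <= @growth_mean R.
  by have := le_trans (normr_ge0 _) (@norm_mean_f R 0); rewrite normr0 add0r.
have i0 : intg P (fun t => `|(chn 0 t).2|).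
  have mW : measurable_fun [set: T] (W (rung 0) : T -> mR).
    exact: (@measurable_funP _ _ _ _ _ (W (rung 0))).
  have lW (A : set mR) : measurable A -> exp1 R A = P ((W (rung 0) : T -> mR) @^-1` A).
    by move=> mA; exact/esym/W_law.
  apply: (law_intg mW lW mabs).1.
  apply: (@intg_dom _ mR _ _ (fun r : R => 2 * expR (1 / 2 * `|r|))) => //.
    by apply: intgZ; exact: intg_exp1_expR.
  by move=> r; rewrite normr_id; exact: norm_le_expR_half.
exists (growth_mean + \int[P]_t `|(chn 0 t).2|) => -[|n].
  by split => //; rewrite lerDr.
pose Psi (p : mR * mR * NT) : R := `|delta_step (p.1.2, p.2)|.
have mPsi : measurable_fun setT Psi.
  apply: (measurableT_comp mabs).
  exact: (measurableT_comp measurable_snd (@measurable_chain_map R)).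
have sg (r : R) (w : NT) : `|delta_step (r, w)| <= noise_growth w.
  apply: le_trans (norm_delta_step _) _; rewrite noise_growthE /=.
  have := normr_ge0 w.1.1; have := normr_ge0 w.1.2; lra.
have Pb v w : `|Psi (v, w)| <= 216 * noise_dom w.
  rewrite /Psi normr_id; apply: le_trans (sg _ _) _.
  exact: (@noise_growthX_le R w 1).
have [i E] := chain_markov W_indep W_law n mPsi Pb.
have -> : (fun t => `|(chn n.+1 t).2|) = fun t => Psi (chn n t, col n t).
  by apply/funext => t; rewrite chainS.
split => //; rewrite E; apply: (@le_trans _ _ growth_mean); last first.
  by rewrite lerDl Rintegral_ge0.
apply: le_trans (ler_norm _) _.
have mI : measurable_fun [set: mR * mR] (fun v => \int[noise R]_w Psi (v, w)).
  have id := @intg_noise_dom R.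
  exact: (measurable_Rintegral1 mPsi (intg_cst (@noise_xy R) 216) id Pb).
apply: Rintegral_le_bound.
  exact: (measurableT_comp mI (chain_indep W_indep W_law n).1).
move=> t; apply: le_norm_Rintegral.
- exact: (measurableT_comp mPsi (measurable_pair1 _)).
- exact: intg_noise_growth.
- by move=> w; rewrite /Psi normr_id.
Qed.

Section lindeberg.
Variables (h : R -> R) (Ch : R).
Hypothesis mh : measurable_fun [set: R] h.
Hypothesis hC : forall r, `|h r| <= `|r| + Ch.
Hypothesis hP : forall r, h r - Q h r = centered_mean r.
Variables (g : R -> R) (Bg sigma : R).
Hypothesis mg : measurable_fun [set: R] g.
Hypothesis gB : forall r, `|g r| <= Bg.
Hypothesis sigma0 : 0 < sigma.
Hypothesis gP : forall r, g r - Q g r = cond_variance h r - sigma ^+ 2.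

Definition corrected k (t : T) : R := (chn k t).1 - k%:R * chi + h (chn k t).2.

Lemma correctedS k t :
  corrected k.+1 t = corrected k t + increment h ((chn k t).2, col k t).
Proof. by rewrite /corrected chainS /chain_map /increment /ladder_fbar/= -natr1; ring. Qed.

Let mchn k : measurable_fun [set: T] (chn k).
Proof. by have [] := chain_indep W_indep W_law k. Qed.

Let mdelta k : measurable_fun [set: T] (fun t => (chn k t).2).
Proof. exact: (measurableT_comp measurable_snd (mchn k)). Qed.

Lemma measurable_corrected k : measurable_fun [set: T] (corrected k).
Proof.
apply: measurable_funD; last exact: (measurableT_comp mh (mdelta k)).
by apply: measurable_funB => //; exact: (measurableT_comp measurable_fst (mchn k)).
Qed.

Let Bg0 : 0 <= Bg. Proof. exact: le_trans (normr_ge0 _) (gB 0). Qed.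

Section fixed_scale.
Variable e : R.
Hypothesis e0 : 0 < e.
Notation pot := (potential g e).

Let potential_bound (B : R) (f f2 : R -> R) (b r : R) : (forall a, `|f a| <= B) -> (forall a, `|f2 a| <= B) ->
  `|pot f f2 b r| <= B + e ^+ 2 / 2 * (B * Bg).
Proof.
move=> fB f2B; have e2 : 0 <= e ^+ 2 / 2 by rewrite divr_ge0 ?sqr_ge0.
apply: le_trans (ler_normD _ _) _; apply: lerD => //.
by rewrite normrM (ger0_norm e2) ler_wpM2l// normrM ler_pM.
Qed.

Let measurable_potential d' (S : measurableType d') (f f2 : R -> R) (X Y : S -> R) :
  measurable_fun [set: R] f -> measurable_fun [set: R] f2 ->
  measurable_fun [set: S] X -> measurable_fun [set: S] Y ->
  measurable_fun [set: S] (fun t => pot f f2 (X t) (Y t)).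
Proof.
move=> mf mf2 mX mY; apply: measurable_funD; first exact: (measurableT_comp mf mX).
apply: measurable_funM => //.
by apply: measurable_funM; [exact: (measurableT_comp mf2 mX)|exact: (measurableT_comp mg mY)].
Qed.

Let mecorr k : measurable_fun [set: T] (fun t => e * corrected k t).
Proof. by apply: measurable_funM => //; exact: measurable_corrected. Qed.

Let intg_potential (B : R) (f f2 : R -> R) k : measurable_fun [set: R] f -> measurable_fun [set: R] f2 ->
  (forall a, `|f a| <= B) -> (forall a, `|f2 a| <= B) ->
  intg P (fun t => pot f f2 (e * corrected k t) (chn k t).2).
Proof.
move=> mf mf2 fB f2B.
apply: (@intg_bounded _ _ _ _ _ (B + e ^+ 2 / 2 * (B * Bg))) => [|t].
  exact: (measurable_potential mf mf2 (mecorr k) (mdelta k)).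
exact: potential_bound.
Qed.

Lemma potential_close (B : R) (f f2 : R -> R) k : measurable_fun [set: R] f -> measurable_fun [set: R] f2 ->
  (forall a, `|f a| <= B) -> (forall a, `|f2 a| <= B) ->
  `|\int[P]_t pot f f2 (e * corrected k t) (chn k t).2 - \int[P]_t f (e * corrected k t)| <=
  e ^+ 2 / 2 * (B * Bg).
Proof.
move=> mf mf2 fB f2B; have ip := intg_potential k mf mf2 fB f2B.
have mfc := measurableT_comp mf (mecorr k).
have i1 : intg P (fun t => f (e * corrected k t)).
  by apply: (@intg_bounded _ _ _ _ _ B).
rewrite -(RintegralB measurableT ip i1); apply: Rintegral_le_bound.
  exact: measurable_intg (intgB ip i1).
move=> t; rewrite /potential addrC addKr.
have e2 : 0 <= e ^+ 2 / 2 by rewrite divr_ge0 ?sqr_ge0.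
by rewrite normrM (ger0_norm e2) ler_wpM2l// normrM ler_pM.
Qed.

Lemma potential_step (B C : R) (u u1 u2 : R -> R) k : taylor2 B C u u1 u2 ->
  `|\int[P]_t pot u u2 (e * corrected k.+1 t) (chn k.+1 t).2 -
    \int[P]_t pot (smooth (sigma * e) u) (smooth (sigma * e) u2) (e * corrected k t) (chn k t).2|
  <= one_step_const Ch Bg sigma C * e ^+ 3.
Proof.
move=> uT; have [[mu mu1 mu2] [uB u1B u2B] _ _ _] := uT.
have [_ msu suB] := smooth_bounded (sigma * e) mu uB.
have [_ msu2 su2B] := smooth_bounded (sigma * e) mu2 u2B.
pose Psi (p : mR * mR * NT) : R :=
  pot u u2 (e * (p.1.1 - k%:R * chi + h p.1.2) + e * increment h (p.1.2, p.2))
    (delta_step (p.1.2, p.2)).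
have m12 : measurable_fun [set: mR * mR * NT] (fun p => (p.1.2, p.2)).
  apply: measurable_fun_pair; last exact: measurable_snd.
  exact: measurableT_comp measurable_snd measurable_fst.
have mp11 : measurable_fun [set: mR * mR * NT] (fun p => p.1.1).
  exact: measurableT_comp measurable_fst measurable_fst.
have mp12 : measurable_fun [set: mR * mR * NT] (fun p => p.1.2).
  exact: measurableT_comp measurable_snd measurable_fst.
have mPsi : measurable_fun setT Psi.
  apply: (measurable_potential mu mu2).
  - apply: measurable_funD; apply: measurable_funM => //.
      apply: measurable_funD; first exact: measurable_funB.
      exact: (measurableT_comp mh mp12).
    exact: (measurableT_comp (measurable_increment mh) m12).
  - exact: (measurableT_comp (@measurable_delta_step R) m12).
pose c := B + e ^+ 2 / 2 * (B * Bg).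
have Pc v w : `|Psi (v, w)| <= c * 1 by rewrite mulr1; exact: potential_bound.
have c0 : 0 <= c by have := le_trans (normr_ge0 _) (Pc (0, 0) (0, 0, 0)); rewrite mulr1.
have Pb v w : `|Psi (v, w)| <= c * noise_dom w.
  by apply: le_trans (Pc v w) _; rewrite ler_wpM2l// noise_dom_ge1.
have [i E] := chain_markov W_indep W_law k mPsi Pb.
have -> : \int[P]_t pot u u2 (e * corrected k.+1 t) (chn k.+1 t).2 =
    \int[P]_t Psi (chn k t, col k t).
  by apply: eq_Rintegral => t _; rewrite correctedS mulrDr chainS.
have mI : measurable_fun [set: mR * mR] (fun v => \int[noise R]_w Psi (v, w)).
  exact: (measurable_Rintegral1 mPsi (intg_cst (@noise_xy R) c) (@intg_noise_dom R) Pb).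
have i1 : intg P (fun t => \int[noise R]_w Psi (chn k t, w)).
  apply: (@intg_bounded _ _ _ _ _ c) => [|t]; first exact: (measurableT_comp mI (mchn k)).
  apply: Rintegral_le_bound; first exact: (measurableT_comp mPsi (measurable_pair1 _)).
  by move=> w; rewrite -[leRHS]mulr1.
have i2 := intg_potential k msu msu2 suB su2B.
rewrite E -(RintegralB measurableT i1 i2); apply: Rintegral_le_bound.
  exact: measurable_intg (intgB i1 i2).
move=> t; have os := one_step mh hC hP mg gB sigma0 gP e0 uT (e * corrected k t) (chn k t).2.
rewrite (_ : \int[noise R]_w Psi (chn k t, w) = \int[noise R]_w pot u u2
    (e * corrected k t + e * increment h ((chn k t).2, w)) (delta_step ((chn k t).2, w))).
  exact: os.
by apply: eq_Rintegral => w _.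
Qed.

(** The exchange runs backwards in time: the last increment is absorbed into a smoothing of the test
    function, and the induction continues with the smoothed functions. As [smooth_taylor2] keeps
    both constants, the errors add up without growing. *)
Lemma potential_iter n : forall (B C : R) (u u1 u2 : R -> R), taylor2 B C u u1 u2 ->
  `|\int[P]_t pot u u2 (e * corrected n t) (chn n t).2 -
    \int[P]_t pot (iter n (smooth (sigma * e)) u) (iter n (smooth (sigma * e)) u2)
      (e * corrected 0 t) (chn 0 t).2|
  <= n%:R * (one_step_const Ch Bg sigma C * e ^+ 3).
Proof.
elim: n => [|n IH] B C u u1 u2 uT; first by rewrite subrr normr0 mul0r.
rewrite !iterSr -natr1 mulrDl mul1r [leRHS]addrC.
apply: le_trans (ler_distD (\int[P]_t pot (smooth (sigma * e) u) (smooth (sigma * e) u2)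
  (e * corrected n t) (chn n t).2) _ _) _.
by apply: lerD; [exact: potential_step uT|exact: IH (smooth_taylor2 (sigma * e) uT)].
Qed.

End fixed_scale.

Lemma iter_smooth_taylor2 n (s B C : R) (u u1 u2 : R -> R) : taylor2 B C u u1 u2 ->
  taylor2 B C (iter n (smooth s) u) (iter n (smooth s) u1) (iter n (smooth s) u2).
Proof. by elim: n => [//|n IH] uT; rewrite !iterS; exact/smooth_taylor2/IH. Qed.

(** With $e=n^{-1/2}$, $n$ exchanges of cost $Ke^3$ cost $Ke$. Removing $h(\Delta_n)$ at the end and
    $h(\Delta_0)$ at the start costs $BHe$ each, and inserting and removing the term in [g] costs
    $e^2B\,B_g$ in all. *)
Lemma test_function_bound (B C : R) (u u1 u2 : R -> R) : taylor2 B C u u1 u2 -> exists K, forall n : nat,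
  `|\int[P]_t u (((chn n.+1 t).1 - n.+1%:R * chi) / Num.sqrt n.+1%:R) -
    \int[gauss sigma]_y u y| <= K / Num.sqrt n.+1%:R.
Proof.
move=> uT; have [[mu mu1 mu2] [uB u1B u2B] ul _ _] := uT.
have B0 : 0 <= B by exact: le_trans (normr_ge0 _) (uB 0).
have [D Dn] := delta_bound.
pose H := D + Ch; pose K := one_step_const Ch Bg sigma C.
exists (B * H + B * H + K + B * Bg) => n; have [N NE] : exists N : nat, N = n.+1 by exists n.+1.
rewrite -NE; have N0 : (0 < N)%N by rewrite NE.
pose q := Num.sqrt (N%:R : R).
have q0 : 0 < q by rewrite sqrtr_gt0 ltr0n.
have q1 : 1 <= q by rewrite -[leLHS]sqrtr1 ler_wsqrtr// ler1n.
pose e := q^-1; have e0 : 0 < e by rewrite invr_gt0.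
have e1 : e <= 1 by rewrite invf_le1.
have Ne2 : N%:R * e ^+ 2 = 1.
  by rewrite /e exprVn sqr_sqrtr ?ler0n// divff// pnatr_eq0 -lt0n.
have ihd k : intg P (fun t => `|h (chn k t).2|) /\ \int[P]_t `|h (chn k t).2| <= H.
  have [i b] := Dn k.
  have ii : intg P (fun t => `|(chn k t).2| + Ch) by apply: intgD => //; exact: intg_cst.
  have mhk := measurableT_comp mh (mdelta k).
  have ih : intg P (fun t => h (chn k t).2) by exact: (intg_dom mhk ii (fun t => hC _)).
  split; first exact: intg_norm.
  apply: le_trans (le_Rintegral measurableT (intg_norm ih) ii (fun t _ => hC _)) _.
  rewrite (RintegralD measurableT i (intg_cst P Ch)) (Rintegral_cstp P).
  by rewrite lerD2r.
have mc k : measurable_fun [set: T] (fun t => e * corrected k t).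
  by apply: measurable_funM => //; exact: measurable_corrected.
have iu k (f : R -> R) : measurable_fun [set: R] f -> (forall a, `|f a| <= B) ->
    intg P (fun t => f (e * corrected k t)).
  by move=> mf fB; apply: (@intg_bounded _ _ _ _ _ B) => //; exact: (measurableT_comp mf (mc k)).
have sE : iter N (smooth (sigma * e)) u = smooth sigma u.
  have qE : sigma * e * Num.sqrt n.+1%:R = sigma by rewrite -NE; exact: (divfK (lt0r_neq0 q0) sigma).
  have is_ := @iter_smooth R (sigma * e) u B n (mulr_gt0 sigma0 e0) mu uB.
  by rewrite qE in is_; rewrite NE.
have sT := iter_smooth_taylor2 N (sigma * e) uT.
have [[ms _ ms2] [sB _ s2B] sl _ _] := sT.
have g0 : \int[gauss sigma]_y u y = smooth sigma u 0.
  by apply: eq_Rintegral => y _; rewrite add0r.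
(* l_n - n chi and corrected n differ by h (Delta_n) *)
have h1 : `|\int[P]_t u (((chn N t).1 - N%:R * chi) / q) - \int[P]_t u (e * corrected N t)| <= B * H * e.
  have m1 : measurable_fun [set: T] (fun t => u (((chn N t).1 - N%:R * chi) / q)).
    have mX : measurable_fun [set: T] (fun t => (chn N t).1 - N%:R * chi).
      apply: measurable_funB; last exact: measurable_cst.
      exact: (measurableT_comp measurable_fst (mchn N)).
    have mq : measurable_fun [set: T] (fun _ : T => q^-1) by exact: measurable_cst.
    exact: (measurableT_comp mu (measurable_funM mX mq)).
  have i1 : intg P (fun t => u (((chn N t).1 - N%:R * chi) / q)).
    exact: (@intg_bounded _ _ _ _ _ B).
  have [ih hb] := ihd N; have iz := intgZ (B * e) ih.
  rewrite -(RintegralB measurableT i1 (iu N u mu uB)).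
  apply: (@le_trans _ _ (\int[P]_t (B * e * `|h (chn N t).2|))).
    apply: le_norm_Rintegral; [exact: measurable_intg (intgB i1 (iu N u mu uB))|exact: iz|].
    move=> t; rewrite distrC /corrected mulrDr [e * (_ - _)]mulrC -/e.
    by apply: le_trans (ul _ _) _; rewrite normrM (gtr0_norm e0) mulrA.
  by rewrite (RintegralZl _ measurableT ih) mulrAC ler_wpM2r ?(ltW e0)// ler_wpM2l.
have h2 := potential_close e N mu mu2 uB u2B.
have h3 := potential_iter e0 N uT.
have h4 := potential_close e 0 ms ms2 sB s2B.
(* As $l_0=0$, the corrected process starts at $h(\Delta_0)$; what remains after all exchanges is
   the Gaussian average, up to this shift of its argument. *)
have h5 : `|\int[P]_t iter N (smooth (sigma * e)) u (e * corrected 0 t) - smooth sigma u 0| <= B * H * e.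
  have [ih hb] := ihd 0%N; have iz := intgZ (B * e) ih.
  have is_ := iu 0%N _ ms sB.
  rewrite -[X in _ - X](Rintegral_cstp P) -(RintegralB measurableT is_ (intg_cst P _)).
  apply: (@le_trans _ _ (\int[P]_t (B * e * `|h (chn 0 t).2|))).
    apply: le_norm_Rintegral; [exact: measurable_intg (intgB is_ (intg_cst P _))|exact: iz|].
    move=> t; rewrite -sE -[e * _]add0r; apply: le_trans (sl _ _) _.
    rewrite normrM (gtr0_norm e0) mulrA ler_wpM2l ?mulr_ge0 ?(ltW e0)//.
    by rewrite /corrected /chain/= mul0r subr0 add0r.
  by rewrite (RintegralZl _ measurableT ih) mulrAC ler_wpM2r ?(ltW e0)// ler_wpM2l.
rewrite g0.
have e3 : N%:R * (K * e ^+ 3) = K * e.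
  transitivity (N%:R * e ^+ 2 * (K * e)); last by rewrite Ne2 mul1r.
  by move: (N%:R : R) => M; ring.
rewrite -/K e3 in h3.
suff X : `|\int[P]_t u (((chn N t).1 - N%:R * chi) / q) - smooth sigma u 0| <=
    (B * H + B * H + K + B * Bg) * e by exact: X.
have e2 : e ^+ 2 <= e by rewrite expr2 ler_piMr// ltW.
have bb : e ^+ 2 / 2 * (B * Bg) <= e / 2 * (B * Bg).
  by rewrite ler_wpM2r ?mulr_ge0// ler_wpM2r// invr_ge0.
move: h1 h2 h3 h4 h5 bb; rewrite !ler_norml.
set a1 := \int[P]_t _; set a2 := \int[P]_t _; set a3 := \int[P]_t _; set a4 := \int[P]_t _.
set a5 := \int[P]_t _; set a6 := smooth _ _ _.
move: (e ^+ 2 / 2 * (B * Bg)) => b.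
have -> : (B * H + B * H + K + B * Bg) * e = B * H * e + B * H * e + K * e + 2 * (e / 2 * (B * Bg)).
  by field.
move: (B * H * e) (K * e) (e / 2 * (B * Bg)) => x y z.
move=> /andP[? ?] /andP[? ?] /andP[? ?] /andP[? ?] /andP[? ?] ?.
by apply/andP; split; lra.
Qed.

Lemma test_function_cvg (B C : R) (u u1 u2 : R -> R) : taylor2 B C u u1 u2 ->
  \int[P]_t u (((chn n t).1 - n%:R * chi) / Num.sqrt n%:R) @[n --> \oo] -->
  \int[gauss sigma]_y u y.
Proof.
move=> /test_function_bound [K hK].
rewrite -(@cvg_shiftn 1 _ (fun n => \int[P]_t u (((chn n t).1 - n%:R * chi) / Num.sqrt n%:R))).
apply/cvgrPdist_le => /= eps eps0; near=> n; rewrite addn1 distrC.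
apply: le_trans (hK n) _.
have K0 : 0 <= K.
  have := le_trans (normr_ge0 _) (hK 0%N); by rewrite sqrtr1 divr1.
have q0 : 0 < Num.sqrt (n.+1%:R : R) by rewrite sqrtr_gt0 ltr0n.
rewrite ler_pdivrMr// mulrC -ler_pdivrMr//.
have : (K / eps) ^+ 2 <= n%:R.
  near: n; exact: nbhs_infty_ger.
move=> h2; rewrite -[leLHS]ger0_norm ?divr_ge0 ?(ltW eps0)// -sqrtr_sqr ler_wsqrtr//.
by apply: le_trans h2 _; rewrite ler_nat.
Unshelve. all: by end_near. Qed.

End lindeberg.

End clt.

(** * Spline test functions *)

Section spline.
Context {R : realType}.
Implicit Types (t k c : R).

Definition ramp t : R := Num.max t 0.

(* The distribution function of the sum of three independent uniform variables
   on [0, 1], with its first two derivatives. *)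
Definition spline t : R :=
  (ramp t ^+ 3 - 3 * ramp (t - 1) ^+ 3 + 3 * ramp (t - 2) ^+ 3 - ramp (t - 3) ^+ 3) / 6.
Definition spline1 t : R :=
  (ramp t ^+ 2 - 3 * ramp (t - 1) ^+ 2 + 3 * ramp (t - 2) ^+ 2 - ramp (t - 3) ^+ 2) / 2.
Definition spline2 t : R := ramp t - 3 * ramp (t - 1) + 3 * ramp (t - 2) - ramp (t - 3).

Lemma ramp_lip t k : `|ramp (t + k) - ramp t| <= `|k|.
Proof.
have := ler_norm k; have := ler_norm (- k); rewrite normrN /ramp.
by case: (leP (t + k) 0) => ?; case: (leP t 0) => ? ? ?; rewrite ler_norml; apply/andP; split; lra.
Qed.

(** The cube of the ramp is a cubic on each side of $0$ with matching second derivatives. The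
    remainder is $0$ or $k^3$ if the increment stays on one side, and lies between them if it
    crosses. *)
Lemma ramp_taylor t k :
  `|ramp (t + k) ^+ 3 - ramp t ^+ 3 - 3 * ramp t ^+ 2 * k - 3 * ramp t * k ^+ 2| <= `|k| ^+ 3.
Proof.
rewrite -normrX /ramp; case: (leP (t + k) 0) => tk; case: (leP t 0) => t0.
- by rewrite !expr0n/= !(mulr0, mul0r, subrr) normr0.
- rewrite expr0n/= sub0r.
  have -> : - t ^+ 3 - 3 * t ^+ 2 * k - 3 * t * k ^+ 2 = (- (t + k)) ^+ 3 + k ^+ 3 by ring.
  have a0 : 0 <= - (t + k) by lra.
  have ak : - (t + k) <= - k by lra.
  have c1 : (- (t + k)) ^+ 3 <= (- k) ^+ 3 by rewrite lerXn2r ?nnegrE//; lra.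
  have c0 : 0 <= (- (t + k)) ^+ 3 by rewrite exprn_ge0.
  have e : (- k) ^+ 3 = - k ^+ 3 by ring.
  rewrite e in c1; rewrite ler0_norm; last by lra.
  by rewrite (@ler0_norm _ (k ^+ 3)); lra.
- have -> : (t + k) ^+ 3 - 0 ^+ 3 - 3 * 0 ^+ 2 * k - 3 * 0 * k ^+ 2 = (t + k) ^+ 3 by ring.
  have c1 : (t + k) ^+ 3 <= k ^+ 3 by rewrite lerXn2r ?nnegrE//; lra.
  have c0 : 0 <= (t + k) ^+ 3 by rewrite exprn_ge0// ltW.
  by rewrite !ger0_norm//; lra.
- by have -> : (t + k) ^+ 3 - t ^+ 3 - 3 * t ^+ 2 * k - 3 * t * k ^+ 2 = k ^+ 3 by ring.
Qed.

Let rampE t : 0 <= t -> ramp t = t.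
Proof. by move=> t0; rewrite /ramp max_l. Qed.

Let ramp0 t : t <= 0 -> ramp t = 0.
Proof. by move=> t0; rewrite /ramp max_r. Qed.

Lemma spline_eq0 t : t <= 0 -> spline t = 0.
Proof. by move=> t0; rewrite /spline !ramp0 ?expr0n/=; lra. Qed.

Lemma spline_eq1 t : 3 <= t -> spline t = 1.
Proof. by move=> t0; rewrite /spline !rampE; [field|lra..]. Qed.

(** On the last interval the parameter runs backwards, $t=3-s$, so that the spline is $1-s^3/6$
    there and its derivative $s^2/2$. *)
Let segments t : t <= 0 \/ (exists2 s, 0 <= s <= 1 & t = s) \/
  (exists2 s, 0 <= s <= 1 & t = 1 + s) \/ (exists2 s, 0 <= s <= 1 & t = 3 - s) \/ 3 <= t.
Proof.
case: (leP t 0) => t0; first by left.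
right; case: (leP t 1) => t1; first by left; exists t => //; lra.
right; case: (leP t 2) => t2; first by left; exists (t - 1); lra.
right; case: (leP t 3) => t3; first by left; exists (3 - t); lra.
by right; lra.
Qed.

Let pw (s : R) : 0 <= s <= 1 -> [/\ 0 <= s ^+ 2 <= 1, 0 <= s ^+ 3 <= 1 & 0 <= (1 - s) ^+ 2 * (s + 2)].
Proof.
move=> /andP[s0 s1]; split; rewrite ?exprn_ge0 ?exprn_ile1//.
by rewrite mulr_ge0 ?sqr_ge0//; lra.
Qed.

Lemma spline_range t : 0 <= spline t <= 1.
Proof.
have [t0|[[s s01 ->]|[[s s01 ->]|[[s s01 ->]|t3]]]] := segments t.
- by rewrite spline_eq0// lexx ler01.
- have [] := pw s01; move: s01 => /andP[s0 s1] /andP[? ?] /andP[? ?] _.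
  rewrite /spline rampE// !ramp0 ?expr0n/=; [|lra..].
  by apply/andP; split; lra.
- have [] := pw s01; move: s01 => /andP[s0 s1] /andP[? ?] /andP[? ?] h.
  rewrite /spline (@rampE (1 + s)) ?(@rampE (1 + s - 1)) ?(@ramp0 (1 + s - 2)) ?(@ramp0 (1 + s - 3)) ?expr0n/=; [|lra..].
  have -> : ((1 + s) ^+ 3 - 3 * (1 + s - 1) ^+ 3 + 3 * 0 - 0) / 6 = (1 + 3 * s + 3 * s ^+ 2 - 2 * s ^+ 3) / 6 by field.
  have e : (1 - s) ^+ 2 * (s + 2) = s ^+ 3 - 3 * s + 2 by ring.
  have s2 : s ^+ 2 <= s by rewrite expr2 ler_piMr.
  have s3 : s ^+ 3 <= s ^+ 2 by rewrite exprS ler_piMl ?sqr_ge0.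
  rewrite e in h; by apply/andP; split; lra.
- have [] := pw s01; move: s01 => /andP[s0 s1] /andP[? ?] /andP[? ?] h.
  rewrite /spline (@rampE (3 - s)) ?(@rampE (3 - s - 1)) ?(@rampE (3 - s - 2)) ?(@ramp0 (3 - s - 3)) ?expr0n/=; [|lra..].
  have -> : ((3 - s) ^+ 3 - 3 * (3 - s - 1) ^+ 3 + 3 * (3 - s - 2) ^+ 3 - 0) / 6 = 1 - s ^+ 3 / 6 by field.
  by apply/andP; split; lra.
- by rewrite spline_eq1// lexx ler01.
Qed.

Lemma spline1_bound t : `|spline1 t| <= 1.
Proof.
have [t0|[[s s01 ->]|[[s s01 ->]|[[s s01 ->]|t3]]]] := segments t.
- by rewrite /spline1 !ramp0 ?expr0n/=; [|lra..]; rewrite ler_norml; apply/andP; split; lra.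
- have [] := pw s01; move: s01 => /andP[s0 s1] /andP[? ?] _ _.
  rewrite /spline1 rampE// !ramp0 ?expr0n/=; [|lra..].
  by rewrite ler_norml; apply/andP; split; lra.
- have [] := pw s01; move: s01 => /andP[s0 s1] /andP[? ?] _ _.
  rewrite /spline1 (@rampE (1 + s)) ?(@rampE (1 + s - 1)) ?(@ramp0 (1 + s - 2)) ?(@ramp0 (1 + s - 3)) ?expr0n/=; [|lra..].
  have -> : ((1 + s) ^+ 2 - 3 * (1 + s - 1) ^+ 2 + 3 * 0 - 0) / 2 = (1 + 2 * s - 2 * s ^+ 2) / 2 by field.
  have h : 0 <= (1 - s) ^+ 2 by exact: sqr_ge0.
  have e : (1 - s) ^+ 2 = 1 - 2 * s + s ^+ 2 by ring.
  have h2 : 0 <= (1 / 2 - s) ^+ 2 by exact: sqr_ge0.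
  have e2 : (1 / 2 - s) ^+ 2 = 1 / 4 - s + s ^+ 2 by field.
  rewrite e2 in h2; by rewrite ler_norml; apply/andP; split; lra.
- have [] := pw s01; move: s01 => /andP[s0 s1] /andP[? ?] _ _.
  rewrite /spline1 (@rampE (3 - s)) ?(@rampE (3 - s - 1)) ?(@rampE (3 - s - 2)) ?(@ramp0 (3 - s - 3)) ?expr0n/=; [|lra..].
  have -> : ((3 - s) ^+ 2 - 3 * (3 - s - 1) ^+ 2 + 3 * (3 - s - 2) ^+ 2 - 0) / 2 = s ^+ 2 / 2 by field.
  by rewrite ler_norml; apply/andP; split; lra.
- rewrite /spline1 !rampE; [|lra..].
  have -> : (t ^+ 2 - 3 * (t - 1) ^+ 2 + 3 * (t - 2) ^+ 2 - (t - 3) ^+ 2) / 2 = 0 by field.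
  by rewrite normr0.
Qed.

Lemma spline2_bound t : `|spline2 t| <= 1.
Proof.
rewrite /spline2 /ramp ler_norml; case: (leP t 0) => ?; case: (leP (t - 1) 0) => ?;
  case: (leP (t - 2) 0) => ?; case: (leP (t - 3) 0) => ?; apply/andP; split; lra.
Qed.

Let norm4 (a b c e K : R) : `|a| <= K -> `|b| <= K -> `|c| <= K -> `|e| <= K ->
  `|a - 3 * b + 3 * c - e| <= 8 * K.
Proof. by rewrite !ler_norml => /andP[? ?] /andP[? ?] /andP[? ?] /andP[? ?]; apply/andP; split; lra. Qed.

Lemma spline2_lip t k : `|spline2 (t + k) - spline2 t| <= 8 * `|k|.
Proof.
have s c : t + k - c = t - c + k by lra.
have -> : spline2 (t + k) - spline2 t = (ramp (t + k) - ramp t) - 3 * (ramp (t - 1 + k) - ramp (t - 1))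
   + 3 * (ramp (t - 2 + k) - ramp (t - 2)) - (ramp (t - 3 + k) - ramp (t - 3)).
  by rewrite /spline2 !s; ring.
by apply: norm4; exact: ramp_lip.
Qed.

Lemma spline_taylor t k :
  `|spline (t + k) - spline t - spline1 t * k - spline2 t / 2 * k ^+ 2| <= 8 * `|k| ^+ 3.
Proof.
have s c : t + k - c = t - c + k by lra.
pose D t := ramp (t + k) ^+ 3 - ramp t ^+ 3 - 3 * ramp t ^+ 2 * k - 3 * ramp t * k ^+ 2.
have -> : spline (t + k) - spline t - spline1 t * k - spline2 t / 2 * k ^+ 2 =
    (D t - 3 * D (t - 1) + 3 * D (t - 2) - D (t - 3)) / 6.
  by rewrite /spline /spline1 /spline2 /D !s; field.
rewrite normrM [`|6^-1|]gtr0_norm ?invr_gt0//.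
have h := norm4 (ramp_taylor t k) (ramp_taylor (t - 1) k) (ramp_taylor (t - 2) k) (ramp_taylor (t - 3) k).
rewrite ler_pdivrMr//; apply: le_trans h _.
by rewrite ler_peMr ?mulr_ge0 ?exprn_ge0//; lra.
Qed.

(** For $|k|\ge1$ the range $[0,1]$ is enough. For smaller $k$ the remainder, the linear and the
    quadratic term contribute at most $8|k|$, $|k|$ and $|k|$. *)
Lemma spline_lip t k : `|spline (t + k) - spline t| <= 10 * `|k|.
Proof.
have /andP[a0 a1] := spline_range t; have /andP[b0 b1] := spline_range (t + k).
case: (leP 1 `|k|) => k1.
  by rewrite ler_norml; apply/andP; split; lra.
have h := spline_taylor t k; have h1 := spline1_bound t; have h2 := spline2_bound t.
have k0 : 0 <= `|k| by [].
have e : spline (t + k) - spline t = (spline (t + k) - spline t - spline1 t * k - spline2 t / 2 * k ^+ 2)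
   + spline1 t * k + spline2 t / 2 * k ^+ 2 by ring.
rewrite e; apply: le_trans (ler_normD _ _) _; apply: le_trans (lerD (ler_normD _ _) (lexx _)) _.
have e1 : `|spline1 t * k| <= `|k| by rewrite normrM ler_piMl.
have e2 : `|spline2 t / 2 * k ^+ 2| <= `|k|.
  rewrite normrM normrX expr2 mulrA -[leRHS]mul1r ler_wpM2r// -[leRHS]mulr1 ler_pM ?(ltW k1)//.
  by rewrite normrM [`|2^-1|]gtr0_norm ?invr_gt0//; lra.
have e3 : `|k| ^+ 3 <= `|k| by rewrite -[leRHS]expr1 ler_wiXn2l// ltW.
lra.
Qed.

Lemma measurable_ramp : measurable_fun [set: R] ramp.
Proof. exact: measurable_maxr. Qed.

Let mrampX (j : nat) c : measurable_fun [set: R] (fun t => ramp (t - c) ^+ j).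
Proof.
apply: measurable_funX; apply: (measurableT_comp measurable_ramp).
exact: measurable_funB.
Qed.

Let mramp0X (j : nat) : measurable_fun [set: R] (fun t => ramp t ^+ j).
Proof. by have := mrampX j 0; under eq_fun do rewrite subr0. Qed.

Lemma spline_taylor2 : taylor2 10 8 spline spline1 spline2.
Proof.
have mj j : measurable_fun [set: R] (fun t => ramp t ^+ j - 3 * ramp (t - 1) ^+ j +
    3 * ramp (t - 2) ^+ j - ramp (t - 3) ^+ j).
  apply: measurable_funB; last exact: mrampX.
  apply: measurable_funD; last by apply: measurable_funM => //; exact: mrampX.
  by apply: measurable_funB; [exact: mramp0X|apply: measurable_funM => //; exact: mrampX].
split.
- split; [by apply: measurable_funM => //; exact: mj..|].
  by have := mj 1%N; under eq_fun do rewrite !expr1.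
- split=> t; first by have /andP[? ?] := spline_range t; rewrite ger0_norm//; lra.
    by apply: le_trans (spline1_bound t) _; lra.
  by apply: le_trans (spline2_bound t) _; lra.
- exact: spline_lip.
- exact: spline2_lip.
- exact: spline_taylor.
Qed.

Lemma taylor2_affine (B C l c : R) (u u1 u2 : R -> R) : 0 < l -> taylor2 B C u u1 u2 ->
  taylor2 (B * (1 + l + l ^+ 2)) (C * l ^+ 3) (fun t => u (l * (t - c)))
    (fun t => l * u1 (l * (t - c))) (fun t => l ^+ 2 * u2 (l * (t - c))).
Proof.
move=> l0 [[mu mu1 mu2] [uB u1B u2B] ul u2l ut].
have B0 : 0 <= B by exact: le_trans (normr_ge0 _) (uB 0).
have l2 := sqr_ge0 l; have nl := gtr0_norm l0.
have nl2 : `|l ^+ 2| = l ^+ 2 by rewrite ger0_norm.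
have maff : measurable_fun [set: R] (fun t => l * (t - c)).
  by apply: measurable_funM => //; exact: measurable_funB.
have aff a k : l * (a + k - c) = l * (a - c) + l * k by ring.
have p1 : 0 <= B * l by rewrite mulr_ge0// ltW.
have p2 : 0 <= B * l ^+ 2 by rewrite mulr_ge0.
have eB : B * (1 + l + l ^+ 2) = B + B * l + B * l ^+ 2 by ring.
split.
- split; first exact: (measurableT_comp mu maff).
    by apply: measurable_funM => //; exact: (measurableT_comp mu1 maff).
  by apply: measurable_funM => //; exact: (measurableT_comp mu2 maff).
- split=> a; rewrite eB.
  + by apply: le_trans (uB _) _; lra.
  + rewrite normrM nl mulrC; apply: le_trans (ler_wpM2r (ltW l0) (u1B _)) _; lra.
  + rewrite normrM nl2 mulrC; apply: le_trans (ler_wpM2r l2 (u2B _)) _; lra.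
- move=> a k; rewrite aff; apply: le_trans (ul _ _) _.
  rewrite normrM nl mulrA ler_wpM2r// eB; lra.
- move=> a k; rewrite aff -mulrBr normrM nl2.
  apply: le_trans (ler_wpM2l l2 (u2l _ _)) _.
  by rewrite normrM nl (_ : l ^+ 2 * (C * (l * `|k|)) = C * l ^+ 3 * `|k|)//; ring.
- move=> a k; rewrite aff; move: (l * (a - c)) => b.
  have -> : u (b + l * k) - u b - l * u1 b * k - l ^+ 2 * u2 b / 2 * k ^+ 2 =
      u (b + l * k) - u b - u1 b * (l * k) - u2 b / 2 * (l * k) ^+ 2 by field.
  by apply: le_trans (ut _ _) _; rewrite normrM nl exprMn mulrA.
Qed.

End spline.

(** The spline rises from $0$ to $1$ over $[0,3]$; dilated by [3 / del] it lies between the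
    indicators of $Y>c+\delta$ and of $Y>c$. *)
Lemma spline_cdf d (T : measurableType d) (R : realType) (P : probability T R) (Y : T -> R) (c del : R) :
  0 < del -> measurable_fun [set: T] Y ->
  1 - fine (P [set t | Y t <= c + del]) <= \int[P]_t spline (3 / del * (Y t - c)) <=
  1 - fine (P [set t | Y t <= c]).
Proof.
move=> d0 mY; have l0 : 0 < 3 / del by rewrite divr_gt0.
have [[ms _ _] [sB _ _] _ _ _] := taylor2_affine c l0 (@spline_taylor2 R).
have is_ : intg P (fun t => spline (3 / del * (Y t - c))).
  by apply: (@intg_bounded _ _ _ _ _ (10 * (1 + 3 / del + (3 / del) ^+ 2))) => //; exact: (measurableT_comp ms mY).
have mA b : measurable [set t | Y t <= b].
  rewrite -[X in measurable X]setTI; apply: measurable_fun_le => //.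
have E b : 1 - fine (P [set t | Y t <= b]) = \int[P]_t (1 - \1_[set t | Y t <= b] t).
  rewrite (RintegralB measurableT (intg_cst P 1) (intg_indic P (mA b))) (Rintegral_cstp P).
  by rewrite (measure_RintegralE P (mA b)).
have iE b : intg P (fun t => 1 - \1_[set t | Y t <= b] t : R).
  by apply: intgB; [exact: intg_cst|exact: intg_indic].
rewrite !E; apply/andP; split; apply: le_Rintegral => // t _; rewrite indicE.
- have /andP[s0 s1] := spline_range (3 / del * (Y t - c)).
  case: (boolP (t \in _)) => [_|]; first by rewrite subrr.
  rewrite notin_setE/= => /negP; rewrite -ltNge => h; rewrite subr0 spline_eq1//.
  by rewrite mulrAC ler_pdivlMr// ler_pM2l//; lra.
- have /andP[s0 s1] := spline_range (3 / del * (Y t - c)).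
  case: (boolP (t \in _)) => [|_]; last by rewrite subr0.
  rewrite inE/= => h; rewrite subrr spline_eq0// pmulr_rle0//; lra.
Qed.

(** Splines rising over $[x-\delta',x]$ and $[x,x+\delta']$ enclose the distribution functions.
    Continuity at $x$ and the convergence of the spline integrals each contribute half of the
    error. *)
Lemma cvg_cdf d (T : measurableType d) (R : realType) (P : probability T R) (X : nat -> T -> R)
    (m : probability (measurableTypeR R) R) :
  (forall n, measurable_fun [set: T] (X n)) ->
  (forall l c : R, 0 < l -> \int[P]_t spline (l * (X n t - c)) @[n --> \oo] -->
     \int[m]_y spline (l * (y - c))) ->
  cvg_in_distribution P X m.
Proof.
move=> mX sX; split=> // x cx.
pose F y := fine (m `]-oo, y]%classic).
have Ffin y : m `]-oo, y]%classic \is a fin_num by apply: fin_num_measure.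
have mA n : measurable [set t | X n t <= x].
  rewrite -[Y in measurable Y]setTI; apply: measurable_fun_le => //.
have Fx : F y @[y --> x] --> F x.
  by apply: fine_cvg; rewrite fineK.
rewrite -(fineK (Ffin x)).
have -> : (fun n => P [set t | X n t <= x]) = (fun n => (fine (P [set t | X n t <= x]))%:E).
  by apply/funext => n; rewrite fineK//; apply: fin_num_measure.
apply: cvg_EFin; first by near=> n.
apply/cvgrPdist_le => /= e e0.
have e20 : 0 < e / 2 by rewrite divr_gt0.
have /cvgrPdist_le /(_ _ e20) /nbhs_ballP[del /= del0 hdel] := Fx.
pose del' := del / 2; have d0 : 0 < del' by rewrite divr_gt0.
have l0 : 0 < 3 / del' by rewrite divr_gt0.
have hF y : `|y - x| <= del' -> `|F x - F y| <= e / 2.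
  move=> yx; apply: hdel; rewrite /ball/= distrC; apply: le_lt_trans yx _.
  by rewrite /del'; lra.
have h1 := hF (x + del') _; have h2 := hF (x - del') _.
have mid : measurable_fun [set: measurableTypeR R] (id : measurableTypeR R -> R) by [].
have /andP[N1 _] := spline_cdf m x d0 mid.
have /andP[_ N2] := spline_cdf m (x - del') d0 mid.
have FE y : fine (m [set t | t <= y]) = F y.
  by rewrite /F; congr (fine (m _)); apply/seteqP; split => z /=; rewrite in_itv.
rewrite !FE in N1 N2.
have /cvgrPdist_le/(_ _ e20) s1 := sX _ x l0.
have /cvgrPdist_le/(_ _ e20) s2 := sX _ (x - del') l0.
near=> n.
have /andP[_ P1] := spline_cdf P x d0 (mX n).
have /andP[P2 _] := spline_cdf P (x - del') d0 (mX n).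
rewrite subrK in P2.
have q1 : `|\int[m]_y spline (3 / del' * (y - x)) - \int[P]_t spline (3 / del' * (X n t - x))| <= e / 2.
  near: n; exact: s1.
have q2 : `|\int[m]_y spline (3 / del' * (y - (x - del'))) -
    \int[P]_t spline (3 / del' * (X n t - (x - del')))| <= e / 2.
  near: n; exact: s2.
have g1 : `|F x - F (x + del')| <= e / 2 by apply: h1; rewrite addrAC subrr add0r gtr0_norm.
have g2 : `|F x - F (x - del')| <= e / 2 by apply: h2; rewrite addrAC subrr add0r normrN gtr0_norm.
move: P1 P2 q1 q2 g1 g2 N1 N2; rewrite -/(F x) !ler_norml.
move: (F x) (F (x + del')) (F (x - del')) (fine (P _)) => f0 f1 f2 p.
move: (\int[P]_t _) (\int[m]_t _) (\int[P]_t _) (\int[m]_t _) => a1 a2 a3 a4.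
move=> ? ? /andP[? ?] /andP[? ?] /andP[? ?] /andP[? ?] ? ?.
by apply/andP; split; lra.
Unshelve. all: by end_near. Qed.

Theorem theorem1 (R : realType) (d : measure_display) (T : measurableType d)
    (P : probability T R) (W : ladder_edge -> {RV P >-> R})
    (W_indep : mutually_independent W)
    (W_law : forall (e : ladder_edge) (A : set R), measurable A ->
      distribution P (W e) A = exponential_prob 1 A) :
  exists sigma2 : R,
    [/\ 0 < sigma2,
        cvg_in_distribution P
          (fun n t => (ladder_fpt (fun e => W e) n t - n%:R * chi)
                      / Num.sqrt n%:R)
          (normal_prob 0 (Num.sqrt sigma2)),
        (* the integrals and the series below are well defined *)
        [/\ (pi_tilde R).-integrable state_space
              (EFin \o (fun m => ladder_fbar m ^+ 2)),
            forall (n : nat) (m : state R), (0 < n)%N -> state_space m ->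
              (ntransition n m).-integrable state_space (EFin \o ladder_fbar),
            forall n : nat, (0 < n)%N -> (pi_tilde R).-integrable state_space
              (EFin \o (fun m => ladder_fbar m * iter_fbar n m)) &
            cvgn (fun N => \sum_(1 <= n < N)
              \int[pi_tilde R]_(m in state_space)
                (ladder_fbar m * iter_fbar n m))] &
        sigma2 = \int[pi_tilde R]_(m in state_space) (ladder_fbar m ^+ 2)
          + 2 * limn (fun N => \sum_(1 <= n < N)
              \int[pi_tilde R]_(m in state_space)
                (ladder_fbar m * iter_fbar n m))].
Proof.
have [h [C [mh hC hP hN]]] := @corrector R.
have [i2 ifn cu sE] := green_kubo mh hC hP hN.
have s0 := asymptotic_variance_gt0 mh hC hP.
exists (asymptotic_variance h); split => //; last first.
  by split => // n m _ _; exact: intg_ntransition_fbar.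
set sigma := Num.sqrt _; have sigma0 : 0 < sigma by rewrite sqrtr_gt0.
have sigma2E : sigma ^+ 2 = asymptotic_variance h by rewrite sqr_sqrtr// ltW.
have mv := measurable_cond_variance mh hC hP.
have vB := norm_cond_variance mh hC hP.
have mv' : measurable_fun [set: R] (fun r => cond_variance h r - sigma ^+ 2) by exact: measurable_funB.
have vB' r : `|cond_variance h r - sigma ^+ 2| <= variance_bound C + `|sigma ^+ 2|.
  by apply: le_trans (ler_normB _ _) _; rewrite lerD2r; exact: vB.
have v0 : \int[pi_prob]_r (cond_variance h r - sigma ^+ 2) = 0.
  have iv : intg (@pi_prob R) (cond_variance h) 
    by apply: (@intg_bounded _ _ _ _ _ (variance_bound C)).
  rewrite (RintegralB measurableT iv (intg_cst (@pi_prob R) _)) -/(asymptotic_variance h) -sigma2E.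
  by apply/eqP; rewrite subr_eq0; apply/eqP/esym; exact: (Rintegral_cstp (@pi_prob R)).
(* A second Poisson equation, for the fluctuation of the conditional variance: it is bounded, so
   [poisson] applies directly, and it has mean zero because $\sigma^2$ is the mean of the
   conditional variance. *)
have [g [Bg [mg gB gP _]]] := poisson mv' vB' v0.
have fptE n t : ladder_fpt (fun e => W e) n t = (chain W n t).1.
  exact: first_passage_timeE.
apply: (@cvg_cdf _ _ _ _ _ (gauss sigma)) => [n|l c l0].
  have mc := (chain_indep W_indep W_law n).1.
  apply: measurable_funM => //; apply: measurable_funB => //.
  rewrite (_ : ladder_fpt _ n = fun t => (chain W n t).1); first exact: (measurableT_comp measurable_fst mc).
  by apply/funext => t; exact: fptE.
have uT := taylor2_affine c l0 (@spline_taylor2 R).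
have -> : (fun n => \int[P]_t spline (l *
      ((ladder_fpt (fun e => W e) n t - n%:R * chi) / Num.sqrt n%:R - c))) =
    (fun n => \int[P]_t spline (l * (((chain W n t).1 - n%:R * chi) / Num.sqrt n%:R - c))).
  by apply/funext => n; apply: eq_Rintegral => t _; rewrite fptE.
exact: (test_function_cvg W_indep W_law mh hC hP mg gB sigma0 gP uT).
Qed.
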